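(* For every $1\leq M<\infty$ there exists a positive, finite number $\Lambda$, depending only on $M$, with the following property. Suppose $m,n$ are positive integers, $m\leq n\leq M$, $U$ is an open subset of $\mathbf{R}^n$, $V$ is an $m$ dimensional varifold in $U$, $\|\delta V\|$ is a Radon measure, $\Theta^m(\|V\|,x)\geq 1$ for $\|V\|$ almost all $x$, $E$ is $\|V\|+\|\delta V\|$ measurable, $B$ is a closed subset of $\operatorname{Bdry}U$, and $$(\|V\|+\|\delta V\|)(E\cap K)+\|V\partial E\|(U\cap K)<\infty,$$ $$\int_{E\times\mathbf{G}(n,m)}P_\natural\bullet D\theta(x)\,dV(x,P)=((\delta V)\llcorner E)(\theta|U)-(V\partial E)(\theta|U)$$ whenever $K$ is a compact subset of $\mathbf{R}^n\setminus B$ and $\theta\in\mathscr{D}(\mathbf{R}^n\setminus B,\mathbf{R}^n)$. Suppose further $1\leq Q\leq M$, $0<r<\infty$, and $$\|V\|(E)\leq(Q-M^{-1})\boldsymbol{\alpha}(m)r^m,\qquad\|V\|(E\cap\{x:\Theta^m(\|V\|,x)<Q\})\leq\Lambda^{-1}r^m.$$ Then $$\|V\|(E\cap\{x:\mathbf{U}(x,r)\subset\mathbf{R}^n\setminus B\})^{1-1/m}\leq\Lambda\big(\|V\partial E\|(U)+\|\delta V\|(E)\big),$$ where $0^0=0$.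
   Context: Measures are outer measures. $\mathbf{U}(x,r)$, $\mathbf{B}(x,r)$ are open and closed balls; $\boldsymbol{\alpha}(m)$ is the Lebesgue measure of the unit ball in $\mathbf{R}^m$; $\Theta^m(\mu,x)=\lim_{r\to0+}\mu(\mathbf{B}(x,r))/(\boldsymbol{\alpha}(m)r^m)$. $\operatorname{Bdry}U$ is the topological boundary of $U$. $\mathbf{G}(n,m)$ is the set of $m$ dimensional subspaces of $\mathbf{R}^n$; $P_\natural$ is the orthogonal projection onto $P$; $\sigma\bullet\tau=\operatorname{trace}(\sigma^\ast\circ\tau)$. $\mathscr{D}(\Omega,\mathbf{R}^n)$: smooth compactly supported functions $\Omega\to\mathbf{R}^n$. An $m$ dimensional varifold in $U$ is a Radon measure $V$ over $U\times\mathbf{G}(n,m)$; $\|V\|(A)=V(A\times\mathbf{G}(n,m))$; $\delta V(\theta)=\int P_\natural\bullet D\theta(x)\,dV(x,P)$ for $\theta\in\mathscr{D}(U,\mathbf{R}^n)$. For linear $S:\mathscr{D}(U,\mathbf{R}^n)\to\mathbf{R}$, $\|S\|$ is the largest Borel regular measure over $U$ with $\|S\|(G)=\sup\{S(\theta):\operatorname{spt}\theta\subset G,|\theta|\leq1\}$ for open $G\subset U$. If $\|S\|$ is Radon, then $S$ also denotes its unique continuous extension to $\mathbf{L}_1(\|S\|,\mathbf{R}^n)$, and for $\|S\|$ measurable $A$, $(S\llcorner A)(\theta)=S(\theta_A)$ with $\theta_A=\theta$ on $A$, $\theta_A=0$ elsewhere. The distributional $V$ boundary of a $\|V\|+\|\delta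 V\|$ measurable set $E$ is $V\partial E=(\delta V)\llcorner E-\delta(V\llcorner(E\times\mathbf{G}(n,m)))$. *)

(* Defs.v *)
From HB Require Import structures.
From mathcomp Require Import all_boot all_order all_algebra.
From mathcomp Require Import all_classical all_reals all_analysis.

Set Implicit Arguments.
Unset Strict Implicit.
Unset Printing Implicit Defensive.

Import Order.TTheory GRing.Theory Num.Theory.
Import numFieldNormedType.Exports.

Local Open Scope classical_set_scope.
Local Open Scope ring_scope.

(** Conventions.
    - [R^n] is ['rV[R]_n].  Its library norm is the sup norm, which gives the
      usual topology and derivatives; Euclidean quantities use [enorm] below.
    - Linear maps act on row vectors from the right: the matrix [A] stands for
      [x |-> x *m A].
    - A measure over a subset [X] of a space [T] is an outer measure on [T]
      for which the complement of [X] has measure [0].  Outer measures over [X]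
      correspond to these through [A |-> mu (A `&` X)].
    - Integrals with respect to an outer measure are those of the associated
      Caratheodory measure. *)

(** ** Euclidean space *)

Section Euclid.
Context {R : realType} {n : nat}.

Definition dotv (u v : 'rV[R]_n) : R := \sum_i u 0 i * v 0 i.

Definition enorm (u : 'rV[R]_n) : R := Num.sqrt (dotv u u).

Definition eball (x : 'rV[R]_n) (r : R) : set 'rV[R]_n :=
  [set y | enorm (y - x) < r].

Definition ecball (x : 'rV[R]_n) (r : R) : set 'rV[R]_n :=
  [set y | enorm (y - x) <= r].

End Euclid.

Definition Bdry (T : topologicalType) (A : set T) : set T :=
  closure A `\` interior A.

(** Lebesgue outer measure on [R^m], as the infimum of the total volumes of
    countable covers by boxes; the box [(a, b)] is the product of the intervals
    [[a 0 i, b 0 i]]. *)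
Section Lebesgue.
Context {R : realType} (m : nat).

Definition is_box (ab : 'rV[R]_m * 'rV[R]_m) : Prop :=
  forall i, ab.1 0 i <= ab.2 0 i.

Definition box (ab : 'rV[R]_m * 'rV[R]_m) : set 'rV[R]_m :=
  [set x | forall i, ab.1 0 i <= x 0 i <= ab.2 0 i].

Definition box_vol (ab : 'rV[R]_m * 'rV[R]_m) : R :=
  \prod_i (ab.2 0 i - ab.1 0 i).

Definition lebesgue_outer (A : set 'rV[R]_m) : \bar R :=
  ereal_inf [set (\sum_(k <oo) (box_vol (F k))%:E)%E |
    F in [set F : nat -> 'rV[R]_m * 'rV[R]_m |
            (forall k, is_box (F k)) /\ A `<=` \bigcup_k box (F k)]].

Definition alpha : R := fine (lebesgue_outer (ecball 0 1)).

End Lebesgue.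
Arguments alpha R m : clear implicits.

(** ** Outer measures *)

Section Zero.
Context {R : realType} {T : Type}.
Local Open Scope ereal_scope.

Definition omzero (A : set T) : \bar R := 0.

Let omzero0 : omzero set0 = 0. Proof. by []. Qed.
Let omzero_ge0 A : 0 <= omzero A. Proof. by []. Qed.
Let le_omzero : {homo omzero : A B / A `<=` B >-> A <= B}. Proof. by []. Qed.
Let omzero_ss : sigma_subadditive omzero.
Proof. by move=> F; rewrite eseries0. Qed.

HB.instance Definition _ := isOuterMeasure.Build R T omzero
  omzero0 omzero_ge0 le_omzero omzero_ss.

End Zero.

Section Restriction.
Context {R : realType} {T : Type}.
Variables (mu : {outer_measure set T -> \bar R}) (A : set T).
Local Open Scope ereal_scope.

Definition orestr (B : set T) : \bar R := mu (A `&` B).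

Let orestr0 : orestr set0 = 0.
Proof. by rewrite /orestr setI0 outer_measure0. Qed.
Let orestr_ge0 B : 0 <= orestr B. Proof. exact: outer_measure_ge0. Qed.
Let le_orestr : {homo orestr : B C / B `<=` C >-> B <= C}.
Proof. by move=> B C BC; apply: le_outer_measure; exact: setIS. Qed.
Let orestr_ss : sigma_subadditive orestr.
Proof.
by move=> F; rewrite /orestr setI_bigcupr; exact: outer_measure_sigma_subadditive.
Qed.

HB.instance Definition _ := isOuterMeasure.Build R T orestr
  orestr0 orestr_ge0 le_orestr orestr_ss.

End Restriction.

Section Integral.
Context {R : realType} {T : pointedType}.

Definition oint (mu : {outer_measure set T -> \bar R}) (D : set T)
    (f : T -> \bar R) : \bar R :=
  (\int[(mu : set (caratheodory_type mu) -> \bar R)]_(x in D) f x)%E.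

End Integral.

Section Regularity.
Context {R : realType} {T : topologicalType}.
Implicit Types (mu : {outer_measure set T -> \bar R}) (X : set T).
Local Open Scope ereal_scope.

(** [mu] is a Radon measure over the locally compact Hausdorff subspace [X].
    The open subsets of [X] are the sets [G `&` X] with [G] open in [T]. *)
Definition radon_over X mu : Prop :=
  [/\ mu (~` X) = 0,
      (forall K, compact K -> K `<=` X -> mu K < +oo),
      (forall G, open G -> mu.-caratheodory (G `&` X)),
      (forall G, open G -> mu (G `&` X) =
         ereal_sup [set mu K | K in [set K | compact K /\ K `<=` G `&` X]]) &
      (forall A, A `<=` X -> mu A =
         ereal_inf [set mu (G `&` X) | G in [set G | open G /\ A `<=` G]])].

Definition borel_regular_over X mu : Prop :=
  [/\ mu (~` X) = 0,
      (forall G, open G -> mu.-caratheodory (G `&` X)) &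
      (forall A, A `<=` X -> exists B,
         [/\ <<s X, [set G `&` X | G in open] >> B, A `<=` B & mu A = mu B])].

End Regularity.

(** ** The Grassmannian *)

Section Grassmann.
Context {R : realType} {n : nat}.

Definition is_oproj (P : {vspace 'rV[R]_n}) (p : 'M[R]_n) : Prop :=
  forall x : 'rV[R]_n, x *m p \in P /\
    forall y, y \in P -> dotv (x - x *m p) y = 0.

(** The matrix of the orthogonal projection onto [P]; see [oprojP] and
    [oproj_unique]. *)
Definition oproj (P : {vspace 'rV[R]_n}) : 'M[R]_n := get (is_oproj P).

End Grassmann.

(** The subspaces of [R^n], with the topology for which [P |-> oproj P] is a
    homeomorphism onto its image. *)
Definition subsp (R : realType) (n : nat) : Type :=
  initial_topology (@oproj R n).

HB.instance Definition _ (R : realType) n :=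
  Topological.copy (subsp R n) (initial_topology (@oproj R n)).
HB.instance Definition _ (R : realType) n :=
  isPointed.Build (subsp R n) (0%VS : {vspace 'rV[R]_n}).

Definition Gr (R : realType) (n m : nat) : set (subsp R n) :=
  [set P | \dim (P : {vspace 'rV[R]_n}) = m].
Arguments Gr : clear implicits.

Section ProjectionLemmas.
Context {R : realType} {n : nat}.
Implicit Types (u v w : 'rV[R]_n) (P : {vspace 'rV[R]_n}).

Lemma dotvE u v : dotv u v = (u *m v^T) 0 0.
Proof. by rewrite mxE; apply: eq_bigr => i _; rewrite mxE. Qed.

Lemma dotvBl u v w : dotv (u - v) w = dotv u w - dotv v w.
Proof. by rewrite !dotvE mulmxBl !mxE. Qed.

Lemma dotv_eq0 u : (dotv u u == 0) = (u == 0).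
Proof.
rewrite /dotv psumr_eq0 => [|i _]; last by rewrite -expr2 sqr_ge0.
apply/allP/eqP => [h|-> i _]; last by rewrite /= mxE mul0r eqxx.
apply/rowP => i; rewrite mxE; apply/eqP.
by have := h i (mem_index_enum i); rewrite /= mulf_eq0 orbb.
Qed.

Lemma is_oproj_unique P p q : is_oproj P p -> is_oproj P q -> p = q.
Proof.
move=> hp hq; apply/row_matrixP => i; rewrite !rowE; set x := delta_mx _ _.
have [xp xp0] := hp x; have [xq xq0] := hq x.
apply/eqP; rewrite -subr_eq0 -dotv_eq0; set d := x *m p - x *m q.
have dP : d \in P by rewrite memvB.
have -> : dotv d d = dotv (x - x *m q) d - dotv (x - x *m p) d.
  by rewrite -dotvBl; congr dotv; rewrite /d opprB [RHS]addrC addrA subrK.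
by rewrite xp0 // xq0 // subrr.
Qed.

Lemma is_oproj_ex P : exists p, is_oproj P p.
Proof.
pose A : 'M[R]_(\dim P, n) := \matrix_i (vbasis P)`_i.
have mulA (w : 'rV_(\dim P)) : w *m A = \sum_i w 0 i *: (vbasis P)`_i.
  by rewrite mulmx_sum_row; apply: eq_bigr => i _; rewrite rowK.
have Af : row_free (A *m A^T).
  rewrite -kermx_eq0; apply/rowV0P => w /sub_kermxP.
  rewrite mulmxA => w0.
  have : w *m A == 0.
    by rewrite -dotv_eq0 dotvE trmx_mul mulmxA w0 mul0mx mxE.
  rewrite mulA => /eqP s0; apply/rowP => i; rewrite mxE.
  have /freeP/(_ (fun i => w 0 i)) := basis_free (vbasisP P).
  by apply.
have Au : A *m A^T \in unitmx by rewrite -row_free_unit.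
exists (A^T *m invmx (A *m A^T) *m A) => x; split.
  rewrite mulmxA mulA; apply: memv_suml => i _; apply: memvZ.
  by apply: vbasis_mem; rewrite mem_nth // size_tuple.
move=> y /coord_vbasis yE.
have {yE} -> : y = (\row_i coord (vbasis P) i y) *m A.
  by rewrite mulA {1}yE; apply: eq_bigr => i _; rewrite mxE.
rewrite dotvE trmx_mul mulmxA mulmxBl !mulmxA -(mulmxA _ A A^T).
by rewrite mulmxKV // subrr mxE.
Qed.

Lemma oprojP P : is_oproj P (oproj P).
Proof. by apply: getPex; exact: is_oproj_ex. Qed.

Lemma oproj_unique P p : is_oproj P p -> p = oproj P.
Proof. by move=> hp; apply: is_oproj_unique hp (oprojP P). Qed.

End ProjectionLemmas.

(** ** Test functions and distributions *)

Section Distributions.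
Context {R : realType} {n : nat}.
Local Notation E := 'rV[R]_n.
Implicit Types (U G : set E) (theta : E -> E) (S : (E -> E) -> R).

Fixpoint Ck (k : nat) theta : Prop :=
  if k is k'.+1 then
    (forall x, differentiable theta x) /\
    (forall v, Ck k' (fun x => 'D_v theta x))
  else continuous theta.

Definition spt theta : set E := closure [set x | theta x != 0].

(** Members of [D(U, R^n)], extended by zero to [R^n]. *)
Definition testfun U theta : Prop :=
  [/\ forall k, Ck k theta, compact (spt theta) & spt theta `<=` U].

(** [theta_A]; for [A] an open set [U] it also serves as the restriction
    [theta | U], since measures over [U] ignore the complement of [U]. *)
Definition cut0 (A : set E) theta : E -> E := patch (fun=> 0) A theta.

Definition is_varnorm U S (mu : {outer_measure set E -> \bar R}) : Prop :=
  borel_regular_over U mu /\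
  forall G, open G -> G `<=` U ->
    mu G = ereal_sup [set (S theta)%:E | theta in
      [set theta | [/\ testfun U theta, spt theta `<=` G &
                       forall x, enorm (theta x) <= 1]]].

(** The measure [||S||]. *)
Definition varnorm U S : {outer_measure set E -> \bar R} :=
  xget (omzero : {classic {outer_measure set E -> \bar R}})
    [set mu | is_varnorm U S mu /\
       forall nu, is_varnorm U S nu -> forall A, (nu A <= mu A)%E].

Definition L1 (mu : {outer_measure set E -> \bar R}) (f : E -> E) : Prop :=
  (forall G, open G -> mu.-caratheodory (f @^-1` G)) /\
  (oint mu setT (fun x => (enorm (f x))%:E) < +oo)%E.

(** [T] is the continuous extension of [S] to [L1 (varnorm U S)]; the last
    clause only normalizes [T] off its domain, which makes it unique. *)
Definition is_L1_extension U S (T : (E -> E) -> R) : Prop :=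
  let mu := varnorm U S in
  [/\ (forall theta, testfun U theta -> T theta = S theta),
      (forall f, L1 mu f -> forall e : R, 0 < e ->
         exists2 d : R, 0 < d & forall g, L1 mu g ->
           (oint mu setT (fun x => (enorm (g x - f x))%:E) < d%:E)%E ->
           `|T g - T f| < e) &
      (forall f, ~ L1 mu f -> T f = 0)].

Definition L1_extension U S : (E -> E) -> R := get (is_L1_extension U S).

(** The restriction of [S] to [A]. *)
Definition dist_restr U S (A : set E) : (E -> E) -> R :=
  fun theta => L1_extension U S (cut0 A theta).

End Distributions.

(** ** Varifolds *)

Section Weight.
Context {R : realType} {n : nat} (m : nat).
Variable V : {outer_measure set ('rV[R]_n * subsp R n) -> \bar R}.
Local Open Scope ereal_scope.

(** The measure [||V||]. *)
Definition weight (A : set 'rV[R]_n) : \bar R := V (A `*` Gr R n m).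

Let weight0 : weight set0 = 0.
Proof. by rewrite /weight set0X outer_measure0. Qed.
Let weight_ge0 A : 0 <= weight A. Proof. exact: outer_measure_ge0. Qed.
Let le_weight : {homo weight : A B / A `<=` B >-> A <= B}.
Proof. by move=> A B AB; apply: le_outer_measure; apply: setSX. Qed.
Let weight_ss : sigma_subadditive weight.
Proof.
move=> F; rewrite /weight.
have -> : (\bigcup_k F k) `*` Gr R n m = \bigcup_k (F k `*` Gr R n m).
  by apply/seteqP; split=> [[x P] [[k _ Fx] GP]|[x P] [k _ [Fx GP]]];
    [exists k|split=> //; exists k].
exact: outer_measure_sigma_subadditive.
Qed.

HB.instance Definition _ := isOuterMeasure.Build R 'rV[R]_n weight
  weight0 weight_ge0 le_weight weight_ss.

End Weight.

Section Varifolds.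
Context {R : realType} {n : nat}.
Local Notation E := 'rV[R]_n.
Implicit Types (U A : set E) (theta : E -> E).
Implicit Type V : {outer_measure set (E * subsp R n) -> \bar R}.

Definition varifold (m : nat) U V : Prop := radon_over (U `*` Gr R n m) V.

(** [trace (sigma^* \o tau)] for the maps with matrices [A] and [B]; with the
    right action the composite has matrix [B *m A^T], of the same trace. *)
Definition mxdot (A B : 'M[R]_n) : R := \tr (A^T *m B).

(** The integral of [P_natural . D theta (x)] over [(x, P)] in [D]. *)
Definition int_div V (D : set (E * subsp R n)) theta : R :=
  fine (oint V D (fun z => (mxdot (oproj z.2) ('J theta z.1))%:E)).

(** Over [setT], as the complement of the space of [V] is [V] null. *)
Definition first_var V : (E -> E) -> R := int_div V setT.

(** The distributional [V] boundary of [A]. *)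
Definition vbdry (m : nat) U V A : (E -> E) -> R := fun theta =>
  dist_restr U (first_var V) A theta
  - first_var (orestr V (A `*` Gr R n m)) theta.

(** [l] is the [m] dimensional density of [mu] at [x]. *)
Definition has_density (m : nat) (mu : set E -> \bar R) (x : E) (l : \bar R)
    : Prop :=
  (mu (ecball x r) * ((alpha R m * r ^+ m)^-1)%:E)%E @[r --> 0^'+] --> l.

End Varifolds.

(** [a `^ p] with the convention [0 `^ 0 = 0]. *)
Definition pow00 (R : realType) (a : \bar R) (p : R) : \bar R :=
  if a == 0%E then 0%E else poweR a p.

(* Main.v *)
Require Import Defs.
From HB Require Import structures.
From mathcomp Require Import all_boot all_order all_algebra.
From mathcomp Require Import all_classical all_reals all_analysis.
From mathcomp Require Import ring lra measurable_realfun.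

Set Implicit Arguments.
Unset Strict Implicit.
Unset Printing Implicit Defensive.

Import Order.TTheory GRing.Theory Num.Theory.
Import numFieldNormedType.Exports.
Import HBNNSimple.

Local Open Scope classical_set_scope.
Local Open Scope ring_scope.

(** The proof rests on the monotonicity formula. Let [W] be the part of the
    weight of [V] in [E], and let [mu S] be the mass of the first variation in
    [E `&` S] plus the mass of the boundary in [U `&` S]. By the hypothesis on
    test fields off [B], the integral over [E] of the divergence, along the
    planes of [V], of a field of length at most one with support in a ball off
    [B] is at most [mu] of that ball ([int_div_le]). Radial fields
    ([radial_field]) turn this into [monotonicity]: for [0 < s < t] and a ball
    [ecball a t] off [B],
    [W (ecball a s) <= (s / t) ^+ m * W (ecball a t) + t * mu (ecball a t)].

    The remaining argument only uses this inequality, Vitali coverings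
    ([vitali_bound]), and the fact that almost every point of [E] sees in [E]
    the full density of the weight ([density_good]).

    Iterating monotonicity over dyadic radii ([chain]) shows that the mass ratio
    at scale [R0] about [y] almost dominates the density at [y], provided [mu] is
    small compared with [W] at every scale up to [R0]. The points at which this
    smallness fails are covered by balls carrying much of [mu], hence have
    little [W] mass. So ([good_point]), if all points of [A0] have density at
    least [q] and balls of radius [R0] about them lie in [O], then either
    [kappa * W A0 <= R0 * mu O] or [q * R0 ^+ m <= (1 + chain_cst * kappa) * W O].

    Let [A] be the set of points whose open [r] ball is off [B]. There are two
    cases ([core_ineq]).

    If the ball of radius [inner_frac * r] about some point of [A] has at least a
    fixed fraction of [r ^+ m] as mass, at least half of it lies at points of
    density at least [Q], because the others have total mass at most
    [r ^+ m / Lambda]. The second alternative above, for [q] close to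
    [Q * alpha] and [R0] close to [r], would give [W] more mass than
    [(Q - M^-1) * alpha * r ^+ m]. So the first one holds, [r ^+ m.-1] is bounded
    by a multiple of the total [mu], and [W A <= M * alpha * r ^+ m] concludes.

    Otherwise almost every point [a] of [A] has a positive density but small mass
    ratio at scale [inner_frac * r], and between these scales there is a radius
    [t] at which the ratio crosses a fixed level. There the second alternative,
    now with the crude density bound [alpha / 2], is excluded by the choice of
    [t], and the first one gives [mu (ecball a t) >= c * t ^+ m.-1] while
    [W (ecball a (5 * t)) <= C * t ^+ m] ([select_radius]). The first bound
    limits [t ^+ m.-1] by the total [mu]; a Vitali covering of [A] by such balls
    then yields [W A ^+ m.-1 <= C * mu ^+ m] ([cover_estimate]).

    [varnorm] and [L1_extension] are chosen objects, equal to zero when there is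
    nothing to choose; the only estimate on them, [ext_bound], holds in this
    case as well because the extension then vanishes at the field concerned. *)

(** * Smooth functions on the line *)

Section SmoothLine.
Context {R : realType}.
Implicit Types (D : set R) (f g : R -> R).

(** Continuity of the last derivative is not recorded: for a function that
    satisfies this for every [k] it is automatic. *)
Fixpoint C1 (k : nat) D f : Prop :=
  if k is k'.+1 then
    exists2 f', (forall x, D x -> is_derive x 1 f (f' x)) & C1 k' D f'
  else True.

Lemma C1_ext k D f g : open D -> (forall x, D x -> f x = g x) ->
  C1 k D f -> C1 k D g.
Proof.
case: k => //= k oD fg [f' f'E kf']; exists f' => // x Dx.
apply: (near_eq_is_derive _ (f'E x Dx)).
by near=> y; apply: fg; near: y; exact: open_nbhs_nbhs.
Unshelve. all: by end_near. Qed.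

Lemma C1_le k D f : C1 k.+1 D f -> C1 k D f.
Proof.
elim: k f => //= k ih f [f' f'E [f2 f2E kf2]].
by exists f' => //; apply: ih; exists f2.
Qed.

Lemma C1_sub k D D' f : D' `<=` D -> C1 k D f -> C1 k D' f.
Proof.
move=> DD; elim: k f => //= k ih f [f' f'E kf'].
by exists f'; [move=> x /DD; exact: f'E|exact: ih].
Qed.

Lemma is_derive_uniq f (x a b : R) :
  is_derive x 1 f a -> is_derive x 1 f b -> a = b.
Proof. by move=> [_ <-] [_ <-]. Qed.

Lemma C1_setU k D D' f : open D -> open D' ->
  C1 k D f -> C1 k D' f -> C1 k (D `|` D') f.
Proof.
move=> oD oD'; elim: k f => //= k ih f [f1 f1E kf1] [f2 f2E kf2].
pose f' x := if x \in D then f1 x else f2 x.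
have f'1 x : D x -> f1 x = f' x by move=> Dx; rewrite /f' mem_set.
have f'2 x : D' x -> f2 x = f' x.
  move=> D'x; rewrite /f'; case: ifPn => // /set_mem Dx.
  exact: is_derive_uniq (f2E _ D'x) (f1E _ Dx).
exists f'; last by apply: ih; [exact: C1_ext oD f'1 kf1|exact: C1_ext oD' f'2 kf2].
by move=> x [Dx|Dx]; [rewrite -(f'1 x Dx); exact: f1E|rewrite -(f'2 x Dx); exact: f2E].
Qed.

Lemma C1_cst k D (c : R) : C1 k D (fun=> c).
Proof.
elim: k c => //= k ih c; exists (fun=> 0); last exact: ih.
by move=> x _; exact: is_derive_cst.
Qed.

Lemma C1D k D f g : C1 k D f -> C1 k D g -> C1 k D (fun x => f x + g x).
Proof.
elim: k f g => //= k ih f g [f' f'E kf'] [g' g'E kg'].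
exists (fun x => f' x + g' x); last exact: ih.
by move=> x Dx; have := f'E _ Dx; have := g'E _ Dx => hf hg; apply: is_deriveD.
Qed.

Lemma C1M k D f g : C1 k D f -> C1 k D g -> C1 k D (fun x => f x * g x).
Proof.
elim: k f g => //= k ih f g fk gk.
have [f' f'E kf'] := fk; have [g' g'E kg'] := gk.
exists (fun x => f x * g' x + g x * f' x).
  by move=> x Dx; have := f'E _ Dx; have := g'E _ Dx => hf hg; apply: is_deriveM.
by apply: C1D; apply: ih => //; exact: C1_le.
Qed.

Lemma C1_comp k D D' f g : (forall x, D x -> D' (f x)) ->
  C1 k D f -> C1 k D' g -> C1 k D (fun x => g (f x)).
Proof.
move=> fD; elim: k f g fD => //= k ih f g fD fk gk.
have [f' f'E kf'] := fk; have [g' g'E kg'] := gk.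
exists (fun x => g' (f x) * f' x).
  move=> x Dx.
  have hf := f'E _ Dx; have hg := g'E _ (fD _ Dx).
  exact: (is_derive1_comp hg hf).
by apply: C1M => //; apply: ih => //; exact: C1_le.
Qed.

Lemma C1_id k D : C1 k D id.
Proof.
case: k => //= k; exists (fun=> 1); last exact: C1_cst.
by move=> x _; exact: is_derive_id.
Qed.

Lemma C1_powR k (p : R) : C1 k [set x | 0 < x] (fun x => x `^ p).
Proof.
elim: k p => //= k ih p; exists (fun x => p * x `^ (p - 1)).
  by move=> x x0; exact: is_derive1_powR.
by apply: C1M => //; exact: C1_cst.
Qed.

(** Passes from an unspecified derivative to [derive1], as needed when
    derivatives of compositions are iterated. *)
Lemma C1_derive k f : C1 k.+1 setT f -> C1 k setT (derive1 f).
Proof.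
move=> [f' f'E]; apply: C1_ext; first exact: openT.
by move=> x _; have [_ <-] := f'E x I; rewrite derive1E.
Qed.

Lemma C1_is_derive f (x : R) : C1 1 setT f -> is_derive x 1 f ((derive1 f) x).
Proof.
by move=> [f' f'E _]; have h := f'E x I; rewrite derive1E; apply/derivableP; case: h.
Qed.

Lemma C1_continuous f : C1 1 setT f -> continuous f.
Proof.
move=> [f' f'E _] x; have [h _] := f'E x I.
by apply: differentiable_continuous; exact/derivable1_diffP.
Qed.

(** The factors [x ^- p] make the family stable under differentiation up to
    linear combinations. *)
Definition flat (p : nat) (x : R) : R :=
  if 0 < x then x ^- p * expR (- x^-1) else 0.

Lemma flat_ge0 p x : 0 <= flat p x.
Proof.
rewrite /flat; case: ifP => // x0.
by rewrite mulr_ge0 ?expR_ge0// invr_ge0 exprn_ge0// ltW.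
Qed.

(** Since [expR (x^-1)] exceeds every power of [x^-1], up to a constant. The quadratic bound gives
    the derivative [0] at the origin. *)
Lemma flat_le p x : flat p x <= (p.+2)`!%:R * `|x| ^+ 2.
Proof.
rewrite /flat; case: ifPn => [x0|_]; last by rewrite mulr_ge0// exprn_ge0.
rewrite gtr0_norm// expRN mulrC ler_pdivrMr ?exprn_gt0//.
rewrite invf_ple ?posrE ?expR_gt0//; last first.
  by rewrite !mulr_gt0 ?exprn_gt0// ltr0n fact_gt0.
have := @expR_ge1Dxn _ x^-1 p.+1 _; rewrite invr_ge0 => /(_ (ltW x0)).
apply: le_trans; rewrite -mulrA -exprD addnC addn2.
rewrite invfM mulrC exprVn.
by rewrite lerDr ler01.
Qed.

(** The derivative of [flat p] is [- p * flat p.+1 + flat p.+2], so that one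
    induction on the order treats all [p] together. *)
Lemma C1_flat k p : C1 k setT (flat p).
Proof.
elim: k p => //= k ih p.
exists (fun x => - p%:R * flat p.+1 x + flat p.+2 x); last first.
  by apply: C1D => //; apply: C1M => //; exact: C1_cst.
move=> x _; case: (ltrgtP x 0) => x0.
- have -> : - p%:R * flat p.+1 x + flat p.+2 x = 0.
    by rewrite /flat ltNge (ltW x0) /= mulr0 addr0.
  apply: (@near_eq_is_derive _ _ _ (cst 0)).
  near=> y; rewrite /flat ltNge ltW//=.
  by near: y; exact: lt_nbhsl.
- have -> : - p%:R * flat p.+1 x + flat p.+2 x =
      x ^- p * (x ^- 2 * expR (- x^-1)) + expR (- x^-1) * (- p%:R * x ^- p.+1).
    rewrite /flat x0 -(addn2 p) exprD invfM; ring.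
  apply: (@near_eq_is_derive _ _ _ ((fun y => y ^- p) * (expR \o (fun y => - y^-1)))).
    near=> y; rewrite /flat ifT//.
    by near: y; exact: lt_nbhsr.
  have xn0 : x != 0 by rewrite gt_eqF.
  have hid : is_derive x 1 (fun y : R => y^-1) (- x ^- 2).
    have := @is_deriveV _ id x 1 1 xn0 (is_derive_id x 1).
    by rewrite -[_ *: _]/(_ * _) mulr1.
  have hV : is_derive x 1 (fun y : R => - y^-1) (x ^- 2).
    by apply: is_derive_eq; rewrite opprK.
  have hp : is_derive x 1 (fun y : R => y ^- p) (- p%:R * x ^- p.+1).
    have := is_deriveX p (is_derive_id x (1 : R)); rewrite exprfctE => hX.
    have := is_deriveV _ hX; rewrite expf_neq0// => /(_ isT) hV'.
    apply: is_derive_eq hV' _.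
    rewrite -![_ *: _]/(_ * _) mulr1.
    case: p {ih hX} => [|p] /=; first by rewrite !(mul0r, mulr0, oppr0).
    have := expf_neq0 p xn0; rewrite !exprS; move: (x ^+ p) => y y0.
    by move: (p.+1%:R : R) => c; field; rewrite xn0 y0.
  apply: is_derive_eq; rewrite -![_ *: _]/(_ * _) /=.
  by rewrite (mulrC (expR _) (x ^- 2)).
- rewrite x0 /flat ltxx mulr0 addr0 -/(flat p).
  suff h : (fun h : R => h^-1 *: ((flat p \o shift 0) (h *: 1) - flat p 0)) @ 0^' --> (0 : R).
    by apply: DeriveDef; [apply/cvg_ex; exists 0|exact: cvg_lim h].
  have flat0 q : flat q 0 = 0 by rewrite /flat ltxx.
  apply/cvgr0Pnorm_le => e e0.
  pose C : R := (p.+2)`!%:R.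
  have C0 : 0 < C by rewrite ltr0n fact_gt0.
  near=> h => /=.
  have h0 : h != 0 by near: h; exact: nbhs_dnbhs_neq.
  rewrite flat0 subr0 addr0 -[h *: 1]/(h * 1) mulr1 -[_ *: _]/(_ * _).
  rewrite normrM normfV ler_pdivrMl ?normr_gt0//.
  rewrite ger0_norm ?flat_ge0//; apply: le_trans (flat_le _ _) _.
  rewrite -/C expr2 mulrA mulrC ler_wpM2l//.
  rewrite -ler_pdivlMl//.
  near: h; apply: dnbhs0_le.
  by rewrite mulr_gt0 ?invr_gt0.
Unshelve. all: by end_near. Qed.

Definition step (x : R) : R := flat 0 x / (flat 0 x + flat 0 (1 - x)).

Lemma flat_gt0 x : 0 < x -> 0 < flat 0 x.
Proof. by move=> x0; rewrite /flat x0 expr0 invr1 mul1r expR_gt0. Qed.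

Lemma flat_le0 p x : x <= 0 -> flat p x = 0.
Proof. by move=> x0; rewrite /flat ltNge x0. Qed.

Lemma step_den_gt0 x : 0 < flat 0 x + flat 0 (1 - x).
Proof.
have [x0|x0] := ltP 0 x.
  by rewrite ltr_pwDl ?flat_gt0 ?flat_ge0.
by rewrite ltr_wpDl ?flat_ge0// flat_gt0// subr_gt0 (le_lt_trans x0).
Qed.

Lemma C1_step k : C1 k setT step.
Proof.
have h : step = fun x => flat 0 x * (flat 0 x + flat 0 (1 - x)) `^ (-1).
  by apply/funext => x; rewrite powR_inv1// ltW// step_den_gt0.
rewrite h; apply: C1M; first exact: C1_flat.
apply: (@C1_comp k _ [set x | 0 < x] _ (fun x => x `^ (-1))).
- by move=> x _; exact: step_den_gt0.
- apply: C1D; first exact: C1_flat.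
  apply: (@C1_comp k _ setT (fun x => 1 - x) (flat 0)) => //; last exact: C1_flat.
  apply: C1D; first exact: C1_cst.
  have -> : -%R = (fun x : R => -1 * x) by apply/funext => x; rewrite mulN1r.
  by apply: C1M; [exact: C1_cst|exact: C1_id].
- exact: C1_powR.
Qed.

Lemma step_ge0 x : 0 <= step x.
Proof. by rewrite divr_ge0 ?flat_ge0// ltW// step_den_gt0. Qed.

Lemma step_le1 x : step x <= 1.
Proof. by rewrite ler_pdivrMr ?step_den_gt0// mul1r lerDl flat_ge0. Qed.

Lemma step0 x : x <= 0 -> step x = 0.
Proof. by move=> x0; rewrite /step flat_le0// mul0r. Qed.

Lemma step1 x : 1 <= x -> step x = 1.
Proof.
move=> x1; rewrite /step (@flat_le0 _ (1 - x)) ?subr_le0// addr0 divff//.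
by rewrite gt_eqF// flat_gt0// (lt_le_trans ltr01).
Qed.

End SmoothLine.

(** * The radial profile *)

Section Profile.
Context {R : realType}.
Implicit Types f : R -> R.

Lemma derive_ge0_le f f' (a b : R) :
  (forall x, a <= x <= b -> is_derive x 1 f (f' x)) ->
  (forall x, a < x < b -> 0 <= f' x) -> a <= b -> f a <= f b.
Proof.
move=> fE f0; rewrite le_eqVlt => /predU1P[->//|ab].
have [x||x + E] := @MVT R f f' a b ab.
- rewrite in_itv/= => /andP[ax xb]; apply: fE; rewrite !ltW//.
- apply: derivable_within_continuous => x; rewrite in_itv/= => xab.
  by have [] := fE _ xab.
rewrite in_itv/= => xab; rewrite -subr_ge0 E.
by rewrite mulr_ge0 ?f0// subr_ge0 ltW.
Qed.

Lemma derive_le0_ge f f' (a b : R) :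
  (forall x, a <= x <= b -> is_derive x 1 f (f' x)) ->
  (forall x, a < x < b -> f' x <= 0) -> a <= b -> f b <= f a.
Proof.
move=> fE f0 ab; rewrite -lerN2.
apply: (@derive_ge0_le (- f) (fun x => - f' x)) ab => [x /fE h|x /f0].
  exact: is_deriveN.
by rewrite oppr_ge0.
Qed.

(** The integral over [`[0, x]]: to the right of [0] by the fundamental theorem,
    and up to [c] because there both the integral and [b] vanish. *)
Lemma primitive_ex (b : R -> R) (c : R) : 0 < c -> continuous b ->
  (forall x, x <= c -> b x = 0) ->
  exists F : R -> R, forall x : R, is_derive x 1 F (b x).
Proof.
move=> c0 cb b0.
pose F x := (\int[@lebesgue_measure R]_(t in `[0%R, x]) b t)%R.
exists F => x; have [xc|cx] := ltP x c.
  rewrite b0 ?ltW//; apply: (@near_eq_is_derive _ _ _ (cst 0)).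
  near=> y; rewrite /F /Rintegral integral0_eq// => z.
  rewrite /= in_itv/= => /andP[_ zy]; rewrite b0//.
  apply: le_trans zy _; apply: ltW; near: y; exact: lt_nbhsl.
have x0 : 0 < x by exact: lt_le_trans cx.
have [||dF FE] := @continuous_FTC1_closed R b 0 x (x + 1) _ _ x0 (cb x).
- by rewrite ltrDl.
- apply: continuous_compact_integrable; first exact: segment_compact.
  by apply: continuous_subspaceT => ?; exact: cb.
by rewrite -FE derive1E; apply/derivableP.
Unshelve. all: by end_near. Qed.

Lemma powR_sqr_half (m : nat) (s : R) : 0 < s ->
  (s ^+ 2) `^ (- (m%:R / 2)) = s ^- m.
Proof.
move=> s0; rewrite -powR_mulrn ?ltW// -powRrM mulrN mulrCA divff// mulr1.
by rewrite powRN powR_mulrn ?ltW.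
Qed.

(** A smooth version of [q |-> max (q, s^2) `^ (- m / 2) - t ^- m] truncated at
    [t^2]: the primitive of [- b], where [b] is a cutoff of minus the derivative
    [w] of [p q = q `^ (- m / 2)]. As [p] is homogeneous of degree [- m / 2],
    [2 * q * w q = m * p q]; hence [m * Psi + 2 * q * Psi'] nearly equals
    [m * (p q - t ^- m) - m * p q], a constant, between the two cutoffs. *)
Lemma radial_profile (m : nat) (s s1 t1 t : R) :
  0 < s -> s < s1 -> s1 < t1 -> t1 < t ->
  exists Psi : R -> R, exists Psi' : R -> R,
  [/\ (forall k, C1 k setT Psi) /\ (forall q : R, is_derive q 1 Psi (Psi' q)),
      (forall q, 0 <= Psi q <= s ^- m) /\ (forall q, Psi' q <= 0),
      forall q, t ^+ 2 <= q -> Psi q = 0,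
      forall q, q <= s ^+ 2 -> s1 ^- m - t1 ^- m <= Psi q /\ Psi' q = 0 &
      forall q, s ^+ 2 <= q ->
        - (m%:R * (t1 ^- m + s ^- m - s1 ^- m)) <= m%:R * Psi q + 2 * q * Psi' q].
Proof.
move=> s0 ss1 s1t1 t1t.
have s10 := lt_trans s0 ss1; have t10 := lt_trans s10 s1t1.
have t0 := lt_trans t10 t1t.
have s20 : 0 < s ^+ 2 by rewrite exprn_gt0.
have ss1' : s ^+ 2 < s1 ^+ 2 by rewrite ltr_pXn2r ?nnegrE ?ltW.
have s1t1' : s1 ^+ 2 < t1 ^+ 2 by rewrite ltr_pXn2r ?nnegrE ?ltW.
have t1t' : t1 ^+ 2 < t ^+ 2 by rewrite ltr_pXn2r ?nnegrE ?ltW.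
have s1t := lt_trans s1t1' t1t'.
pose p (q : R) := q `^ (- (m%:R / 2)).
pose w (q : R) := (m%:R / 2) * q `^ (- (m%:R / 2) - 1).
have pE (q : R) : 0 < q -> is_derive q 1 p (- w q).
  by move=> q0; rewrite /w -mulNr; exact: is_derive1_powR.
have w0 q : 0 <= w q by rewrite mulr_ge0 ?powR_ge0// divr_ge0.
have qw q : 0 < q -> 2 * q * w q = m%:R * p q.
  move=> q0; rewrite /w /p powRD; last by rewrite (gt_eqF q0) implybT.
  by rewrite powR_inv1 ?ltW//; field; rewrite gt_eqF.
(* [u] switches on between [s^2] and [s1^2], [d] off between [t1^2] and [t^2]. *)
pose u (q : R) := step ((q - s ^+ 2) / (s1 ^+ 2 - s ^+ 2)).
pose d (q : R) := step ((t ^+ 2 - q) / (t ^+ 2 - t1 ^+ 2)).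
have C1aff k (a b : R) : C1 k setT (fun q => step (a * q + b)).
  apply: (@C1_comp _ k _ setT (fun q => a * q + b) step) => //.
    apply: C1D; last exact: C1_cst.
    by apply: C1M; [exact: C1_cst|exact: C1_id].
  exact: C1_step.
have C1u k : C1 k setT u.
  have -> : u = fun q => step ((s1 ^+ 2 - s ^+ 2)^-1 * q
                    + (- s ^+ 2 / (s1 ^+ 2 - s ^+ 2))).
    by apply/funext => q; congr step; ring.
  exact: C1aff.
have C1d k : C1 k setT d.
  have -> : d = fun q => step (- (t ^+ 2 - t1 ^+ 2)^-1 * q
                    + (t ^+ 2 / (t ^+ 2 - t1 ^+ 2))).
    by apply/funext => q; congr step; ring.
  exact: C1aff.
pose b q := w q * (u q * d q).
have b0l q : q <= s ^+ 2 -> b q = 0.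
  move=> qs; rewrite /b /u step0 ?mul0r ?mulr0//.
  by rewrite pmulr_lle0 ?invr_gt0 ?subr_gt0 ?subr_le0.
have b0r q : t ^+ 2 <= q -> b q = 0.
  move=> qs; rewrite /b /d step0 ?mulr0//.
  by rewrite pmulr_lle0 ?invr_gt0 ?subr_gt0 ?subr_le0.
have bE q : s1 ^+ 2 <= q <= t1 ^+ 2 -> b q = w q.
  move=> /andP[sq qt]; rewrite /b /u /d !step1 ?mulr1//.
    by rewrite ler_pdivlMr ?subr_gt0// mul1r lerD2l lerN2.
  by rewrite ler_pdivlMr ?subr_gt0// mul1r lerD2r.
have b_ge0 q : 0 <= b q by apply: mulr_ge0 (w0 q) (mulr_ge0 _ _); exact: step_ge0.
have b_le q : b q <= w q.
  by rewrite /b ler_piMr// mulr_ile1 ?step_ge0 ?step_le1.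
have C1b k : C1 k setT b.
  apply: (@C1_sub _ k ([set x | 0 < x] `|` [set x | x < s ^+ 2])).
    by move=> x _ /=; have [x0|x0] := ltP 0 x; [left|right; exact: le_lt_trans x0 _].
  have o1 : open [set x : R | 0 < x] by exact: open_gt.
  have o2 : open [set x : R | x < s ^+ 2] by exact: open_lt.
  apply: C1_setU => //.
    apply: C1M; first by apply: C1M; [exact: C1_cst|exact: C1_powR].
    by apply: C1M; [apply: C1_sub (C1u k)|apply: C1_sub (C1d k)].
  apply: (C1_ext o2) (C1_cst _ _ 0) => x /= xs.
  by rewrite b0l// ltW.
have [F FE] := @primitive_ex b _ s20 (C1_continuous (C1b 1)) b0l.
pose Psi q := F (t ^+ 2) - F q.
have PsiE (q : R) : is_derive q 1 Psi (- b q).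
  rewrite -[- b q]add0r; have := FE q => h; exact: is_deriveB.
have Pinc x y : x <= y -> Psi y <= Psi x.
  move=> xy; apply: (@derive_le0_ge Psi (fun q => - b q)) xy => // q _.
  by rewrite oppr_le0.
have Pt : Psi (t ^+ 2) = 0 by rewrite /Psi subrr.
have P0 q : t ^+ 2 <= q -> Psi q = 0.
  move=> tq; apply/eqP; rewrite eq_le -{1}Pt Pinc//= -Pt.
  apply: (@derive_ge0_le Psi (fun q => - b q)) tq => // x /andP[/ltW tx _].
  by rewrite b0r// oppr0.
have Pge0 q : 0 <= Psi q.
  by have [qt|/ltW/P0->//] := leP q (t ^+ 2); rewrite -Pt Pinc.
have Pcst q : q <= s ^+ 2 -> Psi q = Psi (s ^+ 2).
  move=> qs; apply/eqP; rewrite eq_le; apply/andP; split; last exact: Pinc.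
  apply: (@derive_ge0_le Psi (fun q => - b q)) qs => // x /andP[_ /ltW tx].
  by rewrite b0l// oppr0.
have pinc x y : 0 < x -> x <= y -> p y <= p x.
  move=> x0 xy; apply: (@derive_le0_ge p (fun q => - w q)) xy => [q /andP[xq _]|q _].
    by apply: pE; exact: lt_le_trans xq.
  by rewrite oppr_le0.
have p_ge0 q : 0 <= p q by exact: powR_ge0.
have Pp q : 0 < q -> Psi q <= p q.
  move=> q0; have [qt|/ltW/P0->//] := leP q (t ^+ 2).
  suff : p (t ^+ 2) - Psi (t ^+ 2) <= p q - Psi q.
    by rewrite Pt subr0 => /(le_trans (p_ge0 _)); rewrite subr_ge0.
  apply: (@derive_le0_ge (fun q => p q - Psi q) (fun q => - w q - - b q)) qt.
    move=> x /andP[qx _]; have h1 := pE _ (lt_le_trans q0 qx); have h2 := PsiE x.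
    exact: is_deriveB.
  by move=> x _; rewrite opprK addrC subr_le0.
have Pmid q : s1 ^+ 2 <= q <= t1 ^+ 2 -> p q - t1 ^- m <= Psi q.
  move=> /andP[sq qt]; rewrite -(powR_sqr_half _ t10) -/(p _).
  suff : Psi (t1 ^+ 2) - p (t1 ^+ 2) <= Psi q - p q.
    by have := Pge0 (t1 ^+ 2); lra.
  apply: (@derive_le0_ge (fun q => Psi q - p q) (fun q => - b q - - w q)) qt.
    move=> x /andP[qx _].
    have h1 : is_derive x 1 p (- w x).
      by apply: pE; apply: lt_le_trans qx; apply: lt_le_trans sq; exact: lt_trans ss1'.
    have h2 := PsiE x; exact: is_deriveB.
  move=> x /andP[/ltW qx /ltW xt]; rewrite bE ?subrr//.
  by rewrite (le_trans sq qx).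
exists Psi, (fun q => - b q); split => //.
- split=> //; case=> // k; exists (fun q => - b q) => //.
  have -> : (fun q => - b q) = fun q => (-1) * b q by apply/funext => q; ring.
  by apply: C1M => //; exact: C1_cst.
- split=> q; last by rewrite oppr_le0.
  rewrite Pge0 /=; have [qs|sq] := leP q (s ^+ 2).
    by rewrite Pcst// -(powR_sqr_half _ s0) Pp.
  apply: le_trans (Pinc _ _ (ltW sq)) _.
  by rewrite -(powR_sqr_half _ s0) Pp.
- move=> q qs; rewrite b0l// oppr0; split=> //.
  rewrite Pcst// (le_trans _ (Pinc _ _ (ltW ss1')))//.
  by rewrite -(powR_sqr_half _ s10) Pmid// lexx/= ltW.
- move=> q sq.
  have q0 : 0 < q by exact: lt_le_trans sq.
  have bq : 2 * q * b q <= m%:R * p q.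
    by rewrite -qw// ler_wpM2l// mulr_ge0// ltW.
  have m0 : 0 <= m%:R :> R by [].
  have T1 : 0 <= t1 ^- m :> R by rewrite invr_ge0 exprn_ge0// ltW.
  have SS1 : s1 ^- m <= s ^- m.
    rewrite -(powR_sqr_half _ s0) -(powR_sqr_half _ s10); apply: pinc => //.
    exact: ltW.
  rewrite mulrN; suff : m%:R * (p q - Psi q) <= m%:R * (t1 ^- m + s ^- m - s1 ^- m).
    by rewrite mulrBr; lra.
  apply: ler_wpM2l => //.
  have [qs1|s1q] := leP q (s1 ^+ 2).
    have := Pmid (s1 ^+ 2); rewrite lexx ltW//= => /(_ isT).
    rewrite /p powR_sqr_half// -/(p _) => h1.
    have := Pinc _ _ qs1; have := pinc _ _ s20 sq.
    by rewrite {2}/p powR_sqr_half//; lra.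
  have [qt1|t1q] := leP q (t1 ^+ 2).
    by have := Pmid q; rewrite ltW//= qt1 => /(_ isT); lra.
  have := pinc _ _ (exprn_gt0 2 t10) (ltW t1q); rewrite {2}/p powR_sqr_half//.
  by have := Pge0 q; lra.
Qed.

End Profile.

(** * Smooth functions and balls in Euclidean space *)

Section SmoothSpace.
Context {R : realType} {n : nat}.
Local Notation E := 'rV[R]_n.
Implicit Types (f g : E -> R) (X : E -> E).

Fixpoint Cm (k : nat) f : Prop :=
  if k is k'.+1 then
    (forall x, differentiable f x) /\ (forall v, Cm k' (fun x => 'D_v f x))
  else True.

Definition smooth f := forall k, Cm k f.

Lemma Cm_le k f : Cm k.+1 f -> Cm k f.
Proof.
elim: k f => //= k ih f [df kf]; split=> // v.
by apply: ih; exact: kf.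
Qed.

Lemma Cm_cst k (c : R) : Cm k (fun=> c).
Proof.
elim: k c => //= k ih c; split=> [x|v]; first exact: differentiable_cst.
by under eq_fun do rewrite derive_cst; exact: ih.
Qed.

Lemma CmD k f g : Cm k f -> Cm k g -> Cm k (fun x => f x + g x).
Proof.
elim: k f g => //= k ih f g [df kf] [dg kg]; split=> [x|v].
  exact: differentiableD.
have -> : (fun x => 'D_v (fun y => f y + g y) x) = (fun x => 'D_v f x + 'D_v g x).
  by apply/funext => x; rewrite deriveD//; exact: diff_derivable.
exact: ih.
Qed.

Lemma CmM k f g : Cm k f -> Cm k g -> Cm k (fun x => f x * g x).
Proof.
elim: k f g => //= k ih f g kf kg.
have [df kdf] := kf; have [dg kdg] := kg; split=> [x|v].
  exact: differentiableM.
have -> : (fun x => 'D_v (fun y => f y * g y) x)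
    = (fun x => f x * 'D_v g x + g x * 'D_v f x).
  by apply/funext => x; rewrite deriveM//; exact: diff_derivable.
by apply: CmD; apply: ih => //; exact: Cm_le.
Qed.

Lemma derive_compR (f : E -> R) (g : R -> R) (x v : E) (dg : R) :
  differentiable f x -> is_derive (f x) 1 g dg ->
  differentiable (fun y => g (f y)) x /\ 'D_v (fun y => g (f y)) x = dg * 'D_v f x.
Proof.
move=> df hg.
have dg' : differentiable g (f x) by apply/derivable1_diffP; case: hg.
have dc : differentiable (fun y => g (f y)) x by exact: differentiable_comp.
split=> //.
rewrite (deriveE _ dc) (deriveE _ df).
rewrite (_ : (fun y => g (f y)) = g \o f)// diff_comp//=.
rewrite deriv1E; last by case: hg.
by rewrite /= derive1E derive_val mulrC.
Qed.

Lemma Cm_comp k (g : R -> R) f : (forall k, C1 k setT g) -> Cm k f ->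
  Cm k (fun x => g (f x)).
Proof.
elim: k g f => //= k ih g f gk kf; have [df kdf] := kf.
have hg x : is_derive (f x) 1 g (derive1 g (f x)).
  by apply: C1_is_derive; exact: gk.
split=> [x|v]; first by have [] := derive_compR 0 (df x) (hg x).
have -> : (fun x => 'D_v (fun y => g (f y)) x) =
    (fun x => derive1 g (f x) * 'D_v f x).
  by apply/funext => x; have [] := derive_compR v (df x) (hg x).
apply: CmM => //; apply: ih; last exact: Cm_le.
by move=> j; apply: C1_derive; exact: gk.
Qed.

Lemma Cm_sum k (I : Type) (r : seq I) (f : I -> E -> R) :
  (forall i, Cm k (f i)) -> Cm k (fun x => \sum_(i <- r) f i x).
Proof.
move=> fk; elim: r => [|i r ih].
  by under eq_fun do rewrite big_nil; exact: Cm_cst.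
by under eq_fun do rewrite big_cons; exact: CmD.
Qed.

Lemma Cm_prod k (I : Type) (r : seq I) (f : I -> E -> R) :
  (forall i, Cm k (f i)) -> Cm k (fun x => \prod_(i <- r) f i x).
Proof.
move=> fk; elim: r => [|i r ih].
  by under eq_fun do rewrite big_nil; exact: Cm_cst.
by under eq_fun do rewrite big_cons; exact: CmM.
Qed.

Lemma derive_coord (x v : E) i :
  differentiable (fun y : E => y 0 i) x /\ 'D_v (fun y : E => y 0 i) x = v 0 i.
Proof.
have dc : differentiable (fun y : E => y 0 i) x by exact: differentiable_coord.
split=> //.
have h : 'D_v (id : E -> E) x = \matrix_(a, b) 'D_v (fun y : E => y a b) x.
  by apply: derive_mx; exact: derivable_id.
by move: h; rewrite derive_id => /matrixP/(_ 0 i); rewrite mxE.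
Qed.

Lemma Cm_coord k i : Cm k (fun y : E => y 0 i).
Proof.
case: k => //= k; split=> [x|v]; first by have [] := derive_coord x 0 i.
have -> : (fun x => 'D_v (fun y : E => y 0 i) x) = fun=> v 0 i.
  by apply/funext => x; have [] := derive_coord x v i.
exact: Cm_cst.
Qed.

Lemma smooth_continuous f : smooth f -> continuous f.
Proof. by move=> /(_ 1%N) [df _] x; exact: differentiable_continuous. Qed.

Definition smoothv X := forall i, smooth (fun x => X x 0 i).

Lemma smoothv_differentiable X x : smoothv X -> differentiable X x.
Proof.
move=> sX; have -> : X = fun x => \sum_i X x 0 i *: delta_mx 0 i.
  by apply/funext => y; exact: row_sum_delta.
have := @differentiable_sum R E E n (fun i x => X x 0 i *: delta_mx 0 i) x.
rewrite (_ : \sum_(i < n) (fun x0 : E => X x0 0 i *: delta_mx 0 i) =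
  (fun x => \sum_i X x 0 i *: delta_mx 0 i)).
  by apply => i; apply: differentiableZl; have [df _] := sX i 1%N; exact: df.
by apply/funext => y; rewrite fct_sumE.
Qed.

Lemma smoothv_derive X x v i : smoothv X ->
  ('D_v X x) 0 i = 'D_v (fun y => X y 0 i) x.
Proof.
move=> sX; rewrite derive_mx ?mxE//.
by apply: diff_derivable; exact: smoothv_differentiable.
Qed.

(** Smoothness is established by components; this gives the smoothness that test
    fields are required to have. *)
Lemma smoothv_Ck X k : smoothv X -> Ck k X.
Proof.
elim: k X => /= [|k ih] X sX.
  by move=> x; apply: differentiable_continuous; exact: smoothv_differentiable.
split=> [x|v]; first exact: smoothv_differentiable.
apply: ih => i j.
have -> : (fun x => ('D_v X x) 0 i) = fun x => 'D_v (fun y => X y 0 i) x.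
  by apply/funext => x; exact: smoothv_derive.
by have [_] := sX i j.+1; apply.
Qed.

Lemma smoothv_jacobian X x i j : smoothv X ->
  'J X x i j = 'D_(delta_mx 0 i) (fun y => X y 0 j) x.
Proof.
move=> sX; rewrite -smoothv_derive// deriveEjacobian.
  by rewrite -rowE [RHS]mxE.
exact: smoothv_differentiable.
Qed.

End SmoothSpace.

Section EuclidGeom.
Context {R : realType} {n : nat}.
Local Notation E := 'rV[R]_n.
Implicit Types (u v w x y a : E).

Lemma dotvC u v : dotv u v = dotv v u.
Proof. by apply: eq_bigr => i _; rewrite mulrC. Qed.

Lemma dotvZl c u v : dotv (c *: u) v = c * dotv u v.
Proof. by rewrite /dotv mulr_sumr; apply: eq_bigr => i _; rewrite mxE mulrA. Qed.

Lemma dotvDl u v w : dotv (u + v) w = dotv u w + dotv v w.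
Proof. by rewrite /dotv -big_split; apply: eq_bigr => i _; rewrite mxE mulrDl. Qed.

Lemma dotvNl u v : dotv (- u) v = - dotv u v.
Proof. by rewrite -scaleN1r dotvZl mulN1r. Qed.

Lemma dotv_ge0 u : 0 <= dotv u u.
Proof. by apply: sumr_ge0 => i _; rewrite -expr2 sqr_ge0. Qed.

Lemma enorm_ge0 u : 0 <= enorm u. Proof. exact: sqrtr_ge0. Qed.

Lemma enorm_sqr u : enorm u ^+ 2 = dotv u u.
Proof. by rewrite sqr_sqrtr// dotv_ge0. Qed.

Lemma enorm0 : enorm (0 : E) = 0.
Proof. by rewrite /enorm (_ : dotv _ _ = 0) ?sqrtr0//; apply/eqP; rewrite dotv_eq0. Qed.

Lemma enormN u : enorm (- u) = enorm u.
Proof. by rewrite /enorm dotvNl dotvC dotvNl opprK. Qed.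

Lemma enormB u v : enorm (u - v) = enorm (v - u).
Proof. by rewrite -enormN opprB. Qed.

Lemma enormZ c u : enorm (c *: u) = `|c| * enorm u.
Proof.
rewrite /enorm dotvZl dotvC dotvZl mulrA -expr2 sqrtrM ?sqr_ge0//.
by rewrite sqrtr_sqr.
Qed.

Lemma dotv_cs u v : dotv u v <= enorm u * enorm v.
Proof.
have [->|v0] := eqVneq v 0.
  by rewrite enorm0 mulr0 dotvC -(scale0r 0) dotvZl mul0r.
apply: ler_normlW; rewrite -ler_sqr ?nnegrE ?mulr_ge0 ?enorm_ge0//.
rewrite real_normK ?num_real// exprMn !enorm_sqr.
set b := dotv u v; set c := dotv v v.
have c0 : 0 < c by rewrite lt_neqAle dotv_ge0 andbT eq_sym dotv_eq0.
have := dotv_ge0 (c *: u - b *: v).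
rewrite dotvBl !dotvZl !(dotvC _ (_ - _)) !dotvBl !dotvZl (dotvC v u) -/b -/c.
have -> : c * (c * dotv u u - b * b) - b * (c * b - b * c)
  = c * (dotv u u * c - b ^+ 2) by ring.
by rewrite pmulr_rge0// subr_ge0.
Qed.

Lemma enormD u v : enorm (u + v) <= enorm u + enorm v.
Proof.
rewrite -ler_sqr ?nnegrE ?addr_ge0 ?enorm_ge0// enorm_sqr sqrrD !enorm_sqr.
rewrite dotvDl !(dotvC _ (_ + _)) !dotvDl (dotvC v u).
by have := dotv_cs u v; rewrite mulr2n; lra.
Qed.

Lemma enorm_tri u v w : enorm (u - w) <= enorm (u - v) + enorm (v - w).
Proof. by rewrite -[u - w](subrKA v) enormD. Qed.

Lemma coord_le_enorm u i : `|u 0 i| <= enorm u.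
Proof.
rewrite -ler_sqr ?nnegrE ?enorm_ge0// real_normK ?num_real// enorm_sqr.
rewrite /dotv (bigD1 i)//= -expr2 lerDl.
by apply: sumr_ge0 => j _; rewrite -expr2 sqr_ge0.
Qed.

Lemma norm_le_enorm u : `|u| <= enorm u.
Proof.
rewrite [leLHS]/Num.Def.normr/= mx_normrE; apply: bigmax_le => [|[i j] _].
  exact: enorm_ge0.
by rewrite ord1; exact: coord_le_enorm.
Qed.

Definition sqd a x : R := dotv (x - a) (x - a).

Lemma smooth_sqd a : smooth (sqd a).
Proof.
move=> k; apply: Cm_sum => i.
have h : Cm k (fun x : E => (x - a) 0 i).
  under eq_fun do rewrite mxE mxE.
  by apply: CmD; [exact: Cm_coord|exact: Cm_cst].
exact: CmM.
Qed.

Lemma derive_sqd a x v : 'D_v (sqd a) x = 2 * dotv (x - a) v.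
Proof.
have dc i : derivable (fun x : E => (x - a) 0 i) x v /\
    'D_v (fun x : E => (x - a) 0 i) x = v 0 i.
  have [dc cE] := derive_coord x v i.
  have -> : (fun x : E => (x - a) 0 i) = (fun x : E => x 0 i) + cst (- a 0 i).
    by apply/funext => y; rewrite !mxE.
  have dd : derivable (fun x : E => x 0 i) x v by exact: diff_derivable.
  split; first by apply: derivableD.
  by rewrite deriveD// cE derive_cst addr0.
have -> : sqd a = \sum_i (fun y => (y - a) 0 i * (y - a) 0 i).
  by apply/funext => y; rewrite fct_sumE.
rewrite derive_sum; last by move=> i; have [d _] := dc i; exact: derivableM.
rewrite /dotv mulr_sumr; apply: eq_bigr => i _; have [d dE] := dc i.
by rewrite deriveM// dE -![_ *: _]/(_ * _); ring.
Qed.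

Lemma sqdE a x : sqd a x = enorm (x - a) ^+ 2.
Proof. by rewrite enorm_sqr. Qed.

Lemma sqd_continuous a : continuous (sqd a).
Proof. exact/smooth_continuous/smooth_sqd. Qed.

Lemma ecballE a (r : R) : 0 <= r -> ecball a r = [set x | sqd a x <= r ^+ 2].
Proof.
by move=> r0; apply/seteqP; split=> x /=; rewrite sqdE ler_sqr ?nnegrE ?enorm_ge0.
Qed.

Lemma eballE a (r : R) : 0 <= r -> eball a r = [set x | sqd a x < r ^+ 2].
Proof.
by move=> r0; apply/seteqP; split=> x /=; rewrite sqdE ltr_sqr ?nnegrE ?enorm_ge0.
Qed.

Lemma closed_ecball a r : closed (ecball a r).
Proof.
have [r0|r0] := leP 0 r.
  rewrite ecballE//; apply: (@preimage_closed _ _ (sqd a) [set y | y <= r ^+ 2]).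
    by move=> x _; exact: sqd_continuous.
  exact: closed_le.
rewrite (_ : ecball a r = set0); first exact: closed0.
by rewrite -subset0 => x; rewrite /ecball /= => /(le_trans (enorm_ge0 _)); rewrite leNgt r0.
Qed.

Lemma open_eball a r : open (eball a r).
Proof.
have [r0|r0] := leP 0 r.
  rewrite eballE//; apply: (@open_comp _ _ (sqd a) [set y | y < r ^+ 2]).
    by move=> *; exact: sqd_continuous.
  exact: open_lt.
rewrite (_ : eball a r = set0); first exact: open0.
by rewrite -subset0 => x; rewrite /eball /= => /(le_lt_trans (enorm_ge0 _)) /ltW; rewrite leNgt r0.
Qed.

Lemma compact_ecball a r : compact (ecball a r).
Proof.
apply: bounded_closed_compact; last exact: closed_ecball.
exists (`|a| + `|r|); split; first exact: num_real.
move=> M rM x; rewrite /ecball /= => xr.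
rewrite -[x](subrK a) (le_trans (ler_normD _ _))//.
have := norm_le_enorm (x - a); have := ler_norm r; have := normr_ge0 a; move: rM xr; lra.
Qed.

Lemma enorm_le_norm u : enorm u <= n%:R * `|u|.
Proof.
rewrite -ler_sqr ?nnegrE ?enorm_ge0 ?mulr_ge0// enorm_sqr exprMn.
have h i : `|u 0 i| <= `|u|.
  rewrite [leRHS]/Num.Def.normr/= mx_normrE.
  exact: (le_bigmax _ (fun i => `|u i.1 i.2|) (0, i)).
apply: (@le_trans _ _ (n%:R * `|u| ^+ 2)).
  have -> : n%:R * `|u| ^+ 2 = \sum_(i < n) `|u| ^+ 2.
    by rewrite sumr_const card_ord mulr_natl.
  apply: ler_sum => i _.
  by rewrite -expr2 -(real_normK (num_real (u 0 i))) ler_sqr ?nnegrE.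
rewrite ler_wpM2r ?sqr_ge0// expr2 -natrM ler_nat.
by case: (n) => // k; rewrite leq_pmulr.
Qed.

Lemma nbhs_eball a (A : set E) : nbhs a A -> exists2 r, 0 < r & ecball a r `<=` A.
Proof.
move=> /nbhs_ballP[e /= e0 eA]; exists (e / 2); first by rewrite divr_gt0.
move=> x /= xa; apply: eA; rewrite -ball_normE /=.
rewrite distrC (le_lt_trans (norm_le_enorm _))// (le_lt_trans xa)//; lra.
Qed.

End EuclidGeom.

(** * Smooth Urysohn functions and orthogonal projections *)

Section Urysohn.
Context {R : realType} {n : nat}.
Local Notation E := 'rV[R]_n.

(** A cutoff equal to [1] on the ball of radius [r] and to [0] off the ball of
    radius [2 * r]: [step] runs over [[0, 1]] as the squared distance decreases
    from [4 * r ^+ 2] to [r ^+ 2]. *)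
Definition bump (a : E) (r : R) (x : E) : R :=
  step ((3 * r ^+ 2)^-1 * (4 * r ^+ 2 - sqd a x)).

Lemma smooth_bump a r : smooth (bump a r).
Proof.
move=> k; apply: (@Cm_comp _ _ k (fun y => step ((3 * r ^+ 2)^-1 * (4 * r ^+ 2 - y)))).
  move=> j; apply: (@C1_comp _ j _ setT (fun y => (3 * r ^+ 2)^-1 * (4 * r ^+ 2 - y)) step) => //.
    apply: C1M; first exact: C1_cst.
    apply: C1D; first exact: C1_cst.
    have -> : -%R = (fun x : R => -1 * x) by apply/funext => x; rewrite mulN1r.
    by apply: C1M; [exact: C1_cst|exact: C1_id].
  exact: C1_step.
exact: smooth_sqd.
Qed.

Lemma bump_01 a r x : 0 <= bump a r x <= 1.
Proof. by rewrite /bump step_ge0 step_le1. Qed.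

Lemma bump1 a r x : 0 < r -> x \in ecball a r -> bump a r x = 1.
Proof.
move=> r0; rewrite inE ecballE ?ltW//= => xr; apply: step1.
have r20 : 0 < r ^+ 2 by rewrite exprn_gt0.
by rewrite ler_pdivlMl ?mulr_gt0// mulr1; move: (r ^+ 2 : R) (sqd a x : R) xr r20 => u v; lra.
Qed.

Lemma bump0 a r x : 0 < r -> x \notin ecball a (2 * r) -> bump a r x = 0.
Proof.
move=> r0; rewrite notin_setE ecballE ?mulr_ge0 ?ltW//= => /negP.
rewrite -ltNge => xr; apply: step0.
have r20 : 0 < r ^+ 2 by rewrite exprn_gt0.
rewrite pmulr_rle0 ?invr_gt0 ?mulr_gt0//.
by move: xr; rewrite exprMn; move: (r ^+ 2 : R) (sqd a x : R) r20 => u v; lra.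
Qed.

(** Cover [K] by finitely many balls whose doubles lie in [O]; then
    [1 - \prod (1 - bump)] is [1] on each ball and [0] off the doubles. *)
Lemma smooth_urysohn (K O : set E) : compact K -> open O -> K `<=` O ->
  exists chi : E -> R, [/\ smooth chi, forall x, 0 <= chi x <= 1,
    forall x, K x -> chi x = 1 & closure [set x | chi x != 0] `<=` O].
Proof.
move=> cK oO KO.
have /choice[rho rhoP] : forall x : E, exists r : R, 0 < r /\
    (O x -> ecball x (2 * r) `<=` O).
  move=> x; have [Ox|nOx] := pselect (O x); last by exists 1.
  have [r r0 rO] := nbhs_eball (open_nbhs_nbhs (conj oO Ox)).
  by exists (r / 2); split; [rewrite divr_gt0|rewrite mulrCA divff// mulr1].
have [D DK KD] : finite_subset_cover K (fun x => eball x (rho x)) K.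
  move: cK; rewrite compact_cover; apply; first by move=> x _; exact: open_eball.
  by move=> x Kx; exists x => //; rewrite /eball /= subrr enorm0; have [] := rhoP x.
have {D DK KD} [D [DK KD]] : exists D0 : seq E, {subset D0 <= K} /\
    forall x, K x -> exists2 a, a \in D0 & eball a (rho a) x.
  by exists (finmap.enum_fset D); split.
pose pr x := \prod_(a <- D) (1 - bump a (rho a) x).
have pr01 x : 0 <= pr x <= 1.
  rewrite /pr; elim/big_rec: _ => [|i y _ /andP[y0 y1]]; first by rewrite ler01 lexx.
  have /andP[b0 b1] := bump_01 i (rho i) x.
  by rewrite mulr_ge0 ?subr_ge0//= mulr_ile1 ?subr_ge0// gerBl.
exists (fun x => 1 - pr x); split.
- move=> k; apply: CmD; first exact: Cm_cst.
  have -> : (fun x => - pr x) = fun x => -1 * pr x.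
    by apply/funext => x; rewrite mulN1r.
  apply: CmM; first exact: Cm_cst.
  apply: Cm_prod => a; apply: CmD; first exact: Cm_cst.
  have -> : (fun x => - bump a (rho a) x) = fun x => -1 * bump a (rho a) x.
    by apply/funext => x; rewrite mulN1r.
  by apply: CmM; [exact: Cm_cst|exact: smooth_bump].
- by move=> x; have /andP[p0 p1] := pr01 x; rewrite subr_ge0 p1/= gerBl.
- move=> x /KD[a aD]; rewrite /eball /= => /ltW xa.
  rewrite /pr (big_rem a)//= bump1 ?subrr ?mul0r ?subr0//; last by rewrite inE.
  by have [] := rhoP a.
- have cC : closed (\big[setU/set0]_(a <- D) ecball a (2 * rho a)).
    by apply: closed_bigsetU => i _; exact: closed_ecball.
  have : [set x | 1 - pr x != 0] `<=` \big[setU/set0]_(a <- D) ecball a (2 * rho a).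
    move=> x /=; apply: contra_neqP => xN.
    rewrite /pr big1_seq ?subrr// => a /andP[_ aD].
    rewrite bump0 ?subr0//; first by have [] := rhoP a.
    rewrite notin_setE => xa; apply: xN.
    by rewrite -bigcup_seq; exists a.
  move=> /closure_subset; rewrite closure_id in cC; rewrite -cC.
  move=> h x /h; rewrite -bigcup_seq => -[a /= aD xa].
  by have [_] := rhoP a; apply => //; apply: KO; have := DK a aD; rewrite inE.
Qed.

End Urysohn.

Section Projections.
Context {R : realType} {n : nat}.
Local Notation E := 'rV[R]_n.
Implicit Types (P : {vspace 'rV[R]_n}).

Lemma oproj_mul_id P (x : E) : x \in P -> x *m oproj P = x.
Proof.
move=> xP; have [xp0 xp] := oprojP P x.
apply/eqP; rewrite eq_sym -subr_eq0 -dotv_eq0 xp//.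
by rewrite memvB.
Qed.

Lemma oproj_sqr P : oproj P *m oproj P = oproj P.
Proof.
apply/row_matrixP => i; rewrite !rowE mulmxA oproj_mul_id//.
by have [] := oprojP P (delta_mx 0 i).
Qed.

Lemma dotv_oproj P (x : E) : dotv x (x *m oproj P) = dotv (x *m oproj P) (x *m oproj P).
Proof.
have [xP h] := oprojP P x; have := h _ xP; rewrite dotvBl => /eqP.
by rewrite subr_eq0 => /eqP.
Qed.

Lemma oproj_dot2 P (x y : E) : dotv (x *m oproj P) y = dotv x (y *m oproj P).
Proof.
have [xP hx] := oprojP P x; have [yP hy] := oprojP P y.
have := hx _ yP; rewrite dotvBl => /eqP; rewrite subr_eq0 => /eqP ->.
have := hy _ xP; rewrite dotvBl => /eqP; rewrite subr_eq0 dotvC => /eqP ->.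
by rewrite dotvC.
Qed.

Lemma dotv_delta i j (A : 'M[R]_n) :
  dotv ((delta_mx 0 i : E) *m A) (delta_mx 0 j) = A i j.
Proof. by rewrite dotvE -rowE trmx_delta -colE !mxE. Qed.

Lemma oproj_sym P : (oproj P)^T = oproj P.
Proof.
apply/matrixP => i j; rewrite mxE -!dotv_delta oproj_dot2 dotvC.
by rewrite dotv_delta.
Qed.

Lemma oproj_dot_le P (x : E) : 0 <= dotv x (x *m oproj P) <= dotv x x.
Proof.
rewrite dotv_oproj dotv_ge0 /=.
have := dotv_ge0 (x - x *m oproj P).
rewrite dotvBl !(dotvC _ (_ - _)) !dotvBl -dotv_oproj (dotvC (x *m _) x).
by rewrite subrr subr0 subr_ge0.
Qed.

(** For a rank factorization [C *m D] of an idempotent matrix, [D *m C] is the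
    identity, so the trace is the number of rows of [D]. *)
Lemma oproj_trace P : \tr (oproj P) = (\dim P)%:R.
Proof.
have [k [C [D [DC pE]]]] : exists k : nat, exists C : 'M[R]_(n, k),
   exists D : 'M[R]_(k, n), D *m C = 1%:M /\ oproj P = C *m D.
  exists (\rank (oproj P)), (col_base (oproj P)), (row_base (oproj P)).
  split; last by rewrite mulmx_base.
  have := oproj_sqr P; rewrite -{1 2 3}(mulmx_base (oproj P)) => h.
  have rfree := row_base_free (oproj P).
  have cfull := col_base_full (oproj P).
  have [B hB] := row_freeP rfree; have [B' hB'] := row_fullP cfull.
  have : B' *m (col_base (oproj P) *m row_base (oproj P) *m
     (col_base (oproj P) *m row_base (oproj P))) *m B
     = B' *m (col_base (oproj P) *m row_base (oproj P)) *m B by rewrite h.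
  move: (col_base _) (row_base _) hB hB' => /= C D hB hB'.
  have e1 : B' *m (C *m D *m (C *m D)) *m B = D *m C.
    by rewrite !mulmxA hB' mul1mx -!mulmxA hB mulmx1.
  have e2 : B' *m (C *m D) *m B = 1%:M by rewrite mulmxA hB' mul1mx hB.
  by rewrite e1 e2.
rewrite pE mxtrace_mulC DC mxtrace1; congr (_%:R).
(* the rows of D form a basis of P *)
pose b : k.-tuple 'rV[R]_n := [tuple row i D | i < k].
have bE (i : 'I_k) : b`_i = row i D.
  by rewrite -tnth_nth tnth_mktuple.
have lc (w : 'rV[R]_k) : w *m D = \sum_i w 0 i *: b`_i.
  by rewrite mulmx_sum_row; apply: eq_bigr => i _; rewrite bE.
have fb : free b.
  apply/freeP => c c0 i.
  have : (\row_i c i) *m D = 0.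
    by rewrite lc -[RHS]c0; apply: eq_bigr => j _; rewrite mxE.
  move=> /(congr1 (mulmx^~ C)); rewrite -mulmxA DC mulmx1 mul0mx => /rowP/(_ i).
  by rewrite !mxE.
have sb : <<b>>%VS = P.
  apply/vspaceP => x; apply/idP/idP.
    move=> /coord_span ->; apply: memv_suml => i _; apply: memvZ.
    rewrite bE.
    have -> : row i D = (row i D *m C *m D).
      by rewrite -!row_mul DC mul1mx.
    by rewrite -mulmxA -pE; have [] := oprojP P (row i D).
  move=> /oproj_mul_id <-; rewrite pE mulmxA lc.
  apply: memv_suml => i _; apply: memvZ; apply: memv_span.
  by rewrite mem_nth// size_tuple.
by rewrite -sb; apply/esym/eqP; rewrite -[X in _ == X](size_tuple b); exact: fb.
Qed.

End Projections.

(** * Divergence of radial fields *)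

Section RadialField.
Context {R : realType} {n : nat}.
Local Notation E := 'rV[R]_n.

Lemma continuous_fsum (T : topologicalType) (I : Type) (r : seq I)
    (f : I -> T -> R) :
  (forall i, continuous (f i)) -> continuous (fun z => \sum_(i <- r) f i z).
Proof.
move=> cf; elim: r => [|i r ih] z.
  by under eq_fun do rewrite big_nil; exact: cvg_cst.
by under eq_fun do rewrite big_cons; apply: cvgD; [exact: cf|exact: ih].
Qed.

Lemma mxdotE (A B : 'M[R]_n) : mxdot A B = \sum_i \sum_j A i j * B i j.
Proof.
rewrite /mxdot /mxtrace exchange_big; apply: eq_bigr => i _ /=.
by rewrite mxE; apply: eq_bigr => j _; rewrite mxE.
Qed.

(** The integrand of the first variation is continuous on the product with the
    Grassmannian, hence measurable for [V]. *)
Lemma mxdot_continuous (X : E -> E) : smoothv X ->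
  continuous (fun z : E * subsp R n => mxdot (oproj z.2) ('J X z.1)).
Proof.
move=> sX.
have -> : (fun z : E * subsp R n => mxdot (oproj z.2) ('J X z.1)) =
   fun z => \sum_i \sum_j oproj z.2 i j * 'D_(delta_mx 0 i) (fun y => X y 0 j) z.1.
  apply/funext => z; rewrite mxdotE; apply: eq_bigr => i _.
  by apply: eq_bigr => j _; rewrite smoothv_jacobian.
apply: continuous_fsum => i; apply: continuous_fsum => j z.
apply: cvgM.
  apply: (@continuous_comp _ _ _ (fun z : E * subsp R n => oproj z.2)
    (fun p : 'M[R]_n => p i j)); last exact: coord_continuous.
  apply: (@continuous_comp _ _ _ snd (@oproj R n : subsp R n -> _)).
    exact: cvg_snd.
  exact: initial_continuous.
apply: (@continuous_comp _ _ _ fst (fun y => 'D_(delta_mx 0 i) (fun y => X y 0 j) y)).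
  exact: cvg_fst.
have sm : smooth (fun y : E => 'D_(delta_mx 0 i) (fun y => X y 0 j) y).
  by move=> k; have [_ h] := sX j k.+1; exact: h.
exact: (smooth_continuous sm).
Qed.

(** The field is [x |-> c * Psi (|x - a|^2) * (x - a)] with the profile of
    [radial_profile]. Its divergence along the [m] plane [P] is
    [c * (m * Psi + 2 * Psi' * |P (x - a)|^2)]; as [Psi' <= 0] and
    [|P (x - a)| <= |x - a|], this is at least [c * (m * Psi + 2 * q * Psi')] at
    [q = |x - a|^2]. The factor [c] makes the length at most one. *)
Lemma radial_field (a : E) (m : nat) (s s1 t1 t : R) :
  0 < s -> s < s1 -> s1 < t1 -> t1 < t ->
  let c := s ^+ m / t in
  let lo := c * (m%:R * (s1 ^- m - t1 ^- m)) in
  let hi := c * (m%:R * (t1 ^- m + s ^- m - s1 ^- m)) in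
  exists X : E -> E,
  [/\ smoothv X, spt X `<=` ecball a t, forall x, enorm (X x) <= 1 &
    forall x (P : {vspace E}), \dim P = m ->
    [/\ (ecball a s x -> lo <= mxdot (oproj P) ('J X x)),
        (ecball a t x -> ~ ecball a s x -> - hi <= mxdot (oproj P) ('J X x)),
        (~ ecball a t x -> mxdot (oproj P) ('J X x) = 0) &
        mxdot (oproj P) ('J X x) <= c * (m%:R * s ^- m) ]].
Proof.
move=> s0 ss1 s1t1 t1t c lo hi.
have s10 := lt_trans s0 ss1; have t10 := lt_trans s10 s1t1.
have t0 := lt_trans t10 t1t.
have st : s < t by rewrite (lt_trans ss1)// (lt_trans s1t1).
have [Psi [Psi' [[C1P PE] [P01 P'0] Pt Ps PL]]] := radial_profile m s0 ss1 s1t1 t1t.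
have c0 : 0 <= c by rewrite divr_ge0 ?exprn_ge0// ltW.
pose X x := (c * Psi (sqd a x)) *: (x - a).
have XE x j : X x 0 j = c * Psi (sqd a x) * (x - a) 0 j by rewrite mxE.
have sP : smooth (fun x => c * Psi (sqd a x)).
  move=> k; apply: CmM; first exact: Cm_cst.
  by apply: Cm_comp => //; exact: smooth_sqd.
have sco j : smooth (fun x : E => (x - a) 0 j).
  move=> k; under eq_fun do rewrite mxE mxE.
  by apply: CmD; [exact: Cm_coord|exact: Cm_cst].
have sX : smoothv X.
  move=> j k; under eq_fun do rewrite XE.
  by apply: CmM; [exact: sP|exact: sco].
have Xt x : ~ ecball a t x -> Psi (sqd a x) = 0.
  move=> xt; apply: Pt; apply/ltW; rewrite ltNge; apply/negP => h; apply: xt.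
  by rewrite ecballE// ltW.
have X1 x : enorm (X x) <= 1.
  have [/= xt|/Xt xt] := pselect (ecball a t x); last first.
    by rewrite /X xt mulr0 scale0r enorm0.
  rewrite enormZ; have /andP[P0 P1] := P01 (sqd a x).
  rewrite ger0_norm; last exact: mulr_ge0.
  rewrite (@le_trans _ _ (c * s ^- m * t))//; last first.
    by rewrite /c mulrAC divfK ?gt_eqF// mulfV// gt_eqF// exprn_gt0.
  by apply: ler_pM => //; [exact: mulr_ge0|exact: enorm_ge0|exact: ler_wpM2l].
have dX x i j : 'D_(delta_mx 0 i) (fun y => X y 0 j) x =
    c * (Psi (sqd a x) * (i == j)%:R + 2 * Psi' (sqd a x) * ((x - a) 0 i * (x - a) 0 j)).
  have -> : (fun y => X y 0 j) = (fun y => c * Psi (sqd a y)) * (fun y => (y - a) 0 j).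
    by apply/funext => y; rewrite XE.
  have [d1 dE1] := derive_compR (delta_mx 0 i) (let: conj d _ := smooth_sqd a 1 in d x)
                    (PE (sqd a x)).
  have dP : 'D_(delta_mx 0 i) (fun y => c * Psi (sqd a y)) x =
       c * (Psi' (sqd a x) * (2 * (x - a) 0 i)).
    rewrite (_ : (fun y => c * Psi (sqd a y)) = c *: (fun y => Psi (sqd a y)))//.
    rewrite deriveZ; last exact: diff_derivable.
    rewrite dE1 derive_sqd; congr (_ * (_ * (_ * _))).
    by rewrite dotvC -[delta_mx 0 i]mulmx1 dotvE -rowE !mxE; under eq_bigr do rewrite !mxE;
       rewrite (bigD1 i)//= eqxx mul1r big1 ?addr0// => k /negPf ki; rewrite eq_sym ki mul0r.
  have [d2 dE2] : derivable (fun y : E => (y - a) 0 j) x (delta_mx 0 i) /\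
     'D_(delta_mx 0 i) (fun y : E => (y - a) 0 j) x = (i == j)%:R.
    have [dc cE] := derive_coord x (delta_mx 0 i : E) j.
    have -> : (fun x : E => (x - a) 0 j) = (fun x : E => x 0 j) + cst (- a 0 j).
      by apply/funext => y; rewrite !mxE.
    have dd : derivable (fun x : E => x 0 j) x (delta_mx 0 i) by exact: diff_derivable.
    split; first exact: derivableD.
    by rewrite deriveD// cE derive_cst addr0 mxE eqxx eq_sym.
  rewrite deriveM//; last first.
    by apply: diff_derivable; have [d _] := sP 1%N; exact: d.
  rewrite dE2 dP -![_ *: _]/(_ * _); ring.
have divX x P : mxdot (oproj P) ('J X x) = c * ((\dim P)%:R * Psi (sqd a x)
    + 2 * dotv (x - a) ((x - a) *m oproj P) * Psi' (sqd a x)).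
  rewrite mxdotE.
  under eq_bigr do under eq_bigr do rewrite smoothv_jacobian// dX.
  rewrite -oproj_trace; set w := x - a; set p := oproj P.
  have -> : dotv w (w *m p) = \sum_i \sum_j p i j * (w 0 i * w 0 j).
    rewrite dotvC /dotv exchange_big /=; apply: eq_bigr => j _.
    by rewrite mxE mulr_suml; apply: eq_bigr => i _; ring.
  have -> : \tr p = \sum_i \sum_j p i j * (i == j)%:R.
    apply: eq_bigr => i _; rewrite (bigD1 i)//= eqxx mulr1 big1 ?addr0// => j ji.
    by rewrite eq_sym (negPf ji) mulr0.
  transitivity (\sum_i (c * ((\sum_j p i j * (i == j)%:R) * Psi (sqd a x)) +
       c * (2 * (\sum_j p i j * (w 0 i * w 0 j)) * Psi' (sqd a x)))).
    apply: eq_bigr => i _.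
    rewrite mulr_suml mulr_sumr (mulr_sumr _ _ _ 2) mulr_suml mulr_sumr -big_split.
    by apply: eq_bigr => j _ /=; ring.
  by rewrite big_split /= -!mulr_sumr -!mulr_suml -!mulr_sumr mulrDr.
exists X; split => //.
- have : [set x | X x != 0] `<=` ecball a t.
    move=> x /=; apply: contra_neqP => /Xt xt; by rewrite /X xt mulr0 scale0r.
  by move=> /closure_subset; have /closure_id <- := @closed_ecball R n a t.
- move=> x P dP; rewrite divX dP.
  have q0 : 0 <= sqd a x by exact: dotv_ge0.
  have /andP[d0 d1] := oproj_dot_le P (x - a).
  have low : m%:R * Psi (sqd a x) + 2 * sqd a x * Psi' (sqd a x) <=
      m%:R * Psi (sqd a x) + 2 * dotv (x - a) ((x - a) *m oproj P) * Psi' (sqd a x).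
    by rewrite lerD2l ler_wnM2r// ler_wpM2l.
  split.
  + rewrite ecballE; last exact: ltW.
    move=> /= /Ps[h e]; rewrite e mulr0 addr0.
    by apply: ler_wpM2l => //; exact: ler_wpM2l.
  + move=> _; rewrite ecballE; last exact: ltW.
    move=> /= /negP; rewrite -ltNge => /ltW /PL h.
    by rewrite /hi -mulrN; apply: ler_wpM2l => //; exact: le_trans low.
  + move=> xt; rewrite Xt// mulr0 add0r.
    (* [Psi] vanishes beyond [t^2], hence so does its derivative. *)
    suff -> : Psi' (sqd a x) = 0 by rewrite !mulr0.
    have xt' : t ^+ 2 < sqd a x.
      by rewrite ltNge; apply/negP => h; apply: xt; rewrite ecballE//; exact: ltW.
    have h0 : is_derive (sqd a x) 1 Psi 0.
      apply: (@near_eq_is_derive _ _ _ (cst 0)); near=> y; rewrite Pt//.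
      by apply: ltW; near: y; exact: lt_nbhsr.
    exact: is_derive_uniq (PE _) h0.
  + apply: ler_wpM2l => //.
    have /andP[_ P1] := P01 (sqd a x).
    rewrite -[leRHS]addr0; apply: lerD; first exact: ler_wpM2l.
    by apply: mulr_ge0_le0 => //; exact: mulr_ge0.
Unshelve. all: by end_near. Qed.

End RadialField.

(** * Outer measures and compactness of the Grassmannian *)

Section OuterMeasure.
Context {R : realType} {T : Type} (mu : {outer_measure set T -> \bar R}).
Local Open Scope ereal_scope.

Lemma carath_null N : mu N = 0 -> mu.-caratheodory N.
Proof.
move=> N0; apply: le_caratheodory_measurable => X.
rewrite [X in X + _](_ : _ = 0) ?add0e; last first.
  apply/eqP; rewrite eq_le outer_measure_ge0 andbT -N0.
  exact: le_outer_measure.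
exact: le_outer_measure.
Qed.

(** Splitting a set along [A] instead of along [O] costs at most the measure of
    [O `\` A]. *)
Lemma carath_approx A :
  (forall e : R, (0 < e)%R -> exists O, [/\ mu.-caratheodory O, A `<=` O &
     mu (O `\` A) <= e%:E]) -> mu.-caratheodory A.
Proof.
move=> h; apply: le_caratheodory_measurable => X.
apply/lee_addgt0Pr => e /h[ O [mO AO OA]].
rewrite (mO X) -addeA; apply: leeD.
  by apply: le_outer_measure; exact: setIS.
apply: le_trans (leeD2l _ OA).
apply: le_trans (outer_measureU2 _ _ _); apply: le_outer_measure => x [Xx nAx].
by have [Ox|nOx] := pselect (O x); [right|left].
Qed.

Lemma outer_subset0 A B : A `<=` B -> mu B = 0 -> mu A = 0.
Proof.
move=> AB B0; apply/eqP; rewrite eq_le outer_measure_ge0 andbT -B0.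
exact: le_outer_measure.
Qed.

End OuterMeasure.

Lemma carath_open (R : realType) (T : topologicalType)
    (mu : {outer_measure set T -> \bar R}) X G :
  mu (~` X) = 0%E -> (forall G, open G -> mu.-caratheodory (G `&` X)) ->
  open G -> mu.-caratheodory G.
Proof.
move=> X0 mX oG; have -> : G = (G `&` X) `|` (G `&` ~` X) by rewrite -setIUr setUv setIT.
apply: caratheodory_measurable_setU; first exact: mX.
by apply: carath_null; apply: outer_subset0 X0.
Qed.

Section GrassmannCompact.
Context {R : realType} {n : nat}.
Local Notation E := 'rV[R]_n.

Definition oproj_mx (m : nat) : set 'M[R]_n :=
  [set p | [/\ p *m p = p, p^T = p & \tr p = m%:R]].

(** A symmetric idempotent matrix is the projection onto its image. *)
Lemma oproj_mx_oproj m p : oproj_mx m p ->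
  exists2 P : {vspace E}, \dim P = m & oproj P = p.
Proof.
move=> [pp pt ptr].
pose f := linfun (mulmxr p : E -> E).
have fE x : f x = x *m p by rewrite lfunE.
pose P := (f @: fullv)%VS.
have PE : oproj P = p.
  apply/esym/oproj_unique => x; split; first by rewrite -fE memv_img// memvf.
  move=> y /memv_imgP[z _ ->]; rewrite fE dotvBl !dotvE trmx_mul pt.
  by rewrite !mulmxA -(mulmxA x p p) pp subrr.
exists P => //; apply/eqP; rewrite -(eqr_nat R) -oproj_trace PE ptr//.
Qed.

(** Each row of [p] has squared length [p k k], by [p = p *m p^T]; in particular
    [p k k ^+ 2 <= p k k]. *)
Lemma oproj_mx_le1 m p i j : oproj_mx m p -> `|p i j| <= 1.
Proof.
move=> [pp pt _].
have h k : p k k = \sum_l p k l ^+ 2.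
  rewrite -[in LHS]pp mxE; apply: eq_bigr => l _.
  by rewrite expr2 -[in X in _ * X = _]pt mxE.
have pk k : p k k <= 1.
  have : p k k ^+ 2 <= p k k.
    by rewrite [leRHS]h (bigD1 k)//= lerDl sumr_ge0// => l _; rewrite sqr_ge0.
  by case: (leP (p k k) 1) => // k1; nra.
rewrite -ler_sqr ?nnegrE// expr1n real_normK ?num_real//.
apply: le_trans (pk i); rewrite [leRHS]h (bigD1 j)//= lerDl sumr_ge0// => l _.
exact: sqr_ge0.
Qed.

Lemma closed_oproj_mx m : closed (oproj_mx m).
Proof.
have cc i j : continuous (fun p : 'M[R]_n => p i j) by exact: coord_continuous.
have cm i j : continuous (fun p : 'M[R]_n => (p *m p) i j).
  have -> : (fun p : 'M[R]_n => (p *m p) i j) = fun p => \sum_k p i k * p k j.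
    by apply/funext => p; rewrite mxE.
  by apply: continuous_fsum => k q; exact: (cvgM (cc i k q) (cc k j q)).
have -> : oproj_mx m = (\bigcap_ij [set p : 'M[R]_n | (p *m p) ij.1 ij.2 - p ij.1 ij.2 = 0])
    `&` ((\bigcap_ij [set p : 'M[R]_n | p ij.2 ij.1 - p ij.1 ij.2 = 0])
    `&` [set p | \tr p = m%:R]).
  apply/seteqP; split=> p /=.
    move=> [pp pt ptr]; split; first by move=> [i j] _ /=; rewrite pp subrr.
    by split=> // -[i j] _ /=; rewrite -[in X in X - _]pt mxE subrr.
  move=> [pp [pt ptr]]; split=> //; apply/matrixP => i j.
    by apply/eqP; rewrite -subr_eq0; apply/eqP; exact: (pp (i, j) I).
  by rewrite mxE; apply/eqP; rewrite -subr_eq0; apply/eqP; exact: (pt (i, j) I).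
have c0 (f : 'M[R]_n -> R) c : continuous f -> closed [set p | f p = c].
  move=> cf; apply: (@preimage_closed _ _ f [set c]); first by move=> x _; exact: cf.
  exact: closed_eq.
apply: closedI; [|apply: closedI].
- apply: closed_bigI => -[i j] _; apply: c0 => p.
  exact: (cvgB (cm i j p) (cc i j p)).
- apply: closed_bigI => -[i j] _; apply: c0 => p.
  exact: (cvgB (cc j i p) (cc i j p)).
- by apply: c0; apply: continuous_fsum => k; exact: (cc k k).
Qed.

Lemma vec_mx_continuous : continuous (vec_mx : 'rV[R]_(n * n) -> 'M[R]_n).
Proof.
apply/linear_bounded_continuous/linear_boundedP.
exists 1; split=> [|r /ltW r1 v]; first exact: num_real.
apply: (@le_trans _ _ `|v|); last by rewrite ler_peMl.
rewrite [leLHS]/Num.Def.normr/= mx_normrE; apply: bigmax_le => // -[i j] _.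
rewrite mxE /= [leRHS]/Num.Def.normr/= mx_normrE.
exact: (le_bigmax _ (fun i => `|v i.1 i.2|) (0, _)).
Qed.

Lemma compact_oproj_mx m : compact (oproj_mx m).
Proof.
have cK : compact [set v : 'rV[R]_(n * n) | forall i, `[(-1), 1]%classic (v ord0 i)].
  apply: (@rV_compact _ _ (fun=> `[(-1 : R), 1]%classic)) => _.
  exact: segment_compact.
apply: (@subclosed_compact _ _ (vec_mx @` [set v : 'rV[R]_(n * n) |
    forall i, `[(-1), 1]%classic (v ord0 i)])).
- exact: closed_oproj_mx.
- apply: continuous_compact cK; apply: continuous_subspaceT.
  exact: vec_mx_continuous.
- move=> p pm; exists (mxvec p); last exact: mxvecK.
  move=> k; case/mxvec_indexP: k => i j.
  have -> : mxvec p ord0 (mxvec_index i j) = p i j by exact: mxvecE.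
  rewrite /= in_itv /= -ler_norml.
  exact: oproj_mx_le1 pm.
Qed.

(** The projection matrices of trace [m] form a closed bounded set, and the
    topology of [subsp] is that of the matrices. *)
Lemma compact_Gr m : compact (Gr R n m).
Proof.
move=> F PF FG.
pose G := (@oproj R n : subsp R n -> 'M[R]_n) @ F.
have GG : G (oproj_mx m).
  rewrite /G /= /fmap /=; apply: filterS FG => P Pm; split.
  - exact: oproj_sqr.
  - exact: oproj_sym.
  - by rewrite oproj_trace Pm.
have [p [/oproj_mx_oproj[P dP pE] cl]] := compact_oproj_mx _ GG.
exists P; split=> // A B FA; rewrite nbhsE => -[ O [[ O' oO' OE] OP] OB].
have GA : G ((@oproj R n : subsp R n -> _) @` A).
  rewrite /G; apply: (@filterS _ F _ A) => // Q AQ; by exists Q.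
have nO : nbhs p O'.
  by apply: open_nbhs_nbhs; split=> //; rewrite -pE; move: OP; rewrite -OE.
have [_ [[Q AQ <-] OQ]] := cl _ _ GA nO.
by exists Q; split=> //; apply: OB; rewrite -OE.
Qed.

(** By compactness of the Grassmannian. It lets sets of the form
    [A `*` Gr R n m] be approximated by cylinders over open sets of [R^n]. *)
Lemma tube m (A : set E) (G : set (E * subsp R n)) : open G ->
  A `*` Gr R n m `<=` G ->
  exists O, [/\ open O, A `<=` O & O `*` Gr R n m `<=` G].
Proof.
move=> oG AG.
exists [set x | \near x, Gr R n m `<=` [set P | G (x, P)]]; split.
- rewrite openE => x /= h; exact: (near_join h).
- move=> x Ax /=.
  have /compact_near_coveringP h := @compact_Gr m.
  apply: (h E (nbhs x) (fun y P => G (y, P))) => P Pm; have : nbhs (x, P : subsp R n) G.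
    by apply: open_nbhs_nbhs; split=> //; exact: AG.
  move=> [[B1 B2] /= [h1 h2] BG]; exists (B2, B1) => //= -[Q y] [/= ? ?].
  exact: BG.
- by move=> [x P] [/= /nbhs_singleton h /h].
Qed.

End GrassmannCompact.

(** * Approximation of measurable sets by open sets *)

Section Radon.
Context {R : realType} {T : topologicalType} (X : set T).
Variable mu : {outer_measure set T -> \bar R}.
Hypothesis rmu : radon_over X mu.
Local Open Scope ereal_scope.

Lemma radon_outer A (e : R) : A `<=` X -> mu A < +oo -> (0 < e)%R ->
  exists G, [/\ open G, A `<=` G & mu (G `&` X) <= mu A + e%:E].
Proof.
have [_ _ _ _ h] := rmu => AX Afin e0; rewrite (h _ AX).
set S := [set _ | _ in _].
have fS : ereal_inf S \is a fin_num.
  by rewrite -(h _ AX) ge0_fin_numE// outer_measure_ge0.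
by have [_ [G [oG AG] <-] /ltW lt] := lb_ereal_inf_adherent e0 fS; exists G.
Qed.

Lemma radon_carath G : open G -> mu.-caratheodory G.
Proof.
have [h1 _ h2 _ _] := rmu; exact: carath_open h1 h2.
Qed.

End Radon.

Lemma cara_measurable (R : realType) (T : pointedType)
    (mu : {outer_measure set T -> \bar R}) (f : T -> R) D :
  mu.-caratheodory D ->
  (forall a b : R, mu.-caratheodory (f @^-1` `]a, b[%classic)) ->
  measurable_fun (D : set (caratheodory_type mu)) f.
Proof.
move=> mD cf _; apply: (measurability _ (RGenOpens.measurableE R)) => //.
by move=> _ [_ [a [b ->] <-]]; exact: caratheodory_measurable_setI.
Qed.

Section Approx.
Context {R : realType} {n : nat}.
Local Notation Rn := 'rV[R]_n.
Variables (m : nat) (U : set Rn).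
Variable V : {outer_measure set (Rn * subsp R n) -> \bar R}.
Hypotheses (oU : open U) (vV : varifold m U V).
Local Notation wV := (weight m V).
Local Open Scope ereal_scope.

Lemma carath_setX_Gr G : open G -> G `<=` U -> V.-caratheodory (G `*` Gr R n m).
Proof.
move=> oG GU; have [_ _ h _ _] := vV.
have -> : G `*` Gr R n m = (G `*` setT) `&` (U `*` Gr R n m).
  by apply/seteqP; split=> -[x P] [] /=; [move=> Gx GP; do !split=> //; exact: GU|move=> [Gx _] [Ux GP]].
apply: h; have -> : G `*` setT = (fst : Rn * subsp R n -> Rn) @^-1` G.
  by apply/seteqP; split=> -[x P] //= [].
by apply: open_comp => // z _; exact: cvg_fst.
Qed.

Lemma weight_outer A (e : R) : A `<=` U -> wV A < +oo -> (0 < e)%R ->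
  exists G, [/\ open G, A `<=` G & wV (G `&` U) <= wV A + e%:E].
Proof.
move=> AU Afin e0.
have AX : A `*` Gr R n m `<=` U `*` Gr R n m by exact: setSX.
have [G [oG AG GA]] := radon_outer vV AX Afin e0.
have [ O [oO AO OG]] := tube oG AG.
exists O; split=> //; apply: le_trans GA; apply: le_outer_measure.
by move=> [x P] /= [[Ox Ux] GP]; split=> //; apply: OG.
Qed.

Variable dV : {outer_measure set Rn -> \bar R}.
Hypothesis rdV : radon_over U dV.
Variable E : set Rn.
Hypotheses (EU : E `<=` U) (wE : wV E < +oo) (dE : dV E < +oo).
Hypothesis mE : caratheodory_measurable (fun A => wV A + dV A) E.

(** [E] is only assumed measurable for the sum of the two measures. For an open
    [G] on which both are close to their values on [E], splitting [G] along [E]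
    makes the sum of the two excesses small, hence each of them. In particular
    [E] is measurable for each measure. *)
Lemma approx_open (e : R) : (0 < e)%R ->
  exists G, [/\ open G, E `<=` G, G `<=` U, wV (G `\` E) <= e%:E &
    dV (G `\` E) <= e%:E].
Proof.
move=> e0; have e20 : (0 < e / 2)%R by rewrite divr_gt0.
have [G1 [oG1 EG1 G1E]] := weight_outer EU wE e20.
have [G2 [oG2 EG2 G2E]] := radon_outer rdV EU dE e20.
pose G := G1 `&` G2 `&` U.
have EG : E `<=` G by move=> x Ex; split; [split; [exact: EG1|exact: EG2]|exact: EU].
have wG : wV G <= wV E + (e / 2)%:E.
  by apply: le_trans G1E; apply: le_outer_measure => x [[]].
have dG : dV G <= dV E + (e / 2)%:E.
  by apply: le_trans G2E; apply: le_outer_measure => x [[]].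
have := mE G; rewrite -setDE (setIidr EG) => sumE.
have wEf : wV E \is a fin_num by rewrite ge0_fin_numE// outer_measure_ge0.
have dEf : dV E \is a fin_num by rewrite ge0_fin_numE// outer_measure_ge0.
have : wV (G `\` E) + dV (G `\` E) <= e%:E.
  have sf : wV E + dV E \is a fin_num by rewrite fin_numD wEf.
  rewrite -(leeD2lE _ _ sf) -sumE.
  apply: le_trans (leeD wG dG) _.
  by rewrite [e in leRHS]splitr EFinD addeACA.
move=> h; exists G; split => //.
- by apply: openI => //; exact: openI.
- by move=> x [].
- by apply: le_trans h; rewrite leeDl// outer_measure_ge0.
- by apply: le_trans h; rewrite leeDr// outer_measure_ge0.
Qed.

Lemma carath_E_Gr : V.-caratheodory (E `*` Gr R n m).
Proof.
apply: carath_approx => e /approx_open[G [oG EG GU wG _]].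
exists (G `*` Gr R n m); split; first exact: carath_setX_Gr.
  exact: setSX.
apply: le_trans wG; apply: le_outer_measure => -[x P] /= [[Gx GP] h].
by split=> //; split=> // Ex; exact: h.
Qed.

Lemma carath_E_dV : dV.-caratheodory E.
Proof.
apply: carath_approx => e /approx_open[G [oG EG GU _ dG]].
by exists G; split=> //; exact: (radon_carath rdV oG).
Qed.

(** Integrates the pointwise bounds of [radial_field]: on [E] the integrand is at
    least [lo] times the indicator of the inner ball minus [hi] times that of the
    outer one. The upper bound [C] only serves integrability. *)
Lemma oint_lower (a : Rn) (s t lo hi C : R) (F : Rn * subsp R n -> R) :
  (0 <= lo)%R -> (0 <= hi)%R -> (0 <= C)%R -> (s <= t)%R -> continuous F ->
  (forall x P, Gr R n m P ->
    [/\ ecball a s x -> lo - hi <= F (x, P), ecball a t x -> ~ ecball a s x -> - hi <= F (x, P),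
      ~ ecball a t x -> F (x, P) = 0 & F (x, P) <= C]%R) ->
  (lo * fine (wV (E `&` ecball a s)) - hi * fine (wV (E `&` ecball a t)) <=
    fine (oint V (E `*` Gr R n m) (fun z => (F z)%:E)))%R.
Proof.
move=> lo0 hi0 C0 st cF hF; pose W A := wV (E `&` A).
pose D : set (Rn * subsp R n) := E `*` Gr R n m.
pose mV := (V : set (caratheodory_type V) -> \bar R).
have mo G : open G -> V.-caratheodory G by move=> oG; exact: (radon_carath (vV : radon_over _ _) oG).
have mD : measurable (D : set (caratheodory_type V)) by exact: carath_E_Gr.
pose S (r : R) : set (caratheodory_type V) := ecball a r `*` setT.
have mS r : measurable (S r).
  rewrite -[S r]setCK; apply: measurableC; apply: mo.
  have -> : ~` (S r : set (Rn * subsp R n)) = fst @^-1` (~` ecball a r).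
    by apply/seteqP; split=> -[x P] /= h; [move=> xr; apply: h|move=> [/h]].
  apply: open_comp; first by move=> z _; exact: cvg_fst.
  by apply: closed_openC; exact: closed_ecball.
have Dfin : mV D < +oo by exact: wE.
have SD r : mV (S r `&` D) = W (ecball a r).
  rewrite /W /weight /mV /=; congr (V _); apply/seteqP; split=> -[x P] /=.
    by move=> [[xr _] [Ex GP]].
  by move=> [[Ex xr] GP].
have SDfin r : mV (S r `&` D) \is a fin_num.
  rewrite ge0_fin_numE ?outer_measure_ge0//; apply: le_lt_trans Dfin.
  by apply: le_outer_measure.
have mF : measurable_fun (D : set (caratheodory_type V)) F.
  apply: cara_measurable => // u v; apply: mo.
  by move/continuousP: cF; apply; exact: interval_open.
have iF : (mV : {measure set (caratheodory_type V) -> \bar R}).-integrable D (EFin \o F).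
  apply: measurable_bounded_integrable => //.
  exists (C + hi)%R; split; first exact: num_real.
  move=> M CM [x P] [Ex GP]; apply: ltW; apply: le_lt_trans CM.
  have [f1 f2 f3 f4] := hF x P GP.
  rewrite ler_norml; apply/andP; split; last by rewrite (le_trans f4)// lerDl.
  have [xs|xs] := pselect (ecball a s x).
    by have := f1 xs; lra.
  have [xt|xt] := pselect (ecball a t x); first by have := f2 xt xs; lra.
  by rewrite f3//; lra.
have i1 r : (mV : {measure set (caratheodory_type V) -> \bar R}).-integrable D
    (EFin \o (\1_(S r) : _ -> R)).
  apply: measurable_bounded_integrable => //.
  exists 1%R; split; first exact: num_real.
  move=> M M1 z _; apply: le_trans (ltW M1); rewrite indicE.
  by case: (_ \in _); rewrite ?normr1 ?normr0.
have i2 k r : (mV : {measure set (caratheodory_type V) -> \bar R}).-integrable D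
    (EFin \o (fun z => k * \1_(S r) z)%R).
  exact: (integrableZl mD k (i1 r)).
have e2 k r : \int[mV]_(z in D) (k * \1_(S r) z)%:E = (k * fine (W (ecball a r)))%:E.
  under eq_integral do rewrite EFinM.
  rewrite integralZl//; last exact: i1.
  rewrite integral_indic//; transitivity (k%:E * mV (S r `&` D)); first by [].
  by rewrite SD EFinM fineK// -SD.
rewrite -!/(W _) -lee_fin fineK; last exact: integrable_fin_num.
rewrite EFinB -!e2 -integralB_EFin//.
apply: le_integral => //.
  exact: (integrableB mD (i2 _ _) (i2 _ _)).
move=> [x P] /set_mem[Ex GP]; rewrite -EFinB lee_fin !indicE.
have [f1 f2 f3 f4] := hF x P GP.
have inS r : ((x, P) \in S r) = (x \in ecball a r).
  by apply/idP/idP; rewrite !inE => //= -[].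
rewrite !inS.
have [xs|xs] := boolP (x \in ecball a s).
  have -> : x \in ecball a t.
    by move: xs; rewrite !inE /ecball /= => /le_trans; apply.
  by move: xs; rewrite inE => /f1; rewrite !mulr1; lra.
rewrite mulr0 sub0r; move: xs; rewrite notin_setE => xs.
have [xt|xt] := boolP (x \in ecball a t).
  by rewrite mulr1; apply: f2 => //; rewrite inE in xt.
by rewrite mulr0 oppr0 f3// => xt'; move/negP: xt; apply; rewrite inE.
Qed.

End Approx.

(** * Extensions of distributions to discontinuous fields *)

Section Ext.
Context {R : realType} {n : nat}.
Local Notation Rn := 'rV[R]_n.
Variable (U : set Rn).
Hypothesis (oU : open U).
Implicit Types (S : (Rn -> Rn) -> R) (X f g : Rn -> Rn).

(** When no measure qualifies, the choice defaults to the zero measure. *)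
Lemma varnorm_cases S : is_varnorm U S (varnorm U S) \/ varnorm U S = omzero.
Proof.
rewrite /varnorm; set P := (X in xget _ X).
have [[mu Pmu]|nP] := pselect (exists mu, P mu); [left|right].
  have [] // : P (xget (omzero : {classic {outer_measure set Rn -> \bar R}}) P).
  by apply: xgetPex; exists mu.
by apply: (@xgetPN {classic {outer_measure set Rn -> \bar R}} omzero P) => mu Pmu; apply: nP; exists mu.
Qed.

Lemma L1_extension_cases S :
  is_L1_extension U S (L1_extension U S) \/ L1_extension U S = fun=> 0.
Proof.
have [[T PT]|nP] := pselect (exists T, is_L1_extension U S T); [left|right].
  by apply: getPex; exists T.
apply: xgetPN => T PT; apply: nP; by exists T.
Qed.

Lemma varnorm_carath S G : open G -> (varnorm U S).-caratheodory G.
Proof.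
move=> oG; have [[[h1 h2 _] _]|->] := varnorm_cases S; first exact: carath_open h1 h2 oG.
exact: carath_null.
Qed.

Lemma testfun0 : testfun U (fun=> 0).
Proof.
have s0 : spt (fun=> 0 : Rn) = set0 :> set Rn.
  rewrite /spt (_ : [set _ | _] = set0) ?closure0// -subset0 => x /=.
  by rewrite eqxx.
split; last 2 first.
- by rewrite s0; exact: compact0.
- by rewrite s0.
by move=> k; apply: smoothv_Ck => i j; under eq_fun do rewrite mxE; exact: Cm_cst.
Qed.

Lemma oint_le_set (mu : {outer_measure set Rn -> \bar R}) (A : set Rn) (f : Rn -> R) :
  mu.-caratheodory A -> (forall x, 0 <= f x) -> (forall x, f x <= \1_A x) ->
  (oint mu setT (fun x => (f x)%:E) <= mu A)%E.
Proof.
move=> mA f0 fA; rewrite /oint ge0_integralTE//.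
apply: ge_ereal_sup => _ [h /= hf <-].
pose mv : {measure set (caratheodory_type mu) -> \bar R} := mu.
have -> : mu A = (\int[mv]_x (\1_A x)%:E)%E by rewrite integral_indic// setIT.
have -> : sintegral mu h = (\int[mv]_x (h x)%:E)%E.
  rewrite integral_nnsfun//; congr sintegral; apply/funext => x; by rewrite patchE in_setT.
apply: ge0_le_integral => //.
- by move=> x _; rewrite lee_fin.
- exact/measurable_EFinP.
- by apply/measurable_EFinP; exact: measurable_indic.
- by move=> x _; rewrite lee_fin; apply: le_trans (fA x); rewrite -lee_fin hf.
Qed.

(** A test field that almost attains the supremum on [O] is supported in a
    compact set, and so is a cutoff equal to [1] on its support; the open set
    where this cutoff is nonzero has almost full measure. *)
Lemma varnorm_inner S (O : set Rn) (a : Rn) (r e : R) :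
  is_varnorm U S (varnorm U S) -> open O -> O `<=` U -> O `<=` ecball a r ->
  (varnorm U S O < +oo)%E -> 0 < e ->
  exists K, [/\ compact K, K `<=` O & (varnorm U S (O `\` K) <= e%:E)%E].
Proof.
move=> vS oO OU Or Ofin e0.
set mu := varnorm U S; have [_ sE] := vS; rewrite -/mu in sE Ofin.
have Of : mu O \is a fin_num by rewrite ge0_fin_numE// outer_measure_ge0.
have := sE _ oO OU; set A := [set _ | _ in _] => OA.
have Af : ereal_sup A \is a fin_num by rewrite -OA.
have [_ [theta [[Ck ct sU] sO t1] <-] /ltW lt] := ub_ereal_sup_adherent e0 Af.
have [chi [schi chi01 chi1 cchi]] := smooth_urysohn ct oO sO.
pose K := closure [set x | chi x != 0].
have cK : compact K.
  apply: (@subclosed_compact _ _ (ecball a r)); first exact: closed_closure.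
    exact: compact_ecball.
  by apply: subset_trans Or.
exists K; split=> //.
(* [O'] is open, contains the support of [theta], and lies in [K]. *)
pose O' := chi @^-1` [set y | y != 0].
have oO' : open O'.
  apply: open_comp; first by move=> x _; exact: smooth_continuous.
  exact: open_neq.
have O'K : O' `<=` K by exact: subset_closure.
have muK : (mu O <= mu K + e%:E)%E.
  rewrite -leeBlDr// OA; apply: le_trans lt _.
  apply: (@le_trans _ _ (mu O')); last exact: le_outer_measure.
  rewrite (sE _ oO'); last by apply: subset_trans OU; exact: subset_trans cchi.
  apply: ereal_sup_ubound; exists theta => //; split=> //.
  by move=> x /chi1; rewrite /O' /= => ->; exact: oner_neq0.
have mK : mu.-caratheodory K.
  rewrite -[K]setCK; apply: caratheodory_measurable_setC.
  by apply: varnorm_carath; apply: closed_openC; exact: closed_closure.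
have KO : O `&` K = K by apply: setIidr.
have := mK O; rewrite KO => E.
have Kf : mu K \is a fin_num.
  by rewrite ge0_fin_numE ?outer_measure_ge0// (le_lt_trans _ Ofin)// le_outer_measure.
by rewrite -(leeD2lE _ _ Kf) setDE -E.
Qed.

(** The cut field is approximated in [L1] by [chi * X], where [chi] is a smooth
    cutoff supported in an open [O] around [A0] and equal to [1] on a compact set
    of almost full measure in [O]; and [S (chi * X) <= varnorm U S O]. The lower
    bound applies the same to [- chi * X]. If [varnorm] or the extension take
    their default values, the extension vanishes at the cut field. *)
Lemma ext_bound S X (A A0 : set Rn) (a : Rn) (r m0 : R) :
  S (fun=> 0) = 0 -> smoothv X -> (forall x, enorm (X x) <= 1) -> 0 <= m0 ->
  (varnorm U S).-caratheodory A0 ->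
  (forall x, A0 x -> cut0 A X x = X x) -> (forall x, ~ A0 x -> cut0 A X x = 0) ->
  (forall e : R, 0 < e -> exists O, [/\ open O, O `<=` U, O `<=` ecball a r &
    [/\ A0 `<=` O, (varnorm U S (O `\` A0) <= e%:E)%E &
      (varnorm U S O <= (m0 + e)%:E)%E]]) ->
  L1_extension U S (cut0 A X) <= m0 /\
  ((forall theta, testfun U theta -> S (fun x => - theta x) = - S theta) ->
     - m0 <= L1_extension U S (cut0 A X)).
Proof.
move=> S0 sX X1 m00 mA0 fA0 fnA0 hO.
set f := cut0 A X; set T := L1_extension U S.
suff h : T f = 0 \/ forall e, 0 < e -> exists g,
    [/\ testfun U g /\ smoothv g, T f <= S g + e, S g - e <= T f &
     exists2 O, [/\ open O, O `<=` U & (varnorm U S O <= (m0 + e)%:E)%E] &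
       is_varnorm U S (varnorm U S) /\ (spt g `<=` O /\ forall x, enorm (g x) <= 1)].
  case: h => [->|h].
    by split=> // _; rewrite oppr_le0.
  split.
    apply/ler_addgt0Pr => e e0.
    have [g [[tg smg] T1 T2 [ O [oO OU mO] [[_ vS] [sg g1]]]]] := h (e / 2) (divr_gt0 e0 (ltr0n _ 2)).
    have : ((S g)%:E <= varnorm U S O)%E.
      by rewrite vS//; apply: ereal_sup_ubound; exists g.
    move=> /le_trans/(_ mO); rewrite lee_fin; lra.
  move=> Sodd; rewrite lerNl; apply/ler_addgt0Pr => e e0.
  have [g [[tg smg] T1 T2 [ O [oO OU mO] [[_ vS] [sg g1]]]]] := h (e / 2) (divr_gt0 e0 (ltr0n _ 2)).
  have sE : spt (fun x => - g x) = spt g.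
    by rewrite /spt; congr closure; apply/seteqP; split=> x /=; rewrite oppr_eq0.
  have : ((S (fun x => - g x))%:E <= varnorm U S O)%E.
    rewrite vS//; apply: ereal_sup_ubound; exists (fun x => - g x) => //; split.
    - have [cg kg ug] := tg; split; rewrite ?sE// => k.
      apply: smoothv_Ck => i j.
      have -> : (fun x => (- g x) 0 i) = fun x => -1 * g x 0 i.
        by apply/funext => x; rewrite mxE mulN1r.
      by apply: CmM; [exact: Cm_cst|exact: smg].
    - by rewrite sE.
    - by move=> x; rewrite enormN.
  move=> /le_trans/(_ mO); rewrite Sodd// lee_fin; lra.
have [|T0] := L1_extension_cases S; last by left; rewrite /T T0.
rewrite -/T => -[c1 c2 c3].
have [Lf|/c3->] := pselect (L1 (varnorm U S) f); last by left.
have [vS|v0] := varnorm_cases S; last first.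
  left; apply/eqP; rewrite -normr_le0; apply/ler_addgt0Pr => e e0; rewrite add0r.
  have [d d0 h] := c2 _ Lf _ e0.
  have L10 : L1 (varnorm U S) (fun=> 0 : Rn).
    split; first by move=> G oG; rewrite v0; exact: carath_null.
    under eq_fun do rewrite enorm0; rewrite /oint integral0_eq//.
  have := h _ L10; rewrite (c1 _ testfun0) S0 sub0r normrN => /(_ _)/ltW; apply.
  apply: (@le_lt_trans _ _ 0%E); last by rewrite lte_fin.
  rewrite v0 /oint ge0_integralTE; last by move=> x; rewrite lee_fin enorm_ge0.
  apply: ge_ereal_sup => _ [h' /= hf <-].
  by rewrite /sintegral fsbig1// => y _; rewrite mule0.
right=> e e0.
have [d d0 h] := c2 _ Lf _ e0.
pose e' := Num.min e (d / 3).
have e'0 : 0 < e' by rewrite lt_min e0 divr_gt0.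
have [ O [oO OU Or [AO OA OM]]] := hO _ e'0.
have Ofin : (varnorm U S O < +oo)%E by exact: le_lt_trans OM (ltry _).
have [K [cK KO OK]] := varnorm_inner vS oO OU Or Ofin e'0.
have [chi [schi chi01 chi1 cchi]] := smooth_urysohn cK oO KO.
pose g x := chi x *: X x.
have sg : smoothv g.
  by move=> i k; under eq_fun do rewrite mxE; apply: CmM; [exact: schi|exact: sX].
have sptg : spt g `<=` O.
  apply: subset_trans cchi; apply: closure_subset => x /=.
  by apply: contra_neq => c0; rewrite /g c0 scale0r.
have tg : testfun U g.
  split; [by move=> k; exact: smoothv_Ck| |exact: subset_trans OU].
  apply: (@subclosed_compact _ _ (ecball a r)); first exact: closed_closure.
    exact: compact_ecball.
  exact: subset_trans Or.
have g1 x : enorm (g x) <= 1.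
  have /andP[c0 cc1] := chi01 x.
  by rewrite enormZ ger0_norm// mulr_ile1 ?enorm_ge0.
have gO x : ~ O x -> g x = 0.
  by move=> nO; apply/eqP; apply: contra_notT nO => gx; apply: sptg; exact: subset_closure.
set mu := varnorm U S in OM OA OK Ofin mA0 *.
have mop G : open G -> mu.-caratheodory G by exact: varnorm_carath.
have mK : mu.-caratheodory K.
  rewrite -[K]setCK; apply: caratheodory_measurable_setC; apply: mop.
  by apply: closed_openC; exact: compact_closed.
have L1g : L1 mu g.
  split.
    move=> G oG; apply: mop; apply: open_comp => // x _.
    by have := smoothv_Ck 0 sg; exact.
  apply: le_lt_trans Ofin; apply: oint_le_set => //; first exact: mop.
    by move=> x; exact: enorm_ge0.
  move=> x; rewrite indicE; have [xO|] := boolP (x \in O); first exact: g1.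
  by rewrite notin_setE => /gO ->; rewrite enorm0.
(* [g] and [f] agree off [D]. *)
pose D := (O `\` K) `|` (O `\` A0).
have mD : mu.-caratheodory D.
  by apply: caratheodory_measurable_setU; apply: caratheodory_measurable_setD => //; exact: mop.
have gf x : enorm (g x - f x) <= \1_D x.
  rewrite indicE; have [/set_mem Ox|] := boolP (x \in O); last first.
    rewrite notin_setE => nO; rewrite gO// /f fnA0 ?subrr ?enorm0//.
    by move=> /AO.
  have [/set_mem Dx|] := boolP (x \in D).
    have /andP[c0 cc1] := chi01 x.
    have [A0x|nA0x] := pselect (A0 x).
      rewrite /f fA0// /g -[X in _ - X x]scale1r -scalerBl enormZ distrC ger0_norm ?subr_ge0//.
      by rewrite mulr_ile1 ?enorm_ge0 ?subr_ge0// gerBl.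
    by rewrite /f fnA0// subr0.
  rewrite notin_setE => nD.
  have Kx : K x by apply: contrapT => nK; apply: nD; left.
  have A0x : A0 x by apply: contrapT => nA; apply: nD; right.
  by rewrite /f fA0// /g chi1// scale1r subrr enorm0.
have lt : (oint mu setT (fun x => (enorm (g x - f x))%:E) < d%:E)%E.
  apply: (@le_lt_trans _ _ (mu D)).
    by apply: oint_le_set => // x; exact: enorm_ge0.
  apply: (@le_lt_trans _ _ (e'%:E + e'%:E)%E).
    by apply: le_trans (outer_measureU2 _ _ _) _; exact: leeD.
  rewrite -EFinD lte_fin.
  have : e' <= d / 3 by rewrite ge_min lexx orbT.
  lra.
have := h _ L1g lt; rewrite (c1 _ tg) ltr_norml => /andP[l1 l2].
exists g; split=> //; try lra.
exists O => //; split=> //; apply: le_trans OM _; rewrite lee_fin lerD2l.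
by rewrite ge_min lexx.
Qed.

End Ext.

(** * The monotonicity formula *)

Lemma cut0E (R : realType) (n : nat) (A : set 'rV[R]_n) (f : 'rV[R]_n -> 'rV[R]_n) x :
  cut0 A f x = if x \in A then f x else 0.
Proof. by []. Qed.

Section IntDiv.
Context {R : realType} {n : nat}.
Local Notation Rn := 'rV[R]_n.
Implicit Type V : {outer_measure set (Rn * subsp R n) -> \bar R}.

(** Also for infinite integrals, as [fine] sends both infinities to [0]. *)
Lemma fine_ointN (T : pointedType) (mu : {outer_measure set T -> \bar R}) D (f : T -> R) :
  fine (oint mu D (fun z => (- f z)%:E)) = - fine (oint mu D (fun z => (f z)%:E)).
Proof.
rewrite /oint integralE [in RHS]integralE.
rewrite (_ : (fun x => (- f x)%:E) = (\- (fun x => (f x)%:E))%E) ?funeposN ?funenegN//.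
set a := integral _ _ _; set b := integral _ _ _.
have a0 : (0 <= a)%E by apply: integral_ge0 => x _; exact: funeneg_ge0.
have b0 : (0 <= b)%E by apply: integral_ge0 => x _; exact: funepos_ge0.
move: a b a0 b0 => [a| |] [b| |] //= _ _; rewrite ?oppr0//.
by rewrite opprB.
Qed.

Lemma int_divN V D (theta : Rn -> Rn) : (forall x, differentiable theta x) ->
  int_div V D (fun x => - theta x) = - int_div V D theta.
Proof.
move=> dt; rewrite -fine_ointN; congr (fine (oint _ _ _)); apply/funext => z.
congr (_%:E).
have -> : 'J (fun x => - theta x) z.1 = - 'J theta z.1.
  have dN : differentiable (fun x => - theta x) z.1 by exact: differentiableN.
  have h (v : Rn) : v *m 'J (fun x => - theta x) z.1 = - (v *m 'J theta z.1).
    have d : derivable theta z.1 v by exact: diff_derivable.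
    have := deriveN d.
    rewrite (deriveEjacobian v (dt z.1)) => <-.
    by rewrite -(deriveEjacobian v dN).
  by apply/row_matrixP => i; rewrite !rowE mulmxN.
by rewrite /mxdot mulmxN raddfN.
Qed.

Lemma first_var0 V : first_var V (fun=> 0) = 0.
Proof.
have := @int_divN V setT (fun=> 0) (fun x => differentiable_cst _ _).
under [X in int_div _ _ X]eq_fun do rewrite oppr0.
rewrite /first_var; set x := int_div _ _ _ => h; lra.
Qed.

End IntDiv.

Section Mono.
Context {R : realType} {n : nat}.
Local Notation Rn := 'rV[R]_n.
Variables (m : nat) (U : set Rn).
Variable V : {outer_measure set (Rn * subsp R n) -> \bar R}.
Hypotheses (m0 : (0 < m)%N) (oU : open U) (vV : varifold m U V).
Local Notation wV := (weight m V).
Local Notation dV := (varnorm U (first_var V)).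
Hypothesis rdV : radon_over U dV.
Variable E : set Rn.
Hypothesis EU : E `<=` U.
Hypothesis mE : caratheodory_measurable (fun A => wV A + dV A)%E E.
Variable B : set Rn.
Local Notation bE := (varnorm U (vbdry m U V E)).
Hypothesis hE : forall theta, testfun (~` B) theta ->
   int_div V (E `*` Gr R n m) theta =
       dist_restr U (first_var V) E (cut0 U theta)
       - L1_extension U (vbdry m U V E) (cut0 U theta).
Hypotheses (wE : (wV E < +oo)%E) (dE : (dV E < +oo)%E) (bEfin : (bE U < +oo)%E).

Definition Wt (A : set Rn) : R := fine (wV (E `&` A)).
(** Both terms of the bound for the first variation of the part of [V] in [E]. *)
Definition mt (A : set Rn) : R := fine (dV (E `&` A)) + fine (bE (U `&` A)).

Lemma fin_setI (mu : {outer_measure set Rn -> \bar R}) A C :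
  (mu A < +oo)%E -> mu (A `&` C) \is a fin_num.
Proof.
move=> Afin; rewrite ge0_fin_numE ?outer_measure_ge0//.
by apply: le_lt_trans Afin; apply: le_outer_measure.
Qed.

Lemma vbdry0 : vbdry m U V E (fun=> 0) = 0.
Proof.
rewrite /vbdry first_var0 subr0 /dist_restr.
have -> : cut0 E (fun=> 0 : Rn) = fun=> 0.
  by apply/funext => x; rewrite cut0E; case: ifP.
have [[c1 _ _]|->//] := L1_extension_cases U (first_var V).
by rewrite c1 ?first_var0//; exact: testfun0.
Qed.

(** The identity is applied to [- X], so that the boundary enters through an upper
    bound and the first variation through a lower bound. [ext_bound] gives lower
    bounds for odd functionals, such as the first variation. *)
Lemma int_div_le (X : Rn -> Rn) a (t' t : R) : t' < t -> smoothv X ->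
  (forall x, enorm (X x) <= 1) -> spt X `<=` ecball a t' ->
  ecball a t `<=` ~` B ->
  int_div V (E `*` Gr R n m) X <= mt (ecball a t).
Proof.
move=> tt sX X1 Xt tB.
pose Y x := - X x.
have sY : smoothv Y.
  move=> i k.
  have -> : (fun x => Y x 0 i) = fun x => -1 * X x 0 i.
    by apply/funext => x; rewrite mxE mulN1r.
  by apply: CmM; [exact: Cm_cst|exact: sX].
have sE : spt Y = spt X.
  by rewrite /spt; congr closure; apply/seteqP; split=> x /=; rewrite oppr_eq0.
have Y1 x : enorm (Y x) <= 1 by rewrite enormN.
have Y0 x : ~ eball a t x -> Y x = 0.
  move=> xt; apply/eqP; apply: contra_notT xt => Yx.
  have /Xt : spt X x by rewrite -sE; exact: subset_closure.
  by rewrite /ecball /eball /= => /le_lt_trans; apply.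
have tY : testfun (~` B) Y.
  split; first by move=> k; exact: smoothv_Ck.
    rewrite sE; apply: (@subclosed_compact _ _ (ecball a t')) => //.
      exact: closed_closure.
    exact: compact_ecball.
  rewrite sE; apply: subset_trans tB; apply: subset_trans Xt _ => x.
  by rewrite /ecball /= => /le_trans; apply; exact: ltW.
have -> : int_div V (E `*` Gr R n m) X = - int_div V (E `*` Gr R n m) Y.
  by rewrite int_divN ?opprK// => x; exact: smoothv_differentiable.
rewrite (hE tY) opprB /dist_restr.
have -> : cut0 E (cut0 U Y) = cut0 E Y.
  apply/funext => x; rewrite !cut0E; case: ifPn => // /set_mem /EU Ux.
  by rewrite mem_set.
have oball : open (eball a t) by exact: open_eball.
have balls : eball a t `<=` ecball a t by move=> x; rewrite /eball /ecball /= => /ltW.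
have [|||b1 _] := @ext_bound R n U (vbdry m U V E) Y U (U `&` eball a t) a t
  (fine (bE (U `&` ecball a t))) vbdry0 sY Y1 (fine_ge0 (outer_measure_ge0 _ _))
  (varnorm_carath _ _ (openI oU oball)) _ _ _.
- by move=> x [Ux _]; rewrite cut0E mem_set.
- move=> x nx; rewrite cut0E; case: ifPn => // /set_mem Ux.
  by apply: Y0 => xt; apply: nx.
- move=> e e0; exists (U `&` eball a t); split.
  + exact: openI.
  + by move=> x [].
  + by move=> x [_ /balls].
  + split=> //; first by rewrite setDv outer_measure0 lee_fin ltW.
    rewrite EFinD fineK; last exact: fin_setI.
    apply: (@le_trans _ _ (bE (U `&` ecball a t))).
      by apply: le_outer_measure; exact: setIS.
    by rewrite leeDl// lee_fin ltW.
have mEd : dV.-caratheodory E by exact: (carath_E_dV oU vV rdV EU wE dE mE).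
have [|||_ b2] := @ext_bound R n U (first_var V) Y E (E `&` eball a t) a t
  (fine (dV (E `&` ecball a t))) (first_var0 V) sY Y1 (fine_ge0 (outer_measure_ge0 _ _))
  (caratheodory_measurable_setI mEd (varnorm_carath _ _ oball)) _ _ _.
- by move=> x [Ex _]; rewrite cut0E mem_set.
- move=> x nx; rewrite cut0E; case: ifPn => // /set_mem Ex.
  by apply: Y0 => xt; apply: nx.
- move=> e e0.
  have [G [oG EG GU _ dG]] := approx_open oU vV rdV EU wE dE mE e0.
  exists (G `&` eball a t); split.
  + exact: openI.
  + by move=> x [/GU].
  + by move=> x [_ /balls].
  + split=> //.
    * by move=> x [/EG].
    * apply: le_trans dG; apply: le_outer_measure => x [[Gx xt] nx].
      by split=> // Ex; apply: nx.
    * rewrite EFinD fineK; last exact: fin_setI.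
      apply: (@le_trans _ _ (dV ((E `&` ecball a t) `|` (G `\` E)))).
        apply: le_outer_measure => x [Gx /balls xt].
        by have [Ex|nEx] := pselect (E x); [left|right].
      apply: le_trans (outer_measureU2 _ _ _) _; exact: leeD2l.
have : - fine (dV (E `&` ecball a t)) <= L1_extension U (first_var V) (cut0 E Y).
  apply: b2 => theta [/(_ 1%N)[dt _] _ _]; exact: int_divN.
by rewrite /mt; move: b1; lra.
Qed.

(** Test with the radial field for radii [s < s1 < t1 < t2 < t]: the divergence is
    at least [lo - hi] on the inner ball and at least [- hi] on the rest of
    the outer one. The claim
    is the limit for [s1] tending to [s] and [t1], [t2] tending to [t], with the
    factor [m^-1 <= 1] of the last term dropped. *)
Lemma monotonicity a (s t : R) : 0 < s -> s < t -> ecball a t `<=` ~` B ->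
  Wt (ecball a s) <= (s / t) ^+ m * Wt (ecball a t) + t * mt (ecball a t).
Proof.
move=> s0 st tB; have t0 := lt_trans s0 st.
have Wle r : r <= t -> Wt (ecball a r) <= Wt (ecball a t).
  move=> rt; apply: fine_le; [exact: fin_setI|exact: fin_setI|].
  by apply: le_outer_measure; apply: setIS => x; rewrite /ecball /= => /le_trans; apply.
have W0 A : 0 <= Wt A by exact/fine_ge0/outer_measure_ge0.
have mt0 A : 0 <= mt A by apply: addr_ge0; exact/fine_ge0/outer_measure_ge0.
have cinv x : 0 < x -> {for x, continuous (fun y : R => y ^- m)}.
  move=> x0; apply: (@continuousV _ _ (fun y : R => y ^+ m)).
    by rewrite expf_neq0// gt_eqF.
  exact: exprn_continuous.
apply/ler_addgt0Pr => e e0.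
pose e1 := e / (2 * (s ^+ m * Wt (ecball a t) + 1)).
have den : 0 < s ^+ m * Wt (ecball a t) + 1.
  by rewrite ltr_wpDl// mulr_ge0// exprn_ge0// ltW.
have e10 : 0 < e1 by rewrite divr_gt0// mulr_gt0.
pose h := (s + t) / 2.
have [sh ht] : s < h /\ h < t by rewrite /h; split; lra.
have [s1 [ss1 s1h s1E]] : exists s1, [/\ s < s1, s1 < h & s ^- m - s1 ^- m <= e1].
  near (s^'+) => s1; exists s1; split=> //.
  apply: ler_normlW; near: s1.
  have /cvgrPdist_le/(_ _ e10) := cinv _ s0; exact: cvg_at_right_filter.
have [t1 [ht1 t1t t1E]] : exists t1, [/\ h < t1, t1 < t & t1 ^- m - t ^- m <= e1].
  near (t^'-) => t1; exists t1; split=> //.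
  rewrite -[leLHS]opprB; apply: le_trans (ler_norm _) _; rewrite normrN; near: t1.
  have /cvgrPdist_le/(_ _ e10) := cinv _ t0; exact: cvg_at_left_filter.
have [t2 [t12 t2t]] : exists t2, t1 < t2 /\ t2 < t.
  by exists ((t1 + t) / 2); split; lra.
have s1t1 : s1 < t1 by exact: lt_trans ht1.
have t20 : 0 < t2.
  by apply: lt_trans t12; apply: lt_trans s1t1; exact: lt_trans ss1.
(* [t2 < t] keeps the support of the field in the open ball, where the
   restricted measures are bounded by those of open sets. *)
have [X [sX Xt X1 XF]] := @radial_field R n a m s s1 t1 t2 s0 ss1 s1t1 t12.
set c := s ^+ m / t2 in XF.
have c0 : 0 < c by rewrite divr_gt0// exprn_gt0.
pose hi := c * (m%:R * (t1 ^- m + s ^- m - s1 ^- m)).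
pose lo := c * (m%:R * s ^- m).
have mR : 0 < m%:R :> R by rewrite ltr0n.
have sm0 : 0 < s ^- m by rewrite invr_gt0 exprn_gt0.
have lo0 : 0 <= lo by apply: mulr_ge0; [|apply: mulr_ge0]; exact: ltW.
have s10 : 0 < s1 by exact: lt_trans ss1.
have s1s : s1 ^- m <= s ^- m.
  by rewrite lef_pV2 ?posrE ?exprn_gt0// lerXn2r ?nnegrE ?ltW.
have t10 : 0 < t1 by exact: lt_trans s1t1.
have t1m0 : 0 < t1 ^- m by rewrite invr_gt0 exprn_gt0.
have hi0 : 0 <= hi.
  apply: mulr_ge0; first exact: ltW.
  by apply: mulr_ge0; [exact: ltW|move: s1s t1m0; lra].
have cF := mxdot_continuous sX.
have low := @oint_lower R n m U V oU vV dV rdV E EU wE dE mE a s t2 lo hi lo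
  (fun z => mxdot (oproj z.2) ('J X z.1)) lo0 hi0 lo0 _ cF _.
have {}low : lo * Wt (ecball a s) - hi * Wt (ecball a t2) <= int_div V (E `*` Gr R n m) X.
  apply: low; first by apply: ltW; apply: lt_trans ss1 _; exact: lt_trans s1t1 _.
  move=> x P GP; have [f1 f2 f3 f4] := XF x P GP; split=> //= /f1.
  by apply: le_trans; rewrite le_eqVlt; apply/orP; left; apply/eqP; rewrite /lo /hi; ring.
have up := int_div_le t2t sX X1 Xt tB.
have W2 := Wle _ (ltW t2t).
have lowup : lo * Wt (ecball a s) <= mt (ecball a t) + hi * Wt (ecball a t).
  have : hi * Wt (ecball a t2) <= hi * Wt (ecball a t) by exact: ler_wpM2l.
  by move: low up; lra.
have loE : lo = m%:R / t2.
  by rewrite /lo /c; field; rewrite ?expf_neq0 ?gt_eqF.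
have hiE : hi = m%:R / t2 * (s ^+ m * (t1 ^- m + s ^- m - s1 ^- m)).
  by rewrite /hi /c; ring.
have {}lowup : Wt (ecball a s) <= t2 / m%:R * mt (ecball a t)
     + s ^+ m * (t1 ^- m + s ^- m - s1 ^- m) * Wt (ecball a t).
  have k0 : 0 < m%:R / t2 by exact: divr_gt0.
  move: lowup; rewrite loE hiE -(ler_pdivlMl _ _ k0) => /le_trans; apply.
  rewrite le_eqVlt; apply/orP; left; apply/eqP; field.
  by apply/and5P; split; rewrite ?expf_neq0// gt_eqF.
apply: le_trans lowup _.
have b1 : t2 / m%:R * mt (ecball a t) <= t * mt (ecball a t).
  apply: ler_wpM2r => //; rewrite ler_pdivrMr//.
  apply: le_trans (ltW t2t) _; apply: ler_peMr; first exact: ltW.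
  by rewrite ler1n.
have b2 : s ^+ m * (t1 ^- m + s ^- m - s1 ^- m) * Wt (ecball a t) <=
   (s / t) ^+ m * Wt (ecball a t) + e.
  apply: (@le_trans _ _ (s ^+ m * (t ^- m + 2 * e1) * Wt (ecball a t))).
    apply: ler_wpM2r => //; apply: ler_wpM2l; first by rewrite exprn_ge0// ltW.
    by move: s1E t1E; lra.
  rewrite mulrDr mulrDl expr_div_n lerD2l.
  have -> : s ^+ m * (2 * e1) * Wt (ecball a t) = 2 * e1 * (s ^+ m * Wt (ecball a t)).
    by ring.
  have -> : 2 * e1 = e / (s ^+ m * Wt (ecball a t) + 1).
    by rewrite /e1; field; rewrite gt_eqF.
  rewrite mulrAC ler_pdivrMr//; apply: ler_wpM2l; first exact: ltW.
  by rewrite lerDl.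
by move: b1 b2; lra.
Unshelve. all: by end_near. Qed.

End Mono.

(** * Vitali coverings *)

Section Vitali.
Context {R : realType} {n : nat}.
Local Notation Rn := 'rV[R]_n.
Variables (A : set Rn) (rho : Rn -> R) (L : R).
Hypothesis rhoA : forall x, A x -> 0 < rho x <= L.
Local Notation cb x := (ecball x (rho x)).

Let meets x y := cb x `&` cb y !=set0.

(** Take, by Zorn's lemma, a maximal disjoint family [G] such that every ball
    that meets [G] meets a member of at least half its radius. If some balls met
    no member, one among them of more than half the supremum of their radii could
    be added. So every ball meets a member of at least half its radius, and the
    fivefold enlargement of that member contains its center. *)
Lemma vitali_select : exists D : set Rn, [/\ D `<=` A,
  forall x y, D x -> D y -> x <> y -> ~ meets x y &
  forall x, A x -> exists2 y, D y & ecball y (5 * rho y) x].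
Proof.
pose P (G : set Rn) := [/\ G `<=` A,
  forall x y, G x -> G y -> x <> y -> ~ meets x y &
  forall x, A x -> (exists2 y, G y & meets x y) ->
    exists y, [/\ G y, meets x y & rho x <= 2 * rho y]].
have [F FP Ftot|G [[GA Gd Gm] Gmax]] := @Zorn_bigcup _ P.
  split.
  - by move=> x [G FG Gx]; have [GA _ _] := FP _ FG; exact: GA.
  - move=> x y [G FG Gx] [H FH Hy]; have [GH|HG] := Ftot _ _ FG FH.
      by have [_ d _] := FP _ FH; apply: d => //; exact: GH.
    by have [_ d _] := FP _ FG; apply: d => //; exact: HG.
  - move=> x Ax [y [G FG Gy] xy]; have [_ _ h] := FP _ FG.
    have [|z [Gz xz rz]] := h x Ax; first by exists y.
    by exists z; split=> //; exists G.
exists G; split=> // x Ax.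
suff [y [Gy [z [zx zy]] rxy]] : exists y, [/\ G y, meets x y & rho x <= 2 * rho y].
  exists y => //; rewrite /ecball /= in zx zy *.
  have := enorm_tri x z y; rewrite enormB in zx; move: zx zy rxy.
  by have := enorm_ge0 (z - y) => h0 h1 h2 h3 h4; apply: le_trans h4 _; lra.
apply: (Gm) => //; apply: contrapT => nx.
pose S := [set rho z | z in [set z | A z /\ ~ exists2 y, G y & meets z y]].
have S0 : S !=set0 by exists (rho x), x.
have Sub : has_ubound S by exists L => _ [z [Az _] <-]; have /andP[] := rhoA Az.
have Ssup : has_sup S by [].
have sup0 : 0 < sup S.
  have /andP[r0 _] := rhoA Ax; apply: lt_le_trans r0 _.
  by apply: ub_le_sup => //; exists x.
have [_ [x0 [Ax0 nx0] <-] lt] := @sup_adherent _ S (sup S / 2) (divr_gt0 sup0 (ltr0n _ 2)) Ssup.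
have mx0 : meets x0 x0.
  exists x0; split; rewrite /ecball /= subrr enorm0; by have /andP[/ltW] := rhoA Ax0.
apply: (Gmax (G `|` [set x0])); first split.
- by move=> z Gz; left.
- by move=> /(_ x0 (or_intror erefl)) Gx0; apply: nx0; exists x0.
- split.
  + by move=> z [/GA//|->].
  + move=> u v [Gu|->] [Gv|->] //; first exact: Gd.
      move=> _ [w [wu wv]]; apply: nx0; exists u => //; by exists w.
    by move=> _ [w [wu wv]]; apply: nx0; exists v => //; exists w.
  + move=> z Az [y Gy zy].
    have [zG|nzG] := pselect (exists2 y, G y & meets z y).
      by have [y' [? ? ?]] := Gm z Az zG; exists y'; split=> //; left.
    case: Gy => [Gy|yE]; first by case: nzG; exists y.
    exists x0; split; [by right|by rewrite -yE|].
    have : rho z <= sup S by apply: ub_le_sup => //; exists z.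
    by move: lt; lra.
Qed.

(** Rational points serve to enumerate disjoint families of balls. *)
Lemma ratr_dense (x : Rn) (r : R) : 0 < r ->
  exists q : 'rV[rat]_n, ecball x r (map_mx ratr q).
Proof.
move=> r0; pose e := r / n.+1%:R.
have e0 : 0 < e by rewrite divr_gt0.
have h i : exists q : rat, `|ratr q - x 0 i| <= e.
  have [|q] := @rat_in_itvoo R (x 0 i - e) (x 0 i + e); first by lra.
  rewrite in_itv /= => /andP[q1 q2]; exists q; rewrite ler_norml; apply/andP; split; lra.
have /choice[q qP] := h.
exists (\row_i q i); rewrite /ecball /=.
apply: le_trans (enorm_le_norm _) _.
apply: (@le_trans _ _ (n%:R * e)).
  apply: ler_wpM2l => //; rewrite [leLHS]/Num.Def.normr/= mx_normrE.
  by apply: bigmax_le => [|[i j] _]; [exact: ltW|rewrite !mxE ord1].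
rewrite /e mulrCA; apply: ler_piMr; first exact: ltW.
by rewrite ler_pdivrMr// mul1r ler_nat.
Qed.

Local Open Scope ereal_scope.

(** The selected balls are disjoint and contain rational points, hence are
    countably many, and their fivefold enlargements cover [A]. Of [mu] only
    finite sums over disjoint balls enter. *)
Lemma vitali_bound (W : {outer_measure set Rn -> \bar R}) (mu : set Rn -> \bar R)
    (c : R) (Mtot : \bar R) :
  (0 <= c)%R ->
  (forall s : seq Rn, uniq s -> (forall x, x \in s -> A x) ->
    (forall x y, x \in s -> y \in s -> x <> y -> ~ meets x y) ->
    \sum_(x <- s) mu (cb x) <= Mtot) ->
  (forall x, A x -> 0 <= mu (cb x)) ->
  (forall x, A x -> W (ecball x (5 * rho x)) <= c%:E * mu (cb x)) ->
  W A <= c%:E * Mtot.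
Proof.
move=> c0 hM mu0 hW.
have [D [DA Dd DC]] := vitali_select.
have /choice[code codeP] : forall x : Rn, exists q : 'rV[rat]_n,
    D x -> cb x (map_mx ratr q).
  move=> x; have [Dx|nD] := pselect (D x); last by exists (0%R : 'rV[rat]_n).
  have /andP[r0 _] := rhoA (DA _ Dx).
  by have [q qP] := ratr_dense x r0; exists q.
have cinj x y : D x -> D y -> code x = code y -> x = y.
  move=> Dx Dy cxy; apply: contrapT => xy; apply: (Dd x y) => //.
  exists (map_mx ratr (code x)); split; first exact: codeP.
  by rewrite cxy; exact: codeP.
have /choice[h hP] : forall k : nat, exists o : option Rn,
    match o with Some y => D y /\ pickle (code y) = k
    | None => ~ exists2 y, D y & pickle (code y) = k end.
  move=> k; have [[y Dy yk]|nk] := pselect (exists2 y, D y & pickle (code y) = k).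
    by exists (Some y).
  by exists None.
pose F k := if h k is Some y then ecball y (5 * rho y) else set0.
have AF : A `<=` \bigcup_k F k.
  move=> x /DC[y Dy xy]; exists (pickle (code y)) => //.
  rewrite /F; have := hP (pickle (code y)); case: (h _) => [z [Dz zy]|].
    by rewrite (cinj z y)//; exact: (pcan_inj pickleK).
  by case; exists y.
apply: (@le_trans _ _ (\sum_(k <oo) W (F k))).
  apply: le_trans (le_outer_measure W _ _ AF) _.
  exact: outer_measure_sigma_subadditive.
apply: lime_le; first by apply: is_cvg_nneseries => k _ _; exact: outer_measure_ge0.
apply: nearW => N.
pose s := pmap h (iota 0 N).
have sD y : y \in s -> D y.
  rewrite mem_pmap => /mapP[k _ hk]; have := hP k; rewrite -hk; by case.
have us : uniq s.
  apply: (@pmap_uniq _ _ h (fun y => pickle (code y))); last exact: iota_uniq.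
  move=> k; have := hP k; case: (h k) => //= y [_ <-] //.
apply: (@le_trans _ _ (\sum_(y <- s) c%:E * mu (cb y))).
  rewrite /index_iota subn0 /s; elim: (iota 0 N) => [|k t ih] /=.
    by rewrite !big_nil.
  rewrite big_cons /F; have := hP k; case: (h k) => [y [Dy _]|_] /=.
    by rewrite big_cons; apply: leeD ih; apply: hW; exact: DA.
  by rewrite outer_measure0 add0e.
rewrite big_seq -ge0_sume_distrr; last by move=> y /sD /DA; exact: mu0.
rewrite -big_seq; apply: lee_wpmul2l; first by rewrite lee_fin.
apply: hM => // [x /sD /DA//|x y /sD Dx /sD Dy]; exact: Dd.
Qed.

End Vitali.

Lemma sum_disjoint_le (R : realType) (T : eqType) (X : Type)
    (nu : {outer_measure set X -> \bar R}) (B : T -> set X) (s : seq T) (Y : set X) :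
  (forall x, x \in s -> nu.-caratheodory (B x)) -> uniq s ->
  (forall x y, x \in s -> y \in s -> x <> y -> B x `&` B y = set0) ->
  (\sum_(x <- s) nu (Y `&` B x) <= nu Y)%E.
Proof.
elim: s Y => [|x s ih] Y mB; first by rewrite big_nil outer_measure_ge0.
move=> /= /andP[xs us] dB; rewrite big_cons.
have mx : nu.-caratheodory (B x) by apply: mB; rewrite mem_head.
rewrite (mx Y); apply: leeD2l.
apply: le_trans (ih (Y `&` ~` B x) _ us _).
- rewrite le_eqVlt; apply/orP; left; apply/eqP.
  rewrite big_seq [RHS]big_seq; apply: eq_bigr => y ys; congr (nu _).
  apply/seteqP; split=> z; last by move=> [[]].
  move=> [Yz Byz]; split=> //; split=> // Bxz.
  have : (B x `&` B y) z by [].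
  rewrite dB ?mem_head ?inE ?ys ?orbT// => xy; by rewrite xy ys in xs.
- by move=> y ys; apply: mB; rewrite inE ys orbT.
- by move=> y z ys zs; apply: dB; rewrite inE ?ys ?zs orbT.
Qed.

(** * From the monotonicity formula to the isoperimetric inequality *)

Ltac nneg := repeat first [ done | by apply: ltW | apply: divr_ge0 | apply: mulr_ge0
  | apply: exprn_ge0 | apply: addr_ge0 ].

Section Core.
Context {R : realType} {n : nat}.
Local Notation Rn := 'rV[R]_n.
Variables (m : nat) (W : {outer_measure set Rn -> \bar R}) (mu : set Rn -> \bar R).
Variable B : set Rn.
Hypothesis m0 : (0 < m)%N.
Hypothesis Wfin : (W setT < +oo)%E.
Hypothesis mufin : (mu setT < +oo)%E.
Hypothesis mu_ge0 : forall A, (0 <= mu A)%E.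
Hypothesis le_mu : forall A C, A `<=` C -> (mu A <= mu C)%E.
Hypothesis mu_sum : forall (Y : set Rn) (rho : Rn -> R) (s : seq Rn), uniq s ->
  (forall x, x \in s -> ecball x (rho x) `<=` Y) ->
  (forall x y, x \in s -> y \in s -> x <> y ->
     ~ (ecball x (rho x) `&` ecball y (rho y) !=set0)) ->
  (\sum_(x <- s) mu (ecball x (rho x)) <= mu Y)%E.
Local Notation Wr A := (fine (W A)).
Local Notation mr A := (fine (mu A)).
Hypothesis mono : forall a (s t : R), 0 < s -> s < t -> ecball a t `<=` ~` B ->
  Wr (ecball a s) <= (s / t) ^+ m * Wr (ecball a t) + t * mr (ecball a t).

Lemma W_fin A : W A \is a fin_num.
Proof.
rewrite ge0_fin_numE ?outer_measure_ge0//; apply: le_lt_trans Wfin.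
exact: le_outer_measure.
Qed.

Lemma mu_fin A : mu A \is a fin_num.
Proof. by rewrite ge0_fin_numE//; apply: le_lt_trans mufin; exact: le_mu. Qed.

Lemma Wr_ge0 A : 0 <= Wr A. Proof. exact/fine_ge0/outer_measure_ge0. Qed.

Lemma mr_ge0 A : 0 <= mr A. Proof. exact/fine_ge0. Qed.

Lemma le_Wr A C : A `<=` C -> Wr A <= Wr C.
Proof. by move=> AC; apply: fine_le; rewrite ?W_fin// le_outer_measure. Qed.

Lemma le_mr A C : A `<=` C -> mr A <= mr C.
Proof. by move=> AC; apply: fine_le; rewrite ?mu_fin// le_mu. Qed.

Lemma WrU A C : Wr (A `|` C) <= Wr A + Wr C.
Proof.
by rewrite -fineD ?W_fin// fine_le ?fin_numD ?W_fin// outer_measureU2.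
Qed.

Lemma ecball_sub (a y : Rn) (r s t : R) :
  ecball a r y -> r + s <= t -> ecball y s `<=` ecball a t.
Proof.
rewrite /ecball /= => h1 h2 z /= h3; apply: le_trans (enorm_tri z y a) _.
by move: h1 h2 h3; lra.
Qed.

Lemma ecball_le (a : Rn) (s t : R) : s <= t -> ecball a s `<=` ecball a t.
Proof. by move=> st z; rewrite /ecball /= => /le_trans; apply. Qed.

(** A lower bound for the upper density, not normalized by the volume of the unit
    ball: only arbitrarily small radii are needed to start the iteration in
    [chain]. *)
Definition good (q : R) (x : Rn) := forall rho0, 0 < rho0 ->
  exists rho, [/\ 0 < rho, rho < rho0 & q * rho ^+ m <= Wr (ecball x rho)].

(** [2 ^+ m] pays for the step from [R0] to the largest dyadic multiple of the
    initial radius. [4 * 16 ^+ m] pays for the dyadic steps: the ball of radius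
    [5 * sig] lies in the one of radius [8 * sig], three steps up, which is [16]
    times the radius [sig / 2] being estimated. *)
Definition chain_cst : R := 2 ^+ m + 4 * 16 ^+ m.

Lemma dyadic_between (s L : R) : 0 < s -> s <= L ->
  exists i : nat, s * 2 ^+ i <= L /\ L < s * 2 ^+ i.+1.
Proof.
move=> s0 sL.
have ex : exists i : nat, L < s * 2 ^+ i.+1.
  have [k] : exists k : nat, L / s < k%:R.
    by exists (Num.trunc (L / s)).+1; exact: truncnS_gt.
  move=> hk; exists k; rewrite -ltr_pdivrMl// mulrC (lt_le_trans hk)//.
  rewrite -natrX ler_nat; apply: leq_trans (leqnSn _) _; apply: ltnW; exact: ltn_expl.
have [i iP imin] := ex_minnP ex; exists i; split=> //.
case: i iP imin => [|i] iP imin; first by rewrite expr0 mulr1.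
by rewrite leNgt; apply/negP => /imin; rewrite ltnn.
Qed.

(** By induction on [i], the mass ratio at the radius [S i = sig / 2 ^+ i] is at
    most [b i] times the ratio [F0] of [O] at scale [R0]: the error term of the
    formula at radius [S i] is at most [kappa / R0 * S i] times a ratio already
    estimated, and these errors form a geometric series. At the initial radius
    of [good] the ratio is at least [q]. *)
Lemma chain (y : Rn) (O : set Rn) (R0 kappa q : R) : 0 < R0 -> 0 <= kappa ->
  kappa * chain_cst <= 1 -> ecball y R0 `<=` O -> O `<=` ~` B ->
  (forall sig, 0 < sig -> sig <= R0 ->
     mr (ecball y sig) <= kappa / R0 * Wr (O `&` ecball y (5 * sig))) ->
  good q y -> q * R0 ^+ m <= (1 + kappa * chain_cst) * Wr O.
Proof.
move=> R00 k0 kC yO OB hmu gq.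
have [s [s0 sR sq]] := gq _ R00.
have [N [sN1 sN2]] := dyadic_between s0 (ltW sR).
set sig := s * 2 ^+ N in sN1.
have sig0 : 0 < sig by rewrite mulr_gt0// exprn_gt0.
have Rsig : R0 < 2 * sig by rewrite /sig mulrCA -exprS.
pose S (i : nat) : R := sig / 2 ^+ i.
have S0 i : 0 < S i by rewrite divr_gt0// exprn_gt0.
have SS i : S i = 2 * S i.+1.
  by rewrite /S exprS; field; rewrite expf_neq0.
have Sle i : S i <= sig by rewrite /S ler_pdivrMr ?exprn_gt0//; apply: ler_peMr; [exact: ltW|rewrite exprn_ege1// ler1n].
pose F0 := Wr O / R0 ^+ m.
have F00 : 0 <= F0 by rewrite divr_ge0 ?Wr_ge0// exprn_ge0// ltW.
have FR : Wr O = F0 * R0 ^+ m by rewrite /F0 divfK// expf_neq0// gt_eqF.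
have P2 : 0 < 2 ^+ m :> R by rewrite exprn_gt0.
have P16 : 0 < 16 ^+ m :> R by rewrite exprn_gt0.
(* The errors of the steps add up to a multiple of [sig - S i], the sum of the
   differences of consecutive radii. *)
pose b i := 1 + kappa * 2 ^+ m + kappa * (4 * 16 ^+ m) * ((sig - S i) / R0).
have fr i : 0 <= (sig - S i) / R0 <= 1.
  apply/andP; split; first by apply: divr_ge0; [rewrite subr_ge0 Sle|exact: ltW].
  rewrite ler_pdivrMr// mul1r.
  by have := S0 i; move: sN1; lra.
have ble i : b i <= 1 + kappa * chain_cst.
  rewrite /b /chain_cst mulrDr addrA lerD2l; apply: ler_piMr; last by have /andP[] := fr i.
  by rewrite mulr_ge0//; apply: mulr_ge0 => //; exact: ltW.
have b2 i : b i <= 2 by apply: le_trans (ble i) _; move: kC; lra.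
have key i : Wr (ecball y (S i)) <= S i ^+ m * F0 * b i.
  have [k] := ubnP i; elim: k i => // k ih [|i] /ltnSE ik.
    have SE : S 0%N = sig by rewrite /S expr0 divr1.
    rewrite /b SE subrr mul0r mulr0 addr0.
    move: sN1; rewrite le_eqVlt => /predU1P[e|lt].
      rewrite e; apply: (@le_trans _ _ (Wr O)); first exact: le_Wr.
      rewrite FR (mulrC F0); apply: ler_peMr.
        by apply: mulr_ge0 => //; rewrite exprn_ge0// ltW.
      by rewrite lerDl; apply: mulr_ge0 => //; exact: ltW.
    apply: le_trans (mono sig0 lt (subset_trans yO OB)) _.
    have h1 : Wr (ecball y R0) <= Wr O by exact: le_Wr.
    have h2 : mr (ecball y R0) <= kappa / R0 * Wr O.
      apply: le_trans (hmu _ R00 (lexx _)) _.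
      by apply: ler_wpM2l; [rewrite divr_ge0// ltW|apply: le_Wr => z []].
    apply: (@le_trans _ _ ((sig / R0) ^+ m * Wr O + R0 * (kappa / R0 * Wr O))).
      apply: lerD; apply: ler_wpM2l => //; last exact: ltW.
      by rewrite exprn_ge0// divr_ge0// ltW.
    have -> : R0 * (kappa / R0 * Wr O) = kappa * Wr O by field; rewrite gt_eqF.
    rewrite FR mulrDr mulr1; apply: lerD.
      by rewrite expr_div_n le_eqVlt; apply/orP; left; apply/eqP; field; rewrite expf_neq0// gt_eqF.
    have : R0 ^+ m <= 2 ^+ m * sig ^+ m.
      by rewrite -exprMn lerXn2r ?nnegrE ?mulr_ge0 ?ltW.
    move=> /(ler_wpM2l (mulr_ge0 k0 F00)) h.
    rewrite [leLHS]mulrA; apply: le_trans h _; rewrite le_eqVlt; apply/orP; left; apply/eqP; ring.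
  have lt : S i.+1 < S i by rewrite (SS i); have := S0 i.+1; lra.
  have SiR : S i <= R0 by exact: le_trans (Sle i) sN1.
  have hm := mono (S0 i.+1) lt (subset_trans (subset_trans (ecball_le SiR) yO) OB).
  apply: le_trans hm _.
  have Sm0 : 0 <= S i.+1 ^+ m by rewrite exprn_ge0// ltW.
  have t1 : (S i.+1 / S i) ^+ m * Wr (ecball y (S i)) <= S i.+1 ^+ m * F0 * b i.
    have Sim : 0 < S i ^+ m by rewrite exprn_gt0.
    rewrite expr_div_n mulrAC ler_pdivrMr//.
    have := ler_wpM2l Sm0 (ih i ik); move/le_trans; apply.
    by rewrite le_eqVlt; apply/orP; left; apply/eqP; ring.
  have om : Wr (O `&` ecball y (5 * S i)) <= 16 ^+ m * S i.+1 ^+ m * F0 * 2.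
    (* The first three radii have no radius three steps up; they are comparable
       with [R0], and [O] itself serves as the larger set. *)
    have [i3|i3] := ltnP i 3.
      apply: (@le_trans _ _ (Wr O)); first by apply: le_Wr => z [].
      have R16 : R0 <= 16 * S i.+1.
        apply: le_trans (ltW Rsig) _; rewrite /S (mulrA 16) ler_pdivlMr ?exprn_gt0//.
        rewrite mulrAC -exprS; apply: ler_wpM2r; first exact: ltW.
        rewrite (_ : 16 = 2 ^+ 4); last by ring.
        by rewrite ler_eXn2l// ltr1n.
      have : R0 ^+ m <= 16 ^+ m * S i.+1 ^+ m.
        rewrite -exprMn; apply: lerXn2r => //; rewrite nnegrE; first exact: ltW.
        by apply: mulr_ge0 => //; exact: ltW.
      move=> /(ler_wpM2l F00) h; rewrite FR; apply: le_trans h _.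
      rewrite mulrC; apply: ler_peMr; last by rewrite ler1n.
      by apply: mulr_ge0 => //; apply: mulr_ge0 => //; exact: ltW.
    have iE : i = (i - 3)%N.+3 by rewrite -addn3 subnK.
    have S8 : S (i - 3)%N = 16 * S i.+1.
      have -> : S (i - 3)%N = 8 * S i.
        rewrite [in RHS]iE (SS (i - 3)%N) (SS (i - 3)%N.+1) (SS (i - 3)%N.+2); ring.
      by rewrite (SS i); ring.
    apply: (@le_trans _ _ (Wr (ecball y (S (i - 3)%N)))).
      apply: le_Wr => z [_]; apply: ecball_le; rewrite S8 (SS i).
      by have := S0 i.+1; lra.
    have lti : (i - 3 < k)%N by rewrite (leq_ltn_trans _ ik)// leq_subr.
    apply: le_trans (ih _ lti) _; rewrite S8 exprMn; apply: ler_wpM2l => //.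
    by apply: mulr_ge0 => //; apply: mulr_ge0 => //; exact: ltW.
  have t2 : S i * mr (ecball y (S i)) <=
      2 * S i.+1 * (kappa / R0 * (16 ^+ m * S i.+1 ^+ m * F0 * 2)).
    rewrite -(SS i); apply: ler_wpM2l; first exact: ltW.
    apply: le_trans (hmu _ (S0 i) SiR) _; apply: ler_wpM2l => //.
    by rewrite divr_ge0// ltW.
  apply: le_trans (lerD t1 t2) _.
  rewrite le_eqVlt; apply/orP; left; apply/eqP; rewrite /b (SS i); field.
  by rewrite gt_eqF.
have SN : S N = s by rewrite /S /sig mulfK// expf_neq0.
have qF : q <= F0 * b N.
  have sm : 0 < s ^+ m by rewrite exprn_gt0.
  rewrite -(ler_pM2r sm); apply: le_trans sq _.
  by have := key N; rewrite SN => /le_trans; apply; rewrite -mulrA mulrC.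
have Rm : 0 < R0 ^+ m by rewrite exprn_gt0.
rewrite FR mulrA (mulrC _ F0) ler_pM2r//.
by apply: le_trans qF _; exact: ler_wpM2l.
Qed.

(** If no point of [A0] satisfies the smallness condition of [chain], each has a
    radius at which it fails, and [vitali_bound] applied to these balls bounds
    the mass of [A0] by [R0 / kappa * mu O]. *)
Lemma good_point (A0 O : set Rn) (R0 kappa q : R) : 0 < R0 -> 0 < kappa ->
  kappa * chain_cst <= 1 -> O `<=` ~` B ->
  (forall y, A0 y -> ecball y R0 `<=` O) -> (forall y, A0 y -> good q y) ->
  kappa * Wr A0 <= R0 * mr O \/ q * R0 ^+ m <= (1 + kappa * chain_cst) * Wr O.
Proof.
move=> R00 k0 kC OB AO Aq.
have [[y Ay hy]|no] := pselect (exists2 y, A0 y & forall sig, 0 < sig -> sig <= R0 ->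
     mr (ecball y sig) <= kappa / R0 * Wr (O `&` ecball y (5 * sig))).
  by right; apply: (@chain y) => //; [exact: ltW|exact: AO|exact: Aq].
left.
have /choice[rho rhoP] : forall y, exists sig : R, A0 y -> [/\ 0 < sig, sig <= R0 &
     kappa / R0 * Wr (O `&` ecball y (5 * sig)) < mr (ecball y sig)].
  move=> y; have [Ay|] := pselect (A0 y); last by exists 0.
  apply: contrapT => nex; apply: no; exists y => // sig s0 sR; rewrite leNgt.
  by apply/negP => h; apply: nex; exists sig.
have cb y : A0 y -> ecball y (rho y) `<=` O.
  by move=> Ay; have [_ rR _] := rhoP y Ay; apply: subset_trans (AO y Ay); exact: ecball_le.
have := @vitali_bound R n A0 rho R0 _ (orestr W O) mu (R0 / kappa) (mu O).
have rA y : A0 y -> 0 < rho y <= R0 by move=> /rhoP[-> -> _].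
move=> /(_ rA) h.
have AO' : A0 `<=` O.
  move=> y Ay; apply: (AO y Ay); rewrite /ecball /= subrr enorm0; exact: ltW.
have {h} : (orestr W O A0 <= (R0 / kappa)%:E * mu O)%E.
  apply: h.
  - by rewrite divr_ge0// ltW.
  - move=> s us sA sd; apply: mu_sum => // x /sA; exact: cb.
  - by move=> x _; exact: mu_ge0.
  - move=> y Ay; have [r0 rR lt] := rhoP y Ay.
    change (W (O `&` ecball y (5 * rho y)) <= (R0 / kappa)%:E * mu (ecball y (rho y)))%E.
    rewrite -(fineK (W_fin _)) -(fineK (mu_fin _)) -EFinM lee_fin.
    move: lt => /ltW; rewrite -ler_pdivlMl ?divr_gt0// => /le_trans; apply.
    by rewrite invf_div.
change ((W (O `&` A0) <= (R0 / kappa)%:E * mu O)%E -> kappa * Wr A0 <= R0 * mr O).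
rewrite (setIidr AO') -(fineK (W_fin _)) -(fineK (mu_fin _)) -EFinM lee_fin.
by rewrite mulrAC ler_pdivlMr// mulrC.
Qed.

Lemma Wr_null (A G : set Rn) : W (~` G) = 0%E -> Wr A <= Wr (A `&` G).
Proof.
move=> G0; rewrite -[leRHS]addr0.
have -> : 0 = Wr (~` G) by rewrite G0.
apply: le_trans (WrU _ _); apply: le_Wr => x Ax.
by have [Gx|nGx] := pselect (G x); [left|right].
Qed.

(** The level of the mass ratio used in [select_radius]. For this value
    [al / 2 * (t / 2) ^+ m = 2 * (dens_lo al * t ^+ m)], which contradicts the
    second alternative of [good_point] as soon as the ratio at [t] is smaller. *)
Definition dens_lo (al : R) : R := al / 2 ^+ m.+2.
(** What the first alternative of [good_point] gives at radius [t / 2] with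
    [kappa = chain_cst^-1]. *)
Definition bdry_lo (al : R) : R := chain_cst^-1 * dens_lo al / 2 ^+ m.-1.

Lemma chain_cst_gt0 : 0 < chain_cst.
Proof. by rewrite /chain_cst addr_gt0// ?mulr_gt0// exprn_gt0. Qed.

Lemma dens_lo_gt0 al : 0 < al -> 0 < dens_lo al.
Proof. by move=> al0; rewrite /dens_lo divr_gt0// exprn_gt0. Qed.

Lemma bdry_lo_gt0 al : 0 < al -> 0 < bdry_lo al.
Proof.
by move=> al0; rewrite /bdry_lo divr_gt0 ?exprn_gt0// mulr_gt0 ?dens_lo_gt0// invr_gt0 chain_cst_gt0.
Qed.

(** Let [t / 2] be the largest radius [d / 2 ^+ j] with mass ratio at least
    [dens_lo al]; there is one since [a] is [good]. Smallness of the mass at [d]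
    forces [j >= 4], so the ratios at [t] and [8 * t] are below this level. The
    ball of radius [t / 2] then has too much mass for its boundary term to be
    small. *)
Lemma select_radius (al d : R) (a : Rn) : 0 < al -> 0 < d ->
  W (~` good (al / 2)) = 0%E -> good (al / 2) a -> ecball a d `<=` ~` B ->
  Wr (ecball a d) < dens_lo al / 8 ^+ m * d ^+ m ->
  exists t, [/\ 0 < t, t <= d, bdry_lo al * t ^+ m.-1 <= mr (ecball a t) &
    Wr (ecball a (5 * t)) <= dens_lo al * 8 ^+ m * t ^+ m].
Proof.
move=> al0 d0 G0 ga dB small; set c := dens_lo al.
have c0 : 0 < c by exact: dens_lo_gt0.
pose tau (j : nat) : R := d / 2 ^+ j.
have tau0 j : 0 < tau j by rewrite divr_gt0// exprn_gt0.
have tauS j : tau j = 2 * tau j.+1 by rewrite /tau exprS; field; rewrite expf_neq0.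
have tau_le j : tau j <= d.
  by rewrite /tau ler_pdivrMr ?exprn_gt0//; apply: ler_peMr; [exact: ltW|rewrite exprn_ege1// ler1n].
have ex : exists j, c * tau j ^+ m <= Wr (ecball a (tau j)).
  have [rho [rho0 rhod hrho]] := ga _ d0.
  have [i [i1 i2]] := dyadic_between rho0 (ltW rhod); exists i.
  have p2 : 0 < 2 ^+ i :> R by rewrite exprn_gt0.
  have t1 : rho <= tau i by rewrite /tau ler_pdivlMr.
  have t2 : tau i <= 2 * rho.
    by rewrite /tau ler_pdivrMr//; move: i2; rewrite exprS mulrCA mulrA => /ltW.
  apply: le_trans (le_Wr (ecball_le t1)); apply: le_trans hrho.
  apply: (@le_trans _ _ (c * (2 * rho) ^+ m)).
    apply: ler_wpM2l; first exact: ltW.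
    by apply: lerXn2r => //; rewrite nnegrE; [exact: ltW|apply: mulr_ge0 => //; exact: ltW].
  have rm : 0 < rho ^+ m by rewrite exprn_gt0.
  have -> : c * (2 * rho) ^+ m = al / 4 * rho ^+ m.
    by rewrite exprMn /c /dens_lo !exprS; field; rewrite expf_neq0.
  by apply: ler_wpM2r; [exact: ltW|move: al0; lra].
have [j jP jmin] := ex_minnP ex.
have j4 : (3 < j)%N.
  rewrite ltnNge; apply/negP => j3.
  move: jP; rewrite leNgt => /negP; apply.
  apply: le_lt_trans (le_Wr (ecball_le (tau_le j))) _.
  apply: lt_le_trans small _; rewrite -/c /tau.
  rewrite mulrAC -mulrA; apply: ler_wpM2l; first exact: ltW.
  rewrite -expr_div_n.
  apply: lerXn2r; rewrite ?nnegrE ?divr_ge0 ?exprn_ge0 ?(ltW d0)//.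
  rewrite ler_wpM2l ?(ltW d0)// lef_pV2 ?posrE ?exprn_gt0//.
  by rewrite (_ : 8 = 2 ^+ 3); [rewrite ler_eXn2l// ltr1n|ring].
have [k jE] : exists k, j = k.+4.
  by exists (j - 4)%N; rewrite -addn4 subnK.
pose t := tau k.+3.
have tE : t / 2 = tau j by rewrite /t (tauS k.+3) jE; field.
have t0 : 0 < t by exact: tau0.
have nj i : (i < j)%N -> Wr (ecball a (tau i)) < c * tau i ^+ m.
  by move=> ij; rewrite ltNge; apply/negP => /jmin; rewrite leqNgt ij.
have h1 : Wr (ecball a t) < c * t ^+ m by apply: nj; rewrite jE.
have h8 : Wr (ecball a (8 * t)) < c * (8 * t) ^+ m.
  have -> : 8 * t = tau k by rewrite /t (tauS k) (tauS k.+1) (tauS k.+2); ring.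
  by apply: nj; rewrite jE -addn4 -addn1 leq_add2l.
have td : t <= d by exact: tau_le.
have OB : ecball a t `<=` ~` B by apply: subset_trans dB; exact: ecball_le.
have m1 : t ^+ m = t * t ^+ m.-1 by rewrite -exprS prednK.
have t20 : 0 < t / 2 by rewrite divr_gt0.
exists t; split=> //; last first.
  apply: (@le_trans _ _ (Wr (ecball a (8 * t)))).
    apply: le_Wr; apply: ecball_le; move: t0; lra.
  by rewrite -mulrA -exprMn ltW.
have kC : chain_cst^-1 * chain_cst <= 1 by rewrite mulVf// gt_eqF// chain_cst_gt0.
have Ci : 0 < chain_cst^-1 by rewrite invr_gt0 chain_cst_gt0.
have := @good_point (ecball a (t / 2) `&` good (al / 2)) (ecball a t) (t / 2)
  chain_cst^-1 (al / 2) t20 Ci kC OB.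
case.
- move=> y [ay _]; apply: ecball_sub ay _; move: t0; lra.
- by move=> y [].
- move=> h.
  have low : c * (t / 2) ^+ m <= Wr (ecball a (t / 2) `&` good (al / 2)).
    apply: le_trans (Wr_null _ G0); by rewrite tE.
  have := le_trans (ler_wpM2l (ltW Ci) low) h.
  have -> : chain_cst^-1 * (c * (t / 2) ^+ m) = t / 2 * (bdry_lo al * t ^+ m.-1).
    have p2 : 2 ^+ m = 2 * 2 ^+ m.-1 :> R by rewrite -exprS prednK.
    rewrite expr_div_n m1 p2 /bdry_lo -/c; field.
    by rewrite expf_neq0//= gt_eqF// chain_cst_gt0.
  by rewrite ler_pM2l.
- rewrite mulVf ?gt_eqF ?chain_cst_gt0// => h; exfalso.
  have e : al / 2 * (t / 2) ^+ m = (1 + 1) * (c * t ^+ m).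
    by rewrite expr_div_n /c /dens_lo !exprS; field; rewrite expf_neq0.
  move: h; rewrite e; move: h1; lra.
Qed.

(** Each mass [W (ecball a (5 * t))] is at most [K * t] times
    [mu (ecball a t)], so a Vitali covering gives [W A <= K * T * mu setT] for a
    bound [T] of the radii; and [T ^+ m.-1] can be taken at most
    [mu setT / bdry_lo al]. *)
Lemma cover_estimate (al d : R) (A : set Rn) : 0 < al -> 0 < d ->
  (forall a, A a -> exists t, [/\ 0 < t, t <= d, bdry_lo al * t ^+ m.-1 <= mr (ecball a t) &
    Wr (ecball a (5 * t)) <= dens_lo al * 8 ^+ m * t ^+ m]) -> A !=set0 ->
  Wr A ^+ m.-1 <= (dens_lo al * 8 ^+ m / bdry_lo al) ^+ m.-1 / bdry_lo al * mr setT ^+ m.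
Proof.
move=> al0 d0 hA [a0 Aa0].
set c := dens_lo al; set c' := bdry_lo al; set D := mr setT; set K := c * 8 ^+ m / c'.
have c0 : 0 < c by exact: dens_lo_gt0.
have c'0 : 0 < c' by exact: bdry_lo_gt0.
have K0 : 0 <= K by rewrite /K; nneg.
have D0 : 0 <= D by exact: mr_ge0.
have /choice[rho rhoP] : forall a, exists t, A a -> [/\ 0 < t, t <= d,
    c' * t ^+ m.-1 <= mr (ecball a t) & Wr (ecball a (5 * t)) <= c * 8 ^+ m * t ^+ m].
  move=> a; have [/hA[t ht]|nA] := pselect (A a); first by exists t.
  by exists 0.
have rD a : A a -> rho a ^+ m.-1 <= D / c'.
  move=> /rhoP[_ _ h _]; rewrite ler_pdivlMr// mulrC; apply: le_trans h _.
  exact: le_mr.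
have [T [T0 TA TD]] : exists T : R, [/\ 0 <= T, forall a, A a -> rho a <= T &
    T ^+ m.-1 <= D / c'].
  (* For [m = 1] the bound on [rho a ^+ m.-1] says nothing on the radius, and
     [d] serves. *)
  have [m1|m1] := posnP m.-1.
    exists d; split; first exact: ltW.
      by move=> a /rhoP[].
    by have := rD _ Aa0; rewrite m1 !expr0.
  have Dc : 0 <= D / c' by rewrite divr_ge0// ltW.
  pose T := (D / c') `^ (m.-1%:R^-1).
  have TE : T ^+ m.-1 = D / c'.
    rewrite -powR_mulrn ?powR_ge0// -powRrM mulVf ?powRr1//.
    by rewrite pnatr_eq0 -lt0n.
  exists T; split; [exact: powR_ge0| |by rewrite TE].
  move=> a Aa; have [r0 _ _ _] := rhoP _ Aa.
  rewrite -(ler_pXn2r m1) ?nnegrE ?powR_ge0 ?(ltW r0)//.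
  by rewrite TE; exact: rD.
have WA : Wr A <= K * T * D.
  have rA a : A a -> 0 < rho a <= d by move=> /rhoP[-> ->].
  have := @vitali_bound R n A rho d rA W mu (K * T) (mu setT) (mulr_ge0 K0 T0).
  move=> h; have {h} : (W A <= (K * T)%:E * mu setT)%E.
    apply: h.
    - by move=> s us sA sd; apply: mu_sum.
    - by move=> x _; exact: mu_ge0.
    - move=> a Aa; have [r0 rd h1 h2] := rhoP a Aa.
      rewrite -(fineK (W_fin _)) -(fineK (mu_fin _)) -EFinM lee_fin.
      apply: le_trans h2 _.
      have -> : rho a ^+ m = rho a * rho a ^+ m.-1 by rewrite -exprS prednK.
      have -> : c * 8 ^+ m * (rho a * rho a ^+ m.-1)
         = K * (rho a * (c' * rho a ^+ m.-1)).
        by rewrite /K; field; rewrite gt_eqF.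
      rewrite -(mulrA K T); apply: ler_wpM2l => //.
      apply: ler_pM => //; first exact: ltW.
        by nneg.
      exact: TA.
  by rewrite -(fineK (W_fin _)) -(fineK (mu_fin _)) -EFinM lee_fin.
apply: (@le_trans _ _ ((K * T * D) ^+ m.-1)).
  by apply: lerXn2r; rewrite ?nnegrE ?Wr_ge0//; nneg.
rewrite (exprMn _ (K * T)) (exprMn _ K).
have DE : D ^+ m = D * D ^+ m.-1 by rewrite -exprS prednK.
apply: (@le_trans _ _ (K ^+ m.-1 * (D / c') * D ^+ m.-1)).
  by apply: ler_wpM2r; [nneg|apply: ler_wpM2l => //; nneg].
by rewrite DE le_eqVlt; apply/orP; left; apply/eqP; ring.
Qed.

Lemma bernoulli_le (x : R) (k : nat) : 0 <= x <= 1 -> 1 - k%:R * x <= (1 - x) ^+ k.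
Proof.
move=> /andP[x0 x1]; elim: k => [|k ih]; first by rewrite mul0r subr0 expr0.
rewrite exprS.
have := ler_wpM2l (_ : 0 <= 1 - x) ih; rewrite subr_ge0 => /(_ x1); apply: le_trans.
have kx : 0 <= k%:R * x ^+ 2 by rewrite mulr_ge0// sqr_ge0.
by rewrite -natr1; move: kx; rewrite expr2; lra.
Qed.

Section Constants.
Variables (al M : R).
Hypotheses (al0 : 0 < al) (M1 : 1 <= M).

(** As [Q <= M], the bound [Q - M^-1] is at most [Q * (1 - gap)]. *)
Definition gap : R := (M ^+ 2)^-1.
(** Such that [(1 - 2 * inner_frac) ^+ m >= 1 - gap / 8] by Bernoulli's
    inequality. *)
Definition inner_frac : R := gap / (16 * m%:R).
(** Such that [inner_kappa * chain_cst = gap / 8]. *)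
Definition inner_kappa : R := gap / (8 * chain_cst).
(** Half of the mass threshold for the ball of radius [inner_frac * r], as a
    multiple of [r ^+ m]; the other half is left to points of density at least
    [Q]. *)
Definition mass_lo : R := dens_lo al / 8 ^+ m * inner_frac ^+ m / 2.
Definition bdry_frac : R := inner_kappa * mass_lo.
(** One summand for each of the two cases of [core_ineq]. *)
Definition iso_cst : R := (dens_lo al * 8 ^+ m / bdry_lo al) ^+ m.-1 / bdry_lo al + (M * al) ^+ m.-1 / bdry_frac ^+ m.

Lemma consts_gt0 : [/\ 0 < gap <= 1, 0 < inner_frac, 0 < inner_kappa, 0 < mass_lo & 0 < bdry_frac].
Proof.
have M0 : 0 < M by exact: lt_le_trans M1.
have t0 : 0 < gap by rewrite invr_gt0 exprn_gt0.
have m0' : 0 < m%:R :> R by rewrite ltr0n.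
have d0 : 0 < inner_frac by rewrite divr_gt0// mulr_gt0.
have k0 : 0 < inner_kappa by rewrite divr_gt0// mulr_gt0// chain_cst_gt0.
have c20 : 0 < mass_lo.
  by apply: divr_gt0 => //; apply: mulr_gt0; [apply: divr_gt0; [exact: dens_lo_gt0|]|]; exact: exprn_gt0.
split=> //; last exact: mulr_gt0.
by rewrite t0 /= /gap invf_le1 ?exprn_gt0// exprn_ege1.
Qed.

(** If no good point of [A] has mass at scale [inner_frac * r],
    [select_radius] and [cover_estimate] apply. Otherwise [good_point] is applied
    about such a point at the scale [(1 - 2 * inner_frac) * r]. Its second
    alternative is impossible, since
    [(1 - gap / 8) ^+ 2 > (1 + gap / 8) * (1 - gap)]; its first one bounds [r]
    in terms of [mu setT]. *)
Lemma core_ineq (Q r : R) : 1 <= Q -> Q <= M -> 0 < r ->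
  W (~` good (al / 2)) = 0%E ->
  Wr setT <= (Q - M^-1) * al * r ^+ m ->
  Wr (~` [set x | forall q, q < Q * al -> good q x]) <= mass_lo * r ^+ m ->
  let A := [set x | eball x r `<=` ~` B] in
  0 < Wr A -> Wr A ^+ m.-1 <= iso_cst * mr setT ^+ m.
Proof.
move=> Q1 QM r0 G0 Wtot WQ A WA.
have [/andP[t0 t1] d0 k0 c20 c30] := consts_gt0.
set D := mr setT; have D0 : 0 <= D by exact: mr_ge0.
have M0 : 0 < M by exact: lt_le_trans M1.
have ca0 := dens_lo_gt0 al0; have cb0 := bdry_lo_gt0 al0.
have mR : 0 < m%:R :> R by rewrite ltr0n.
have X1 : 0 <= (dens_lo al * 8 ^+ m / bdry_lo al) ^+ m.-1 / bdry_lo al.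
  by nneg.
have X2 : 0 <= (M * al) ^+ m.-1 / bdry_frac ^+ m.
  by nneg.
have DM : 0 <= D ^+ m by rewrite exprn_ge0.
have d1 : inner_frac <= 1 / 16.
  have m1 : 1 <= m%:R :> R by rewrite ler1n.
  rewrite /inner_frac ler_pdivrMr ?mulr_gt0//; move: t1 m1; lra.
have dr0 : 0 < inner_frac * r by rewrite mulr_gt0.
have AB a : A a -> ecball a (inner_frac * r) `<=` ~` B.
  move=> Aa; apply: subset_trans Aa => z; rewrite /ecball /eball /= => h.
  apply: le_lt_trans h _; move: d1 r0; nra.
have [[a [Aa ga big]]|nofound] := pselect (exists a, [/\ A a, good (al / 2) a &
    dens_lo al / 8 ^+ m * (inner_frac * r) ^+ m <= Wr (ecball a (inner_frac * r))]); last first.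
  apply: (@le_trans _ _ (Wr (A `&` good (al / 2)) ^+ m.-1)).
    by apply: lerXn2r; rewrite ?nnegrE ?Wr_ge0//; exact: Wr_null.
  apply: (@le_trans _ _ ((dens_lo al * 8 ^+ m / bdry_lo al) ^+ m.-1 / bdry_lo al * D ^+ m)).
    apply: (@cover_estimate al (inner_frac * r)) => //.
      move=> a [Aa ga]; apply: select_radius => //; first exact: AB.
      by rewrite ltNge; apply/negP => h; apply: nofound; exists a.
    apply/set0P; apply/eqP => e; move: WA; rewrite ltNge => /negP; apply.
    by apply: le_trans (Wr_null _ G0) _; rewrite e outer_measure0.
  by rewrite /iso_cst mulrDl lerDl mulr_ge0.
pose G := [set x | forall q, q < Q * al -> good q x].
(* Points of [G] are [good] at the levels below [Q * al], not at [Q * al]. *)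
pose q := Q * al * (1 - gap / 8).
have Q0 : 0 < Q by exact: lt_le_trans Q1.
have qQ : q < Q * al.
  have : 0 < Q * al by rewrite mulr_gt0.
  by rewrite /q; move: t0; nra.
pose R0 := (1 - 2 * inner_frac) * r.
have R00 : 0 < R0 by rewrite mulr_gt0//; move: d1; lra.
have kC : inner_kappa * chain_cst <= 1.
  have -> : inner_kappa * chain_cst = gap / 8 by rewrite /inner_kappa; field; rewrite gt_eqF// chain_cst_gt0.
  by move: t1; lra.
have kC' : inner_kappa * chain_cst = gap / 8 by rewrite /inner_kappa; field; rewrite gt_eqF// chain_cst_gt0.
have := @good_point (ecball a (inner_frac * r) `&` G) (eball a r) R0 inner_kappa q R00 k0 kC Aa.
case.
- move=> y [ay _] z; have := ecball_sub ay (lexx (inner_frac * r + R0)) => h /h.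
  rewrite /ecball /eball /= => h'; apply: le_lt_trans h' _.
  by rewrite /R0; move: dr0; lra.
- by move=> y [_ Gy]; exact: Gy.
- move=> h.
  have lowA : mass_lo * r ^+ m <= Wr (ecball a (inner_frac * r) `&` G).
    have h1 : Wr (ecball a (inner_frac * r)) <= Wr (ecball a (inner_frac * r) `&` G) + Wr (~` G).
      apply: le_trans (WrU _ _); apply: le_Wr => x Ax.
      by have [Gx|nGx] := pselect (G x); [left|right].
    have e : dens_lo al / 8 ^+ m * (inner_frac * r) ^+ m = 2 * (mass_lo * r ^+ m).
      by rewrite exprMn /mass_lo; field; rewrite expf_neq0.
    by move: big h1 WQ; rewrite e -/G; lra.
  have cD : bdry_frac * r ^+ m.-1 <= D.
    have h2 : inner_kappa * (mass_lo * r ^+ m) <= r * D.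
      apply: le_trans (ler_wpM2l (ltW k0) lowA) _; apply: le_trans h _.
      apply: ler_pM; [exact: ltW|exact: mr_ge0| |exact: le_mr].
      by rewrite /R0; move: dr0; lra.
    have e : inner_kappa * (mass_lo * r ^+ m) = r * (bdry_frac * r ^+ m.-1).
      have rE : r ^+ m = r * r ^+ m.-1 by rewrite -exprS prednK.
      by rewrite rE /bdry_frac; ring.
    by move: h2; rewrite e ler_pM2l.
  have rD : (r ^+ m.-1) ^+ m <= D ^+ m / bdry_frac ^+ m.
    rewrite -expr_div_n; apply: lerXn2r.
    - by rewrite nnegrE exprn_ge0// ltW.
    - by rewrite nnegrE divr_ge0// ltW.
    - by rewrite ler_pdivlMr// mulrC.
  have WAr : Wr A <= M * al * r ^+ m.
    apply: le_trans (le_Wr (@subsetT _ A)) _; apply: le_trans Wtot _.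
    apply: ler_wpM2r; first by rewrite exprn_ge0// ltW.
    apply: ler_wpM2r; first exact: ltW.
    have : 0 < M^-1 by rewrite invr_gt0.
    by move: QM; lra.
  have WAm : Wr A ^+ m.-1 <= (M * al) ^+ m.-1 * (r ^+ m.-1) ^+ m.
    rewrite -exprM mulnC exprM -exprMn; apply: lerXn2r; rewrite ?nnegrE ?Wr_ge0//.
    by nneg.
  apply: le_trans WAm _.
  have Mal : 0 <= (M * al) ^+ m.-1 by nneg.
  apply: le_trans (ler_wpM2l Mal rD) _.
  rewrite /iso_cst mulrDl; rewrite mulrA (mulrAC _ (D ^+ m)) lerDr.
  by rewrite mulr_ge0.
- rewrite kC' => h; exfalso.
  have h1 : Wr (eball a r) <= (Q - M^-1) * al * r ^+ m.
    by apply: le_trans (le_Wr (@subsetT _ _)) Wtot.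
  have t8 : 0 <= 1 + gap / 8 by move: t0; lra.
  have h2 := le_trans h (ler_wpM2l t8 h1).
  have de2 : 0 <= 2 * inner_frac <= 1 by move: d0 d1; lra.
  have bern := @bernoulli_le (2 * inner_frac) m de2.
  have me : m%:R * (2 * inner_frac) = gap / 8 by rewrite /inner_frac; field; rewrite gt_eqF.
  rewrite me in bern.
  have rm : 0 < r ^+ m by rewrite exprn_gt0.
  have qa0 : 0 <= Q * al * (1 - gap / 8).
    by apply: mulr_ge0; [apply: mulr_ge0; exact: ltW|move: t1; lra].
  have h3 : Q * al * (1 - gap / 8) * ((1 - gap / 8) * r ^+ m) <=
      (1 + gap / 8) * ((Q - M^-1) * al * r ^+ m).
    apply: le_trans h2; rewrite /q /R0 exprMn; apply: ler_wpM2l => //.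
    by apply: ler_wpM2r => //; exact: ltW.
  have alr : 0 < al * r ^+ m by rewrite mulr_gt0.
  have h4 : Q * (1 - gap / 8) * (1 - gap / 8) <= (1 + gap / 8) * (Q - M^-1).
    rewrite -(ler_pM2r alr); apply: le_trans (le_trans _ h3) _.
      by rewrite le_eqVlt; apply/orP; left; apply/eqP; ring.
    by rewrite le_eqVlt; apply/orP; left; apply/eqP; ring.
  have QMt : Q - M^-1 <= Q * (1 - gap).
    have -> : M^-1 = M * gap by rewrite /gap expr2; field; rewrite gt_eqF.
    have := ler_wpM2r (ltW t0) QM; lra.
  have := le_trans h4 (ler_wpM2l t8 QMt).
  have -> : (1 + gap / 8) * (Q * (1 - gap)) = Q * ((1 + gap / 8) * (1 - gap)) by ring.
  rewrite -mulrA ler_pM2l//.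
  have : 0 <= gap ^+ 2 by rewrite sqr_ge0.
  by rewrite expr2; move: t0; nra.
Qed.

End Constants.

End Core.

(** * Density points *)

Section Density.
Context {R : realType} {n : nat}.
Local Notation Rn := 'rV[R]_n.
Variables (m : nat) (U : set Rn).
Variable V : {outer_measure set (Rn * subsp R n) -> \bar R}.
Hypotheses (oU : open U) (vV : varifold m U V).
Local Notation wV := (weight m V).
Variable dV : {outer_measure set Rn -> \bar R}.
Hypothesis rdV : radon_over U dV.
Variable E : set Rn.
Hypotheses (EU : E `<=` U) (wE : (wV E < +oo)%E) (dE : (dV E < +oo)%E).
Hypothesis mE : caratheodory_measurable (fun A => wV A + dV A)%E E.
Local Open Scope ereal_scope.

Lemma carath_weight G : open G -> wV.-caratheodory G.
Proof.
move=> oG X.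
have : V.-caratheodory (G `*` [set: subsp R n]).
  apply: (radon_carath (vV : radon_over _ _)).
  have -> : G `*` setT = (fst : Rn * subsp R n -> Rn) @^-1` G.
    by apply/seteqP; split=> -[x P] //= [].
  by apply: open_comp => // z _; exact: cvg_fst.
move=> /(_ (X `*` Gr R n m)); rewrite /= /weight => ->; congr (V _ + V _).
  by apply/seteqP; split=> -[x P] /=; [move=> [[? ?] [? _]]|move=> [[? ?] ?]].
apply/seteqP; split=> -[x P] /=; first by move=> [[Xx GP] h]; split=> //; split=> // Gx; apply: h.
by move=> [[Xx nG] GP]; split=> // -[].
Qed.

Lemma carath_weight_ecball a r : wV.-caratheodory (ecball a r).
Proof.
rewrite -[ecball a r]setCK; apply: caratheodory_measurable_setC; apply: carath_weight.
by apply: closed_openC; exact: closed_ecball.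
Qed.

Lemma carath_weight_E : wV.-caratheodory E.
Proof.
apply: carath_approx => e /(approx_open oU vV rdV EU wE dE mE)[G [oG EG GU wG _]].
by exists G; split=> //; exact: carath_weight.
Qed.

Lemma weight_compact K : compact K -> K `<=` U -> wV K < +oo.
Proof.
move=> cK KU; have [_ h _ _ _] := vV; apply: h.
  by apply: compact_setX => //; exact: compact_Gr.
exact: setSX.
Qed.

(** The points that are not density points of [E]: the complement of [E] keeps a
    fixed share of the weight of small balls. The second bound excludes that this
    weight decays too fast for a doubling argument. *)
Definition shared (b : R) (i : nat) (x : Rn) := exists rho0 : R, (0 < rho0)%R /\
  forall rho : R, (0 < rho)%R -> (rho < rho0)%R ->
    wV (ecball x rho) <= i%:R%:E * wV (~` E `&` ecball x rho) /\
    (b * rho ^+ m)%:E <= wV (ecball x rho).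

(** Otherwise the mass of the balls of radius [rho0 / 5 ^+ k] would be at most
    [(2 * 5 ^+ m) ^- k] times a constant, against the lower bound by
    [b * (rho0 / 5 ^+ k) ^+ m]. *)
Lemma doubling_radius (b : R) (x : Rn) (rho0 : R) : (0 < b)%R -> (0 < rho0)%R ->
  wV (ecball x rho0) < +oo ->
  (forall rho : R, (0 < rho)%R -> (rho <= rho0)%R ->
    (b * rho ^+ m)%:E <= wV (ecball x rho)) ->
  exists rho : R, [/\ (0 < rho)%R, (rho <= rho0)%R &
    wV (ecball x (5 * rho)) <= (2 * 5 ^+ m)%:E * wV (ecball x rho)].
Proof.
move=> b0 r0 fin hb; apply: contrapT => nex.
have f5 k : (0 < 5 ^+ k :> R)%R by rewrite exprn_gt0.
have wf rho : (rho <= rho0)%R -> wV (ecball x rho) \is a fin_num.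
  move=> rr; rewrite ge0_fin_numE ?outer_measure_ge0//; apply: le_lt_trans fin.
  by apply: le_outer_measure; exact: ecball_le.
have key k : ((2 * 5 ^+ m) ^+ k * fine (wV (ecball x (rho0 / 5 ^+ k)))
    <= fine (wV (ecball x rho0)))%R.
  elim: k => [|k ih]; first by rewrite !expr0 divr1 mul1r.
  have rk : (rho0 / 5 ^+ k.+1 <= rho0)%R.
    by rewrite ler_pdivrMr//; apply: ler_peMr; [exact: ltW|rewrite exprn_ege1// ler1n].
  have rk' : (rho0 / 5 ^+ k <= rho0)%R.
    by rewrite ler_pdivrMr//; apply: ler_peMr; [exact: ltW|rewrite exprn_ege1// ler1n].
  apply: le_trans ih; rewrite exprSr -mulrA; apply: ler_wpM2l.
    by rewrite exprn_ge0// mulr_ge0// exprn_ge0.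
  rewrite leNgt; apply/negP => lt; apply: nex; exists (rho0 / 5 ^+ k.+1)%R; split=> //.
    by rewrite divr_gt0.
  have -> : (5 * (rho0 / 5 ^+ k.+1) = rho0 / 5 ^+ k)%R.
    by rewrite exprS; field; rewrite expf_neq0.
  by rewrite -(fineK (wf _ rk)) -(fineK (wf _ rk')) -EFinM lee_fin ltW.
have [k hk] : exists k : nat, (fine (wV (ecball x rho0)) / (b * rho0 ^+ m) < k%:R)%R.
  by exists (Num.trunc (fine (wV (ecball x rho0)) / (b * rho0 ^+ m))%R).+1; exact: truncnS_gt.
have rm : (0 < b * rho0 ^+ m)%R by rewrite mulr_gt0// exprn_gt0.
move: hk; rewrite ltr_pdivrMr// ltNge => /negP; apply.
apply: le_trans (key k).
have rk : (rho0 / 5 ^+ k <= rho0)%R.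
  by rewrite ler_pdivrMr//; apply: ler_peMr; [exact: ltW|rewrite exprn_ege1// ler1n].
have := hb _ (divr_gt0 r0 (f5 k)) rk; rewrite -(fineK (wf _ rk)) lee_fin => h.
have p0 : (0 <= (2 * 5 ^+ m) ^+ k :> R)%R by rewrite exprn_ge0// mulr_ge0// exprn_ge0.
apply: le_trans (ler_wpM2l p0 h).
have -> : ((2 * 5 ^+ m) ^+ k * (b * (rho0 / 5 ^+ k) ^+ m) = 2 ^+ k * (b * rho0 ^+ m))%R.
  rewrite exprMn expr_div_n -!exprM (mulnC k m); field.
  by rewrite expf_neq0.
apply: ler_wpM2r; first exact: ltW.
by rewrite -natrX ler_nat ltnW// ltn_expl.
Qed.

(** Cover by doubling balls inside an open [G] that exceeds [E] by little mass.
    A fixed share of the weight of these balls lies in [G `\` E]. *)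
Lemma shared_null (b : R) (i : nat) : (0 < b)%R -> wV (E `&` shared b i) = 0.
Proof.
move=> b0; apply/eqP; rewrite eq_le outer_measure_ge0 andbT.
pose C : R := (2 * 5 ^+ m * i%:R)%R.
have C0 : (0 <= C)%R by rewrite /C !mulr_ge0// exprn_ge0.
apply/lee_addgt0Pr => e e0; rewrite add0e.
have e10 : (0 < e / (C + 1))%R by rewrite divr_gt0// ltr_wpDl.
have [G [oG EG GU wG _]] := approx_open oU vV rdV EU wE dE mE e10.
have /choice[rho rhoP] : forall x : Rn, exists r : R, E x -> shared b i x ->
   [/\ (0 < r)%R, (r <= 1)%R, ecball x r `<=` G &
     wV (ecball x (5 * r)) <= C%:E * orestr wV (~` E) (ecball x r)].
  move=> x; have [Ex|] := pselect (E x); last by exists 0%R.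
  have [[rho0 [r0 h]]|] := pselect (shared b i x); last by exists 0%R.
  have [r1 r10 r1G] := nbhs_eball (open_nbhs_nbhs (conj oG (EG _ Ex))).
  (* Small enough for [shared], for the ball to lie in [G], and for the radii to
     be bounded. *)
  pose r2 := Num.min (rho0 / 2)%R (Num.min r1 1%R).
  have r20 : (0 < r2)%R by rewrite !lt_min divr_gt0//= r10 ltr01.
  have r2r0 : (r2 < rho0)%R.
    apply: (@le_lt_trans _ _ (rho0 / 2)%R); first by rewrite ge_min lexx.
    by move: r0; lra.
  have r2r1 : (r2 <= r1)%R by rewrite !ge_min lexx orbT.
  have r21 : (r2 <= 1)%R by rewrite !ge_min lexx !orbT.
  have fin : wV (ecball x r2) < +oo.
    apply: weight_compact; first exact: compact_ecball.
    by apply: subset_trans GU; apply: subset_trans r1G; exact: ecball_le.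
  have [|r [rr0 rr2 hr]] := doubling_radius b0 r20 fin.
    by move=> r rr0 rr2; have [] := h r rr0 (le_lt_trans rr2 r2r0).
  exists r => _ _; split => //; first exact: le_trans rr2 r21.
    by apply: subset_trans r1G; apply: ecball_le; exact: le_trans rr2 r2r1.
  apply: le_trans hr _; have [h1 _] := h r rr0 (le_lt_trans rr2 r2r0).
  rewrite /C (EFinM (2 * 5 ^+ m)%R i%:R) -muleA; apply: lee_wpmul2l.
    by rewrite lee_fin mulr_ge0// exprn_ge0.
  exact: h1.
have rA x : (E `&` shared b i) x -> (0 < rho x <= 1)%R.
  by move=> [Ex sx]; have [-> ->] := rhoP x Ex sx.
have := @vitali_bound R n (E `&` shared b i) rho 1 rA wV (orestr wV (~` E)) C (wV (G `\` E)) C0.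
move=> h; apply: (@le_trans _ _ (C%:E * wV (G `\` E))).
  apply: h.
  - move=> s us sA sd.
    have sub x : x \in s -> ecball x (rho x) `<=` G.
      by move=> /sA[Ex sx]; have [] := rhoP x Ex sx.
    apply: le_trans (sum_disjoint_le (B := fun x => ecball x (rho x)) (s := s) (G `\` E) _ us _).
    + rewrite le_eqVlt; apply/orP; left; apply/eqP; rewrite big_seq [RHS]big_seq.
      apply: eq_bigr => x xs; rewrite /= /orestr; congr (V (_ `*` _)).
      apply/seteqP; split=> z; first by move=> [nE zx]; do !split=> //; exact: sub zx.
      by move=> [[_ nE] zx].
    + by move=> x _; exact: carath_weight_ecball.
    + move=> x y xs ys xy; rewrite -subset0 => z zxy.
      by apply: (sd x y) => //; exists z.
  - by move=> x _; exact: outer_measure_ge0.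
  - by move=> x [Ex sx]; have [] := rhoP x Ex sx.
apply: (@le_trans _ _ (C%:E * (e / (C + 1))%:E)).
  by apply: lee_wpmul2l => //; rewrite lee_fin.
rewrite -EFinM lee_fin mulrA ler_pdivrMr ?ltr_wpDl// mulrC.
by apply: ler_wpM2l; [exact: ltW|rewrite lerDl].
Qed.

Lemma density_ge (x : Rn) (l : \bar R) (c : R) : (0 < alpha R m)%R ->
  has_density m wV x l -> c%:E < l -> exists rho0 : R, (0 < rho0)%R /\
    forall rho : R, (0 < rho)%R -> (rho < rho0)%R ->
      (c * alpha R m * rho ^+ m)%:E <= wV (ecball x rho).
Proof.
move=> al0 hd cl.
have : nbhs l [set y | c%:E < y].
  by apply: open_nbhs_nbhs; split=> //; exact: open_ereal_gt_ereal.
move=> /hd; rewrite /= => -[d /= d0 h]; exists d; split=> // rho r0 rd.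
have := h rho; rewrite /= sub0r normrN gtr0_norm// => /(_ rd r0) /ltW.
rewrite lee_pdivlMr ?mulr_gt0 ?exprn_gt0//.
by rewrite -EFinM mulrA.
Qed.

(** If [W] fails to be [good] at a level below the density, [E] has a smaller
    density than the whole weight, so its complement keeps a fixed share of all
    small balls, and [shared_null] applies. *)
Lemma density_good : (0 < alpha R m)%R ->
  wV (E `&` [set x | exists l, [/\ has_density m wV x l, 1 <= l &
    exists q : R, q%:E < (alpha R m)%:E * l /\ ~ good m (orestr wV E) q x]]) = 0.
Proof.
move=> al0; set al := alpha R m in al0 *; set N := E `&` _.
have a20 : (0 < al / 2)%R by rewrite divr_gt0.
have : N `<=` \bigcup_i (E `&` shared (al / 2) i).
  move=> x [Ex [l [hd l1 [q [ql nq]]]]].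
  have [c [cl cq c0]] : exists c : R, [/\ c%:E < l, (q < c * al)%R & (1 / 2 <= c)%R].
    move: l l1 ql {hd} => [l| |] // l1 ql.
      rewrite -EFinM lte_fin in ql; rewrite lee_fin in l1.
      have ql' : (q / al < l)%R by rewrite ltr_pdivrMr// mulrC.
      exists (Num.max (1 / 2) ((q / al + l) / 2))%R; split.
      - rewrite lte_fin gt_max; apply/andP; split; [move: l1; lra|move: ql'; lra].
      - rewrite -ltr_pdivrMr// lt_max; apply/orP; right; move: ql'; lra.
      - by rewrite le_max lexx.
    exists (Num.max (1 / 2) (q / al + 1))%R; split; first by rewrite ltry.
    - by rewrite -ltr_pdivrMr// lt_max; apply/orP; right; lra.
    - by rewrite le_max lexx.
  have [rho0 [r0 h1]] := density_ge al0 hd cl.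
  have [rho1 [r1 h2]] : exists rho1 : R, (0 < rho1)%R /\ forall rho : R, (0 < rho)%R ->
      (rho < rho1)%R -> (fine (orestr wV E (ecball x rho)) < q * rho ^+ m)%R.
    apply: contrapT => nex; apply: nq => rho1 r1; apply: contrapT => nex'.
    apply: nex; exists rho1; split=> // rho rr0 rr1; rewrite ltNge; apply/negP => h.
    by apply: nex'; exists rho.
  have cq0 : (0 < c * al - q)%R by rewrite subr_gt0.
  have [i hi] : exists i : nat, (c * al / (c * al - q) < i%:R)%R.
    by exists (Num.trunc (c * al / (c * al - q))%R).+1; exact: truncnS_gt.
  exists i => //; split=> //; exists (Num.min rho0 rho1); split.
    by rewrite lt_min r0.
  move=> rho rr0; rewrite lt_min => /andP[rr1 rr2].
  have w1 := h1 _ rr0 rr1; have w2 := h2 _ rr0 rr2.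
  have rm : (0 < rho ^+ m)%R by rewrite exprn_gt0.
  split; last first.
    apply: le_trans w1; rewrite lee_fin; apply: ler_wpM2r; first exact: ltW.
    by rewrite mulrC; apply: ler_wpM2r; [exact: ltW|move: c0; lra].
  have := carath_weight_E (ecball x rho).
  set w := wV (ecball x rho) in w1 *.
  rewrite !(setIC (ecball x rho)).
  set we := wV (E `&` _); set wn := wV (~` E `&` _).
  have wef : we \is a fin_num.
    rewrite ge0_fin_numE ?outer_measure_ge0//; apply: le_lt_trans wE.
    exact: le_outer_measure.
  have wn0 : 0 <= wn by exact: outer_measure_ge0.
  have i0 : (0 < i%:R :> R)%R.
    by apply: le_lt_trans hi; rewrite divr_ge0 ?ltW// mulr_gt0//; move: c0; lra.
  have w2' : (fine we < q * rho ^+ m)%R by exact: w2.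
  have we0 : (0 <= fine we)%R by exact/fine_ge0/outer_measure_ge0.
  move: w1; rewrite -(fineK wef).
  move: wn wn0 => [wn| |] // wn0 w1 wE'; last by rewrite mulry gtr0_sg// mul1e leey.
  rewrite wE' -EFinD -EFinM lee_fin.
  move: w1; rewrite wE' -EFinD lee_fin => w1.
  have i1 : (c * al < i%:R * (c * al - q))%R by rewrite -ltr_pdivrMr.
  have h3 : ((c * al - q) * (fine we + wn) <= c * al * wn)%R.
    have q0 : (0 < q)%R by rewrite -(pmulr_lgt0 _ rm); exact: le_lt_trans we0 w2'.
    have h4 : (c * al * fine we <= q * (fine we + wn))%R.
      have ca0 : (0 < c * al)%R by move: cq0 q0; lra.
      apply: (@le_trans _ _ (q * (c * al * rho ^+ m))%R); last first.
        by apply: ler_wpM2l => //; exact: ltW.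
      have := ler_wpM2l (ltW ca0) (ltW w2').
      by move/le_trans; apply; rewrite le_eqVlt; apply/orP; left; apply/eqP; ring.
    by move: h4; rewrite !mulrDr !mulrBl; lra.
  rewrite lee_fin in wn0.
  rewrite -(ler_pM2l cq0); apply: le_trans h3 _.
  by rewrite mulrCA mulrA; apply: ler_wpM2r => //; exact: ltW.
move=> Nsub; apply: outer_subset0 Nsub _.
apply/eqP; rewrite eq_le outer_measure_ge0 andbT.
apply: le_trans (outer_measure_sigma_subadditive wV _) _.
by rewrite eseries0// => i _ _; exact: shared_null.
Qed.

End Density.

(** * The isoperimetric inequality for varifolds *)

Section Isoperimetric.
Context {R : realType} {n : nat}.
Local Notation Rn := 'rV[R]_n.
Local Open Scope ereal_scope.

(** The ratios defining the density are then at most [0]. This covers the case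
    of a degenerate normalizing constant without computing the volume of the unit
    ball. *)
Lemma alpha_le0_density (m : nat) (mu : {outer_measure set Rn -> \bar R}) x l :
  (alpha R m <= 0)%R -> has_density m mu x l -> ~ 1 <= l.
Proof.
move=> al0 hd l1.
have : nbhs l [set y | 0%:E < y].
  apply: open_nbhs_nbhs; split; first exact: open_ereal_gt_ereal.
  by apply: lt_le_trans l1; rewrite lte_fin.
move=> /hd; rewrite /= => -[d /= d0 h].
have d2 : (0 < d / 2)%R by rewrite divr_gt0.
have := h (d / 2)%R; rewrite /= sub0r normrN gtr0_norm//.
have dd : (d / 2 < d)%R by move: d0; lra.
move=> /(_ dd d2); rewrite ltNge => /negP; apply.
apply: mule_ge0_le0; first exact: outer_measure_ge0.
rewrite lee_fin invr_le0; apply: mulr_le0_ge0 => //.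
by rewrite exprn_ge0// ltW.
Qed.

Lemma pow00_le (w : \bar R) (D L : R) (m : nat) : (0 < m)%N -> 0 < w -> w \is a fin_num ->
  (0 <= D)%R -> (0 <= L)%R -> (fine w ^+ m.-1 <= (L * D) ^+ m)%R ->
  pow00 w (1 - m%:R^-1) <= (L * D)%:E.
Proof.
move=> m0 w0 wf D0 L0 h; rewrite /pow00 gt_eqF//.
have w0' : (0 < fine w)%R by rewrite fine_gt0// w0 ltey_eq wf.
rewrite -(fineK wf) poweR_EFin lee_fin.
rewrite -(ler_pXn2r m0) ?nnegrE ?powR_ge0 ?mulr_ge0//.
apply: le_trans h.
have m0' : m%:R != 0%R :> R by rewrite pnatr_eq0 -lt0n.
have em : ((1 - m%:R^-1) * m%:R = m.-1%:R :> R)%R.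
  by rewrite mulrBl mul1r mulVf// -{1}(prednK m0) -natr1 addrK.
have -> : ((fine w `^ (1 - m%:R^-1)) ^+ m = fine w ^+ m.-1)%R.
  rewrite -[LHS](powR_mulrn _ (powR_ge0 _ _)) -powRrM em.
  by rewrite powR_mulrn// ltW.
by [].
Qed.

Variables (m : nat) (U : set Rn).
Variable V : {outer_measure set (Rn * subsp R n) -> \bar R}.
Hypotheses (m0 : (0 < m)%N) (oU : open U) (vV : varifold m U V).
Local Notation wV := (weight m V).
Local Notation dV := (varnorm U (first_var V)).
Hypothesis rdV : radon_over U dV.
Hypothesis dens1 : wV (U `&` ~` [set x | exists2 l, has_density m wV x l & 1 <= l]) = 0.
Variable E : set Rn.
Hypothesis EU : E `<=` U.
Hypothesis mE : caratheodory_measurable (fun A => wV A + dV A) E.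
Variable B : set Rn.
Local Notation bE := (varnorm U (vbdry m U V E)).
Hypothesis hE : forall theta, testfun (~` B) theta ->
   int_div V (E `*` Gr R n m) theta =
       (dist_restr U (first_var V) E (cut0 U theta)
       - L1_extension U (vbdry m U V E) (cut0 U theta))%R.

Lemma carath_varnorm_ecball S a r : (varnorm U S).-caratheodory (ecball a r).
Proof.
rewrite -[ecball a r]setCK; apply: caratheodory_measurable_setC; apply: varnorm_carath.
by apply: closed_openC; exact: closed_ecball.
Qed.

(** [core_ineq] for the part of the weight in [E] and the sum of the two boundary
    measures. The exceptional sets of points that are not [good] at the required
    level are null by [density_good] and the lower bound on the density, up to the
    points of [E] of density less than [Q]. *)
Lemma isoperimetric (M Q r : R) : (0 < alpha R m)%R -> (1 <= M)%R ->
  (1 <= Q)%R -> (Q <= M)%R -> (0 < r)%R ->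
  dV E < +oo -> bE U < +oo ->
  wV E <= ((Q - M^-1) * alpha R m * r ^+ m)%:E ->
  wV (E `&` [set x | exists2 l, has_density m wV x l & l < Q%:E])
     <= (mass_lo m (alpha R m) M * r ^+ m)%:E ->
  let A := [set x | eball x r `<=` ~` B] in 0 < wV (E `&` A) ->
  (fine (wV (E `&` A)) ^+ m.-1 <= iso_cst m (alpha R m) M * fine (bE U + dV E) ^+ m)%R.
Proof.
move=> al0 M1 Q1 QM r0 dE bEfin wEle wQ A wA.
have wE : wV E < +oo by apply: le_lt_trans wEle (ltry _).
have dEf C : dV (E `&` C) \is a fin_num by exact: fin_setI.
have bEf C : bE (U `&` C) \is a fin_num by exact: fin_setI.
pose W := orestr wV E.
pose mu (S : set Rn) := dV (E `&` S) + bE (U `&` S).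
have bad0 := density_good oU vV rdV EU wE dE mE al0.
set bad := [set x | _] in bad0.
have dens0 := dens1; set dl := [set x | exists2 l, _ & 1 <= l] in dens0.
have negl (S : set Rn) : (E `&` S) `<=` (E `&` bad) `|` (U `&` ~` dl) -> wV (E `&` S) = 0.
  move=> h; apply: outer_subset0 h _; apply/eqP; rewrite eq_le outer_measure_ge0 andbT.
  apply: le_trans (outer_measureU2 _ _ _) _. 
  by change (wV (E `&` bad) + wV (U `&` ~` dl) <= 0); rewrite bad0 dens0 adde0.
have := @core_ineq R n m W mu B m0 _ _ _ _ _ _ (alpha R m) M al0 M1 Q r Q1 QM r0 _ _ _ _.
move=> core.
have -> : bE U + dV E = mu setT by rewrite /mu !setIT addeC.
apply: core.
- by apply: le_lt_trans wE; apply: le_outer_measure.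
- by rewrite /mu !setIT lte_add_pinfty.
- by move=> S; apply: adde_ge0; exact: outer_measure_ge0.
- by move=> S T ST; apply: leeD; apply: le_outer_measure; exact: setIS.
- move=> Y rho s us sY sd; rewrite /mu big_split /=.
  have sub (nu : {outer_measure set Rn -> \bar R}) (F : set Rn) :
      (forall x, nu.-caratheodory (ecball x (rho x))) ->
      \sum_(x <- s) nu (F `&` ecball x (rho x)) <= nu (F `&` Y).
    move=> nuc.
    apply: le_trans (sum_disjoint_le (B := fun x => ecball x (rho x)) (s := s) (F `&` Y) _ us _).
    + rewrite le_eqVlt; apply/orP; left; apply/eqP; rewrite big_seq [RHS]big_seq.
      apply: eq_bigr => x xs; congr (nu _); apply/seteqP; split=> z.
        by move=> [Fz zx]; split=> //; split=> //; exact: sY zx.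
      by move=> [[Fz _] zx].
    + by move=> x _; exact: nuc.
    + move=> x y xs ys xy; rewrite -subset0 => z zxy.
      by apply: (sd x y) => //; exists z.
  by apply: leeD; apply: sub => x; exact: carath_varnorm_ecball.
- move=> a s t s0 st tB.
  have := monotonicity m0 oU vV rdV EU mE hE wE dE bEfin s0 st tB.
  by rewrite /Wt /mt /mu fineD.
- apply: negl => x [Ex ng].
  have [[l hd l1]|nd] := pselect (dl x); last by right; split=> //; exact: EU.
  left; split=> //; exists l; split=> //; exists (alpha R m / 2)%R; split=> //.
  apply: (@lt_le_trans _ _ ((alpha R m)%:E * 1)).
    by rewrite mule1 lte_fin; move: al0; lra.
  by apply: lee_wpmul2l => //; rewrite lee_fin ltW.
- rewrite -lee_fin fineK; last by rewrite /W; exact: (fin_setI _ wE).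
  by apply: le_trans wEle; apply: le_outer_measure.
- rewrite -lee_fin fineK; last by rewrite /W; exact: (fin_setI _ wE).
  apply: le_trans wQ.
  set LQ := [set x | _ ]; set EQ := E `&` [set x | exists2 l, _ & _].
  apply: (@le_trans _ _ (wV (EQ `|` (E `&` (~` LQ `\` EQ))))).
    apply: le_outer_measure => x [Ex nx].
    by have [?|?] := pselect (EQ x); [left|right].
  apply: le_trans (outer_measureU2 _ _ _) _.
  rewrite [X in _ + X]negl ?adde0// => x [Ex [nL nE]].
  have [[l hd l1]|nd] := pselect (dl x); last by right; split=> //; exact: EU.
  left; split=> //; exists l; split=> //.
  have Ql : Q%:E <= l.
    by rewrite leNgt; apply/negP => lQ; apply: nE; split=> //; exists l.
  apply: contrapT => nex; apply: nL => q qQ; apply: contrapT => ng; apply: nex.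
  exists q; split=> //; apply: (@lt_le_trans _ _ ((alpha R m)%:E * Q%:E)).
    by rewrite -EFinM lte_fin mulrC.
  by apply: lee_wpmul2l => //; rewrite lee_fin ltW.
- have f : wV (E `&` A) \is a fin_num by exact: (fin_setI _ wE).
  by apply: fine_gt0; rewrite wA ltey_eq f.
Qed.

End Isoperimetric.

Theorem mainTheorem3 (R : realType) (M : R) (hM : 1 <= M) :
  exists Lambda : R, 0 < Lambda /\
  forall (m n : nat), (0 < m)%N -> (m <= n)%N -> n%:R <= M ->
  forall (U : set 'rV[R]_n), open U ->
  forall (V : {outer_measure set ('rV[R]_n * subsp R n) -> \bar R}),
  varifold m U V ->
  let wV := weight m V in
  let dV := varnorm U (first_var V) in
  radon_over U dV ->
  wV (U `&` ~` [set x | exists2 l, has_density m wV x l & (1 <= l)%E]) = 0%E ->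
  forall (E : set 'rV[R]_n), E `<=` U ->
  caratheodory_measurable (fun A => wV A + dV A)%E E ->
  forall (B : set 'rV[R]_n), closed B -> B `<=` Bdry U ->
  let bE := varnorm U (vbdry m U V E) in
  (forall (K : set 'rV[R]_n) (theta : 'rV[R]_n -> 'rV[R]_n),
     compact K -> K `<=` ~` B -> testfun (~` B) theta ->
     ((wV (E `&` K) + dV (E `&` K)) + bE (U `&` K) < +oo)%E /\
     int_div V (E `*` Gr R n m) theta =
       dist_restr U (first_var V) E (cut0 U theta)
       - L1_extension U (vbdry m U V E) (cut0 U theta)) ->
  forall (Q r : R), 1 <= Q -> Q <= M -> 0 < r ->
  (wV E <= ((Q - M^-1) * alpha R m * r ^+ m)%:E)%E ->
  (wV (E `&` [set x | exists2 l, has_density m wV x l & (l < Q%:E)%E])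
     <= (Lambda^-1 * r ^+ m)%:E)%E ->
  (pow00 (wV (E `&` [set x | eball x r `<=` ~` B])) (1 - m%:R^-1)
     <= Lambda%:E * (bE U + dV E))%E.
Proof.
(* As [m <= n <= M], a sum over all [i <= M] bounds the constants of all
   dimensions at once; [1 <= Lambda] gives [Lambda <= Lambda ^+ m]. *)
pose N := (Num.trunc M).+1.
pose term (i : nat) : R := `|iso_cst i (alpha R i) M| + `|(mass_lo i (alpha R i) M)^-1|.
have term0 i : 0 <= term i by rewrite addr_ge0.
pose Lambda := 1 + \sum_(i < N) term i.
have L1 : 1 <= Lambda by rewrite lerDl sumr_ge0.
have L0 : 0 < Lambda by exact: lt_le_trans L1.
exists Lambda; split=> // m n m0 mn nM U oU V vV wV dV rdV dens1 E EU mE B cB BU bE hE Q r Q1 QM r0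
  wEle wQ.
set A := [set x | _ ].
have D0 : (0 <= bE U + dV E)%E by apply: adde_ge0; exact: outer_measure_ge0.
have rhs0 : (0 <= Lambda%:E * (bE U + dV E))%E.
  by apply: mule_ge0 => //; rewrite lee_fin ltW.
have [w0|w0] := eqVneq (wV (E `&` A)) 0%E; first by rewrite w0 /pow00 eqxx.
have wpos : (0 < wV (E `&` A))%E by rewrite lt_neqAle eq_sym w0 outer_measure_ge0.
have [al0|al0] := leP (alpha R m) 0.
  exfalso; move/eqP: w0; apply; apply: outer_subset0 dens1 => x [Ex _]; split; first exact: EU.
  by move=> [l hd l1]; exact: (alpha_le0_density al0 hd l1).
have [Dfin|] := boolP (bE U + dV E < +oo)%E; last first.
  rewrite -leNgt leye_eq => /eqP ->; rewrite mulry gtr0_sg// mul1e.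
  exact: leey.
have dE : (dV E < +oo)%E.
  by apply: le_lt_trans Dfin; rewrite leeDr// outer_measure_ge0.
have bEfin : (bE U < +oo)%E.
  by apply: le_lt_trans Dfin; rewrite leeDl// outer_measure_ge0.
have Df : (bE U + dV E)%E \is a fin_num by rewrite ge0_fin_numE.
have mN : (m < N)%N.
  rewrite /N ltnS; apply: leq_trans mn _.
  by rewrite truncn_ge_nat// (le_trans ler01).
have termL : 1 + term m <= Lambda.
  by rewrite lerD2l (bigD1 (Ordinal mN))//= lerDl sumr_ge0.
have cpos := @consts_gt0 R m m0 (alpha R m) M al0 hM.
have [_ _ _ c20 _] := cpos.
have hE' theta : testfun (~` B) theta -> int_div V (E `*` Gr R n m) theta =
       dist_restr U (first_var V) E (cut0 U theta)
       - L1_extension U (vbdry m U V E) (cut0 U theta).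
  by move=> tt; have [] := hE set0 theta compact0 (@sub0set _ _) tt.
have wQ' : (wV (E `&` [set x | exists2 l, has_density m wV x l & (l < Q%:E)%E])
     <= (mass_lo m (alpha R m) M * r ^+ m)%:E)%E.
  apply: le_trans wQ _; rewrite lee_fin; apply: ler_wpM2r; first by rewrite exprn_ge0// ltW.
  rewrite invf_ple ?posrE//; apply: le_trans termL.
  rewrite /term; have := ler_norm (mass_lo m (alpha R m) M)^-1.
  have := normr_ge0 (iso_cst m (alpha R m) M); lra.
have h := @isoperimetric R n m U V m0 oU vV rdV dens1 E EU mE B hE' M Q r al0 hM Q1 QM r0
  dE bEfin wEle wQ' wpos.
have wE : (wV E < +oo)%E by exact: le_lt_trans wEle (ltry _).
rewrite -(fineK Df) -EFinM; apply: pow00_le => //.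
- exact: fin_setI.
- exact: fine_ge0.
- exact: ltW.
- apply: le_trans h _; rewrite exprMn; apply: ler_wpM2r.
    by rewrite exprn_ge0// fine_ge0.
  apply: le_trans (ler_norm _) _; apply: (@le_trans _ _ Lambda).
    apply: le_trans termL; rewrite /term.
    have := normr_ge0 (mass_lo m (alpha R m) M)^-1; lra.
  by exact: ler_eXnr.
Qed.
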